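(* Let $u, v \ge 1$ be integers with $\gcd(u,v)=1$ and let $\epsilon > 0$ be real. Then there is a constant $C = C(v,\epsilon) > 0$ such that the following holds. Let $\alpha \in \mathbb{R}\setminus\mathbb{Q}$, $\beta \in \mathbb{R}$, let $N \ge 1$ be a real number and let $\Delta \in (0,1/2)$. Suppose that $a, q \in \mathbb{Z}$ are coprime with $q > N^{1/4}$ and $|\alpha v - a/q| \le 1/q^2$. Set $\mathcal{L} = \log(Nq/\Delta)$. Then $$\left| \sum_{\substack{1 \le n \le N \\ n \equiv u \bmod v}} \Lambda(n)\bigl(f_{\Delta}(\alpha n - \beta) - 2\Delta\bigr) \right| \le C\, \mathcal{L}^8 \left( N q^{-1/2} + N^{3/4} + N^{5/6}\Delta^{1/2} + (\Delta N q)^{1/2} + N^{\epsilon} q \Delta^{1-\epsilon} \right).$$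
   Context: $\Lambda$ denotes the von Mangoldt function. For real $y$, $\|y\|$ denotes the distance from $y$ to the nearest integer. For $\Delta \in (0,1/2)$, the function $f_\Delta : \mathbb{R} \to \{0,1\}$ is defined by $f_\Delta(\theta) = 1$ if $\|\theta\| < \Delta$ and $f_\Delta(\theta) = 0$ otherwise. *)

(* Defs.v *)
From HB Require Import structures.
From mathcomp Require Import all_boot all_order all_algebra.
From mathcomp Require Import all_classical all_reals.
From mathcomp Require Import exp.

Set Implicit Arguments.
Unset Strict Implicit.
Unset Printing Implicit Defensive.

Import Order.TTheory GRing.Theory Num.Theory.

Local Open Scope classical_set_scope.
Local Open Scope ring_scope.

(* The sum has at most one term: it runs over the primes p of which n is a
   power with exponent at least 1 (p and the exponent are at most n). *)
Definition von_mangoldt (R : realType) (n : nat) : R :=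
  \sum_(p < n.+1 | prime p && [exists k : 'I_n.+1, (0 < k)%N && (n == p ^ k)%N])
    ln (p%:R : R).

Lemma von_mangoldt_pow (R : realType) (p k : nat) :
  prime p -> (0 < k)%N -> von_mangoldt R (p ^ k) = ln p%:R.
Proof.
move=> pp k0; rewrite /von_mangoldt.
have p1 := prime_gt1 pp.
have ltp : (p < (p ^ k).+1)%N by rewrite ltnS -{1}(expn1 p) leq_exp2l.
have ltk : (k < (p ^ k).+1)%N by rewrite ltnS ltnW // ltn_expl.
rewrite (big_pred1 (Ordinal ltp)) // => i /=; apply/idP/eqP => [|->/=].
  move=> /andP[ip /existsP[j /andP[j0 /eqP e]]]; apply: val_inj => /=.
  have : (i %| i ^ j)%N by rewrite dvdn_exp.
  rewrite -e.
  by rewrite Euclid_dvdX // k0 andbT dvdn_prime2 // => /eqP.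
by rewrite pp; apply/existsP; exists (Ordinal ltk); rewrite /= k0 eqxx.
Qed.

Lemma von_mangoldt_eq0 (R : realType) (n : nat) :
  (forall p k, prime p -> (0 < k)%N -> n <> (p ^ k)%N) -> von_mangoldt R n = 0.
Proof.
move=> h; rewrite /von_mangoldt big_pred0 // => i; apply/negP.
by move=> /andP[ip /existsP[j /andP[j0 /eqP e]]]; exact: (h _ _ ip j0 e).
Qed.

Definition dist_int (R : realType) (y : R) : R :=
  inf [set `|y - m%:~R| | m in [set: int]].

Definition f_Delta (R : realType) (Delta theta : R) : R :=
  if dist_int theta < Delta then 1 else 0.

(* Main.v *)
Require Import Defs.
From HB Require Import structures.
From mathcomp Require Import all_boot all_order all_algebra.
From mathcomp Require Import all_classical all_reals.
From mathcomp Require Import topology normedtype derive realfun exp trigo.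
From mathcomp Require Import complex ring lra zify.

(** The number of [n <= N] for which [alpha n - beta] falls in an arc is
    controlled by the exponential sums [S(h)] of [von_mangoldt n] against
    [exp (2 i pi h alpha n)], over [n] congruent to [u] modulo [v], for
    frequencies [h] up to about [1 / Delta] and, with weight [1 / h], beyond.
    Three ranges of the parameters are treated separately.

    If [Delta <= N ^ (-1/4)], the term [N ^ (3/4)] absorbs the main term, and it
    is enough to count the points in the arc, which are well spaced
    ([short_arc]). If [q Delta >= N], the last term of the bound is trivial
    ([large_denominator]). In the remaining range, [long_arc], both [q] and
    [1 / Delta] are bounded by powers of [N].

    There [alpha] and [beta] are rounded to fractions with denominator
    [M = 16 v N ^ 3]. On the residues modulo [M] an arc is a window of consecutive
    classes, and its Fourier expansion is finite ([completing], [window_sum]),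
    with coefficients at most [min Delta (1 / h)]. It remains to bound the sum of
    [|S(h)|] over [h <= H] ([prime_sum]) and to sum over dyadic values of [H]
    ([frequency_sum]).

    Vaughan's identity ([vaughan]) with both cuts at [U], about [N ^ (1/3)],
    splits [S(h)] into two kinds of sums over products [m k]. When [m <= U] and
    the weight of [k] is smooth, the sum over [k] is geometric, and the total is
    estimated through the distances of the multiples [h m alpha v] from the
    integers ([multiples_sum]); collecting the pairs [(h, m)] with a given
    product costs a divisor function, hence a factor [N ^ epsilon]. This is
    harmless since [q > N ^ (1/4)], except in the term
    [N ^ epsilon q Delta ^ (1 - epsilon)].

    In the other sums both variables are at most [N ^ (2/3)], up to a constant,
    and one of them, [m], is at most [N ^ (1/2)]. Here a factor [N ^ epsilon]
    would be too much, so [h m] is treated as a single variable in Cauchy's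
    inequality ([type2_half]): the multiplicities then enter in mean square,
    which costs only logarithms, and the remaining square is expanded
    ([large_sieve]). The condition [m k <= N], which is not one on [h m], is first
    removed by completing the sum over [k] ([inner_complete]). With [H] equal to
    [1 / Delta] the outcome is the sum of [N q ^ (-1/2)],
    [(Delta N N ^ (2/3)) ^ (1/2)], [(N N ^ (1/2)) ^ (1/2)] and
    [(Delta N q) ^ (1/2)], which are the first four terms of the bound.

    The natural number [l] in the bounds below stands for a logarithm: all
    quantities are less than [2 ^ l]. *)

Set Implicit Arguments.
Unset Strict Implicit.
Unset Printing Implicit Defensive.

Import Order.TTheory GRing.Theory Num.Theory.
Import numFieldNormedType.Exports.

Local Open Scope ring_scope.

(** * Complex numbers and additive characters *)

Section ComplexModulus.
Variable R : realType.
Implicit Types (z w : R[i]).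

(** The norm of [R[i]] has values in [R[i]] itself; here a modulus in [R] is
    needed, to be compared with real bounds. *)
Definition cabs z : R := ComplexField.Normc.normc z.

Lemma cabsM z w : cabs (z * w) = cabs z * cabs w.
Proof. exact: ComplexField.Normc.normcM. Qed.

Lemma cabsD z w : cabs (z + w) <= cabs z + cabs w.
Proof. exact: le_normcD. Qed.

Lemma cabsN z : cabs (- z) = cabs z.
Proof. exact: normcN. Qed.

Lemma cabs0 : cabs 0 = 0.
Proof. exact: ComplexField.Normc.normc0. Qed.

Lemma cabs_ge0 z : 0 <= cabs z.
Proof. by case: z => a b; rewrite /cabs /= sqrtr_ge0. Qed.

Lemma cabs_real (r : R) : cabs r%:C%C = `|r|.
Proof. by rewrite /cabs /= expr0n /= addr0 sqrtr_sqr. Qed.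

Lemma cabsV z : cabs z^-1 = (cabs z)^-1.
Proof. exact: ComplexField.Normc.normcV. Qed.

Lemma cabsJ z : cabs (z^*%C) = cabs z.
Proof. by case: z => a b; rewrite /cabs /= sqrrN. Qed.

Lemma conjc_mul z w : ((z * w)^*%C = z^*%C * w^*%C).
Proof. exact: rmorphM. Qed.

Lemma cabs_sqr z : ((cabs z ^+ 2)%:C)%C = z * z^*%C.
Proof. by rewrite -sqr_normc normc_def rmorphXn; case: z. Qed.

Lemma cabs_nat (n : nat) : cabs n%:R = n%:R.
Proof. by rewrite -[n%:R](rmorph_nat (@real_complex R)) cabs_real normr_nat. Qed.

Lemma cabs_sum (I : Type) (r : seq I) (P : pred I) (F : I -> R[i]) :
  cabs (\sum_(i <- r | P i) F i) <= \sum_(i <- r | P i) cabs (F i).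
Proof.
elim/big_ind2 : _ => //; first by rewrite cabs0.
by move=> z x w y zx wy; rewrite (le_trans (cabsD _ _)) // lerD.
Qed.

End ComplexModulus.
Arguments cabs : simpl never.

Section ComplexExponential.
Variable R : realType.
Implicit Types x y : R.

(** The character [exp (2 i pi x)] of the circle. *)
Definition e2pi x : R[i] := (cos (pi *+ 2 * x) +i* sin (pi *+ 2 * x))%C.

Lemma e2piD x y : e2pi (x + y) = e2pi x * e2pi y.
Proof.
by apply/eqP; rewrite eq_complex /= mulrDr cosD sinD eqxx /= addrC [X in X + _]mulrC mulrC.
Qed.

Lemma e2pi0 : e2pi 0 = 1.
Proof. by rewrite /e2pi mulr0 cos0 sin0. Qed.

Lemma e2piN x : e2pi (- x) = (e2pi x)^*%C.
Proof. by rewrite /e2pi mulrN cosN sinN. Qed.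

Lemma cabs_e2pi x : cabs (e2pi x) = 1.
Proof. by rewrite /cabs /= cos2Dsin2 sqrtr1. Qed.

Lemma e2pi1 : e2pi 1 = 1.
Proof. by rewrite /e2pi mulr1 cos2pi sin2pi. Qed.

Lemma e2piMn x n : e2pi (x *+ n) = e2pi x ^+ n.
Proof. by elim: n => [|n IH]; rewrite ?e2pi0 // mulrSr e2piD IH exprSr. Qed.

Lemma e2pi_nat (n : nat) : e2pi n%:R = 1.
Proof. by rewrite e2piMn e2pi1 expr1n. Qed.

Lemma e2pi_int (z : int) : e2pi z%:~R = 1.
Proof.
case: z => n; first by rewrite e2pi_nat.
by rewrite NegzE mulrNz e2piN e2pi_nat conjc1.
Qed.

(** The distance on the unit circle that plays the role of the distance from
    [x] to the nearest integer: it is subadditive, and comparable with it. *)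
Definition chord x : R := cabs (1 - e2pi x).

Lemma chord_ge0 x : 0 <= chord x. Proof. exact: cabs_ge0. Qed.

Lemma chord0 : chord 0 = 0.
Proof. by rewrite /chord e2pi0 subrr cabs0. Qed.

Lemma chordD x y : chord (x + y) <= chord x + chord y.
Proof.
have -> : chord (x + y) = cabs ((1 - e2pi x) + e2pi x * (1 - e2pi y)).
  by congr cabs; rewrite e2piD; ring.
by rewrite (le_trans (cabsD _ _))// cabsM cabs_e2pi mul1r.
Qed.

Lemma chordN x : chord (- x) = chord x.
Proof.
rewrite /chord -[RHS]cabsJ; congr cabs.
by rewrite e2piN; apply/eqP; rewrite eq_complex /= !sub0r !opprK !eqxx.
Qed.

Lemma chordD_int x (z : int) : chord (x + z%:~R) = chord x.
Proof. by rewrite /chord e2piD e2pi_int mulr1. Qed.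

Lemma chordMn x n : chord (n%:R * x) <= n%:R * chord x.
Proof.
elim: n => [|n IH]; first by rewrite !mul0r chord0.
rewrite -addn1 natrD !mulrDl !mul1r; apply: (le_trans (chordD _ _)).
by rewrite lerD2r.
Qed.

Lemma chord_sub x y : chord x - chord y <= chord (x - y).
Proof. by rewrite lerBlDr -{1}(subrK y x) chordD. Qed.

Lemma chord_sqr x : chord x ^+ 2 = 2 * (1 - cos (pi *+ 2 * x)).
Proof.
rewrite /chord /cabs /= sqr_sqrtr ?addr_ge0 ?sqr_ge0 // add0r sqrrN sin2cos2.
by ring.
Qed.

Lemma chord_le2 x : chord x <= 2.
Proof.
rewrite -(@ler_pXn2r _ 2) ?nnegrE ?chord_ge0 // chord_sqr.
have := cos_geN1 (pi *+ 2 * x); lra.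
Qed.

Lemma sin_le_id x : 0 <= x -> sin x <= x.
Proof.
move=> x0; have [c _] : exists2 c, c \in `[0, x] &
    sin x - sin 0 = cos c * (x - 0).
  apply: MVT_segment => //.
  exact/continuous_subspaceT/continuous_sin.
rewrite sin0 !subr0 => ->; rewrite -[leRHS]mul1r ler_wpM2r //.
exact: cos_le1.
Qed.

Lemma chord_sin x : chord x = 2 * `|sin (pi * x)|.
Proof.
apply/eqP; rewrite -(@eqrXn2 _ 2) ?chord_ge0 ?mulr_ge0 // chord_sqr.
rewrite [pi *+ 2 * x]mulrnAl cos_mulr2n exprMn real_normK ?num_real // cos2sin2.
by apply/eqP; ring.
Qed.

Lemma chord_le x : chord x <= 2 * pi * `|x|.
Proof.
wlog x0 : x / 0 <= x => [hw|].
  have [/hw//|x0] := leP 0 x.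
  by rewrite -chordN -normrN hw // oppr_ge0 ltW.
rewrite chord_sin -mulrA ler_pM2l // (ger0_norm x0) ler_norml.
have px : 0 <= pi * x by rewrite mulr_ge0 ?pi_ge0.
rewrite sin_le_id // andbT.
have [pi_ge|lt_pi] := leP pi (pi * x).
  by have := sin_geN1 (pi * x); have := pi_ge2 R; lra.
by have := @sin_ge0_pi _ (pi * x); rewrite px ltW // => /(_ isT); lra.
Qed.

(** Multiplying the angle by [n] multiplies the chord by at most [n]. Hence a
    short arc can be compared with its largest multiple below the half circle,
    whose chord is at least [1]. *)
Lemma chord_ge x : `|x| <= 1 / 2 -> 2 * `|x| <= chord x.
Proof.
wlog x0 : x / 0 <= x => [hw|].
  have [/hw//|x0] := leP 0 x.
  by rewrite -chordN -normrN; apply: hw; rewrite oppr_ge0 ltW.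
rewrite (ger0_norm x0) => x12.
have far y : 1 / 4 <= y -> y <= 1 / 2 -> 1 <= chord y.
  move=> y1 y2; rewrite -(@ler_pXn2r _ 2) ?nnegrE ?chord_ge0 // chord_sqr.
  rewrite expr1n.
  have -> : pi *+ 2 * y = (pi *+ 2 * y - pi / 2) + pi / 2 :> R by ring.
  rewrite cosDpihalf.
  suff : 0 <= sin (pi *+ 2 * y - pi / 2) by lra.
  have p2 := pi_ge2 R; apply: sin_ge0_pi; apply/andP; split; nra.
have [x14|x14] := leP (1 / 4) x.
  by have := far _ x14 x12; lra.
have [->|xn0] := eqVneq x 0; first by rewrite mulr0 chord_ge0.
have xp : 0 < x by rewrite lt_neqAle eq_sym xn0.
have xv : 0 <= 1 / (2 * x) by rewrite divr_ge0 // mulr_ge0.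
have /andP[n1 n2] := truncn_itv xv.
set n := Num.truncn _ in n1 n2.
have n1' : n%:R * x <= 1 / 2.
  by move: n1; rewrite ler_pdivlMr ?mulr_gt0 //; lra.
have n2' : 1 / 2 < n.+1%:R * x.
  by move: n2; rewrite ltr_pdivrMr ?mulr_gt0 //; lra.
have := far (n%:R * x); rewrite -[n.+1]addn1 natrD mulrDl mul1r in n2'.
move=> /(_ ltac:(lra) n1') h.
have np : 0 < n%:R :> R by nra.
have := chordMn x n => h2.
rewrite -(ler_pM2l np); nra.
Qed.

End ComplexExponential.

(** * Geometric sums and completion *)

Section GeometricSums.
Variable R : realType.
Implicit Types x y : R.

Lemma chord_frac_ge (r P : nat) : (0 < P)%N -> (r <= P)%N ->
  2 * (minn r (P - r))%:R / P%:R <= chord (r%:R / P%:R : R).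
Proof.
move=> P0 rP; have P0' : 0 < P%:R :> R by rewrite ltr0n.
have [r1|r1] := leqP r (P - r).
  rewrite -[leLHS]mulrA -[X in 2 * X]ger0_norm ?divr_ge0 //.
  apply: chord_ge; rewrite ger0_norm ?divr_ge0 // ler_pdivrMr //.
  have : (2 * r)%:R <= P%:R :> R by rewrite ler_nat; lia.
  by rewrite natrM; lra.
have -> : chord (r%:R / P%:R) = chord ((P - r)%:R / P%:R : R).
  rewrite -chordN natrB // mulrBl divff ?gt_eqF // addrC.
  by rewrite -[RHS](chordD_int _ (-1)) addrK.
rewrite -[leLHS]mulrA -[X in 2 * X]ger0_norm ?divr_ge0 //.
apply: chord_ge; rewrite ger0_norm ?divr_ge0 // ler_pdivrMr //.
have : (2 * (P - r))%:R <= P%:R :> R by rewrite ler_nat; lia.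
by rewrite natrM; lra.
Qed.

(** The size of a geometric sum with [Y] terms of frequency [x]. This form of
    [min Y (1 / chord x)] is correct when [chord x] vanishes, where the inverse
    would take the default value [0]. *)
Definition chord_cap (Y x : R) : R := (Num.max (chord x) Y^-1)^-1.

Lemma chord_cap_ge0 Y x : 0 <= chord_cap Y x.
Proof. by rewrite invr_ge0 le_max chord_ge0. Qed.

Lemma chord_cap_le Y x : 0 < Y -> chord_cap Y x <= Y.
Proof.
move=> Y0; rewrite -[leRHS]invrK lef_pV2 ?posrE ?invr_gt0 //.
  by rewrite le_max lexx orbT.
by rewrite lt_max invr_gt0 Y0 orbT.
Qed.

Lemma chord_cap_le_inv Y x c : 0 < c -> c <= chord x -> chord_cap Y x <= c^-1.
Proof.
move=> c0 cx; rewrite lef_pV2 ?posrE //; first by rewrite le_max cx.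
by rewrite lt_max (lt_le_trans c0).
Qed.

Lemma chord_cap_mono Y Y' x : 0 < Y -> Y <= Y' -> chord_cap Y x <= chord_cap Y' x.
Proof.
move=> Y0 YY'; have Y0' := lt_le_trans Y0 YY'.
rewrite lef_pV2 ?posrE ?lt_max ?invr_gt0 ?Y0 ?Y0' ?orbT //.
rewrite ge_max !le_max lexx /= lef_pV2 ?posrE // YY'.
by rewrite orbT.
Qed.

Lemma chord_cap_le_cap Y Y' x : 0 < Y' -> Y'^-1 <= chord x -> chord_cap Y x <= chord_cap Y' x.
Proof.
move=> Y0 h; have -> : chord_cap Y' x = (chord x)^-1 by rewrite /chord_cap max_l.
have c0 : 0 < chord x by apply: lt_le_trans h; rewrite invr_gt0.
exact: chord_cap_le_inv.
Qed.

(** Passing from [x] to [v x] kills fractions with denominator [v] and costs only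
    a factor [v]; this is how the congruence condition is absorbed. *)
Lemma chord_cap_mulr Y x (v : nat) z : (0 < v)%N -> 0 < Y ->
  chord z = chord (v%:R * x) -> chord_cap Y x <= v%:R * chord_cap Y z.
Proof.
move=> v0 Y0 zx; have v0' : 0 < v%:R :> R by rewrite ltr0n.
have v1 : 1 <= v%:R :> R by rewrite ler1n.
have m0 y : 0 < Num.max (chord y) Y^-1 by rewrite lt_max invr_gt0 Y0 orbT.
rewrite -[X in X * _]invrK -invfM lef_pV2 ?posrE //; last first.
  by rewrite mulr_gt0 // invr_gt0.
rewrite mulrC ler_pdivrMr // mulrC ge_max; apply/andP; split.
  rewrite zx (le_trans (chordMn _ _)) // ler_wpM2l ?(ltW v0') //.
  by rewrite le_max lexx.
have Yi : 0 < Y^-1 by rewrite invr_gt0.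
apply: (@le_trans _ _ (v%:R * Y^-1)); first by rewrite ler_peMl // ltW.
by rewrite ler_wpM2l ?(ltW v0') // le_max lexx orbT.
Qed.

Lemma chord_capN Y x : chord_cap Y (- x) = chord_cap Y x.
Proof. by rewrite /chord_cap chordN. Qed.

Lemma geom_le (a b : nat) x :
  cabs (\sum_(a <= n < b) e2pi (n%:R * x)) <= 2 * chord_cap (b - a)%:R x.
Proof.
have [ba|ab] := leqP b a.
  by rewrite big_geq // cabs0 mulr_ge0 // chord_cap_ge0.
have -> : \sum_(a <= n < b) e2pi (n%:R * x) =
   e2pi (a%:R * x) * \sum_(0 <= i < b - a) e2pi x ^+ i.
  rewrite -{1}[a]add0n big_addn big_distrr; apply: eq_bigr => i _ /=.
  by rewrite natrD mulrDl e2piD [i%:R * x]mulr_natl e2piMn mulrC.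
rewrite cabsM cabs_e2pi mul1r.
have Y0 : 0 < (b - a)%:R :> R by rewrite ltr0n subn_gt0.
set Y := (b - a)%N in Y0 *.
have tr : cabs (\sum_(0 <= i < Y) e2pi x ^+ i) <= Y%:R.
  apply: (le_trans (cabs_sum _ _ _)).
  rewrite (eq_bigr (fun=> 1)) => [|i _]; last first.
    by rewrite -e2piMn cabs_e2pi.
  by rewrite big_const_nat iter_addr addr0 subn0.
have [h|h] := leP (chord x) Y%:R^-1.
  rewrite /chord_cap max_r // invrK (le_trans tr) //; lra.
rewrite /chord_cap max_l ?(ltW h) //.
have c0 : 0 < chord x by apply: lt_trans h; rewrite invr_gt0.
rewrite ler_pdivlMr // -cabsM mulrC.
have -> : (1 - e2pi x) * \sum_(0 <= i < Y) e2pi x ^+ i = 1 - e2pi (Y%:R * x).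
  rewrite [Y%:R * x]mulr_natl e2piMn -[in RHS]opprB subrX1 big_mkord -mulNr.
  by rewrite opprB.
exact: chord_le2.
Qed.

Lemma sum_unity_roots (P : nat) (j : int) : (0 < P)%N ->
  \sum_(0 <= t < P) e2pi (t%:R * (j%:~R / P%:R : R)) =
  if (P%:Z %| j)%Z then P%:R else 0.
Proof.
move=> P0; have Pn0 : P%:R != 0 :> R by rewrite pnatr_eq0 -lt0n.
case: ifPn => [/dvdzP[k ->]|ndvd].
  rewrite (eq_bigr (fun=> 1)) => [|t _].
    by rewrite big_const_nat iter_addr addr0 subn0.
  rewrite intrM mulfK // -[t%:R]/((t%:Z)%:~R) -intrM; exact: e2pi_int.
set x := j%:~R / P%:R.
have z1 : e2pi x - 1 != 0.
  rewrite -[_ - 1]opprB oppr_eq0; apply/eqP => e0.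
  have c0 : chord x = 0 by rewrite /chord e0 cabs0.
  have := c0; rewrite /x (divz_eq j P%:Z) intrD intrM mulrDl mulfK //.
  rewrite addrC chordD_int.
  have r0 := modz_ge0 j (d := P%:Z) ltac:(by rewrite eqz_nat -lt0n).
  have rP := ltz_pmod j (d := P%:Z) ltac:(by []).
  have rn0 : (j %% P)%Z != 0 by apply: contra ndvd => /eqP/dvdz_mod0P.
  case: (j %% P)%Z r0 rP rn0 => // r _ rP rn0.
  have := @chord_frac_ge r P P0; rewrite ltnW // => /(_ isT) h h'.
  move: h; rewrite -[r%:R]/((r%:Z)%:~R) h'; apply/negP; rewrite -ltNge.
  rewrite divr_gt0 ?mulr_gt0 ?ltr0n //.
  by move: rP rn0; rewrite ltz_nat leq_min subn_gt0 => -> ; lia.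
apply: (mulfI z1); rewrite mulr0.
rewrite (eq_bigr (fun t : nat => e2pi x ^+ t)) => [|t _]; last first.
  by rewrite mulr_natl e2piMn.
rewrite big_mkord -subrX1 -e2piMn -mulr_natl /x mulrC divfK // e2pi_int subrr //.
Qed.

(** Completing an incomplete sum: expand the indicator of [k < X] in additive
    characters modulo [P]; the zero frequency gives the expected main term. *)
Lemma completing (P X : nat) (c : nat -> R[i]) : (0 < P)%N -> (X <= P)%N ->
  cabs (\sum_(0 <= k < X) c k - X%:R / P%:R * \sum_(0 <= k < P) c k) <=
  P%:R^-1 * \sum_(1 <= t < P) (2 * chord_cap X%:R (t%:R / P%:R)) *
     cabs (\sum_(0 <= k < P) c k * e2pi (k%:R * (t%:R / P%:R))).
Proof.
move=> P0 XP; have Pn0 : P%:R != 0 :> R[i] by rewrite pnatr_eq0 -lt0n.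
pose G (t : nat) := \sum_(0 <= j < X) e2pi (- (j%:R * (t%:R / P%:R : R))).
pose S (t : nat) := \sum_(0 <= k < P) c k * e2pi (k%:R * (t%:R / P%:R : R)).
have key : \sum_(0 <= k < X) c k = P%:R^-1 * \sum_(0 <= t < P) G t * S t.
  apply: (mulfI Pn0); rewrite mulVKf //.
  under [RHS]eq_bigr do rewrite /G /S big_distrl /=.
  rewrite exchange_big /= big_distrr /=; apply: eq_big_nat => j /andP[_ jX].
  under eq_bigr do rewrite big_distrr /=.
  rewrite exchange_big /=.
  rewrite (bigD1_seq j) ?mem_index_iota ?iota_uniq //=; last first.
    exact: leq_trans jX XP.
  rewrite [X in _ + X]big1_seq ?addr0 => [|k /andP[kj]].
    rewrite (eq_bigr (fun=> c j)) => [|t _]; last first.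
      by rewrite mulrCA -e2piD addNr e2pi0 mulr1.
    by rewrite big_const_nat iter_addr addr0 subn0 mulr_natl.
  rewrite mem_index_iota => /andP[_ kP].
  under eq_bigr => t _.
    rewrite mulrCA -e2piD.
    rewrite (_ : _ + _ = t%:R * ((k%:Z - j%:Z)%:~R / P%:R)); last first.
      by rewrite intrB /=; ring.
    over.
  rewrite -big_distrr /= sum_unity_roots //; have jP := leq_trans jX XP.
  by rewrite -eqz_mod_dvd !modz_nat eqz_nat !modn_small // (negPf kj) mulr0.
rewrite key big_ltn // mulrDr.
have -> : P%:R^-1 * (G 0%N * S 0%N) = X%:R / P%:R * \sum_(0 <= k < P) c k.
  rewrite /G /S.
  under eq_bigr do rewrite mul0r mulr0 oppr0 e2pi0.
  under [X in _ * (_ * X)]eq_bigr do rewrite mul0r mulr0 e2pi0 mulr1.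
  by rewrite big_const_nat iter_addr addr0 subn0 mulrA [_^-1 * _]mulrC.
rewrite addrC addKr cabsM cabsV cabs_nat ler_wpM2l ?invr_ge0 //.
apply: (le_trans (cabs_sum _ _ _)); apply: ler_sum => t _.
rewrite cabsM ler_wpM2r ?cabs_ge0 // -[in leRHS](subn0 X) -chord_capN.
by rewrite /G; under eq_bigr do rewrite -mulrN; exact: geom_le.
Qed.

End GeometricSums.

(** * Sums over divisors, the Moebius and von Mangoldt functions *)

Section DivisorSums.

Lemma sum_nat_cut (V : nmodType) (f : nat -> V) (c : pred nat) (B M : nat) :
  (M <= B)%N -> (forall k, c k = (k <= M)%N) ->
  \sum_(1 <= k < B.+1 | c k) f k = \sum_(1 <= k < M.+1) f k.
Proof.
move=> MB cM; rewrite [LHS](@big_cat_nat _ _ _ M.+1) //=.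
rewrite [X in _ + X = _]big1_seq ?addr0 => [|k /andP[]]; last first.
  by rewrite cM mem_index_iota; lia.
by rewrite big_nat_cond [RHS]big_nat; apply: eq_bigl => k; rewrite cM; lia.
Qed.

Lemma sum_multiples (V : nmodType) (f : nat -> V) (d B M : nat) :
  (0 < d)%N -> (M <= B)%N ->
  \sum_(1 <= k < B.+1 | (d * k <= M)%N) f k =
  \sum_(1 <= n < M.+1 | (d %| n)%N) f (n %/ d)%N.
Proof.
move=> d0 MB.
transitivity (\sum_(1 <= k < B.+1) \sum_(1 <= n < M.+1 | n == (d * k)%N) f k).
  rewrite big_mkcond /=; apply: eq_big_nat => k /andP[k1 _].
  by rewrite big_nat1_eq ltnS muln_gt0 d0 k1.
rewrite (exchange_big_dep xpredT) //= [RHS]big_mkcond /=.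
apply: eq_big_nat => n /andP[n1 nM].
case: ifP => [/dvdnP[k nk]|ndn].
  move: n1 nM; rewrite {}nk => n1 nM; rewrite mulnK //.
  rewrite (eq_bigl (fun j => j == k)) => [|j]; last first.
    by rewrite mulnC eqn_pmul2l // eq_sym.
  rewrite big_nat1_eq; case: ifP => // /negP[].
  move: n1 nM; rewrite muln_gt0 !ltnS => /andP[-> _] /= h; nia.
rewrite big_pred0 // => k; apply/negbTE/negP => /eqP nk.
by move: ndn; rewrite nk dvdn_mulr.
Qed.

Lemma sum_divisors (V : nmodType) (f : nat -> V) (n B : nat) :
  (0 < n)%N -> (n <= B)%N ->
  \sum_(d <- divisors n) f d = \sum_(1 <= d < B.+1 | (d %| n)%N) f d.
Proof.
move=> n0 nB; rewrite -[RHS]big_filter; apply: perm_big.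
apply: uniq_perm; first exact: divisors_uniq.
  by rewrite filter_uniq ?iota_uniq.
move=> d; rewrite mem_filter mem_index_iota -dvdn_divisors //.
case: (boolP (d %| n)%N) => //= dn.
by rewrite ltnS (dvdn_gt0 n0 dn) (leq_trans (dvdn_leq n0 dn) nB).
Qed.

(** Dirichlet's hyperbola regrouping: lattice points under [d k <= M] are
    sorted by the value [n] of the product. *)
Lemma sum_hyperbola (V : nmodType) (G : nat -> nat -> V) (B M : nat) :
  (M <= B)%N ->
  \sum_(1 <= d < B.+1) \sum_(1 <= k < B.+1 | (d * k <= M)%N) G d k =
  \sum_(1 <= n < M.+1) \sum_(d <- divisors n) G d (n %/ d)%N.
Proof.
move=> MB.
transitivity (\sum_(1 <= d < B.+1) \sum_(1 <= n < M.+1 | (d %| n)%N)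
                G d (n %/ d)%N).
  by apply: eq_big_nat => d /andP[d1 _]; rewrite sum_multiples.
rewrite (exchange_big_dep xpredT) //=; apply: eq_big_nat => n /andP[n1 nM].
by rewrite -sum_divisors // (leq_trans _ MB).
Qed.

Lemma perm_codivisors (n : nat) : (0 < n)%N ->
  perm_eq [seq (n %/ d)%N | d <- divisors n] (divisors n).
Proof.
move=> n0.
have inv d : (d %| n)%N -> (n %/ (n %/ d))%N = d.
  by move=> dn; rewrite -{1}(divnK dn) mulKn // divn_gt0 ?(dvdn_gt0 n0 dn) // dvdn_leq.
apply: uniq_perm; last 1 first.
- move=> x; apply/mapP/idP => [[d]|]; rewrite -!dvdn_divisors // => xn.
    by move=> ->; rewrite dvdn_div.
  by exists (n %/ x)%N; rewrite ?inv // -dvdn_divisors // dvdn_div.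
- rewrite map_inj_in_uniq ?divisors_uniq // => d e.
  by rewrite -!dvdn_divisors // => dn en /(congr1 (divn n)); rewrite !inv.
exact: divisors_uniq.
Qed.

End DivisorSums.

Section Mobius.
Variable A : comNzRingType.

Definition mobius (n : nat) : A :=
  if all (fun p => logn p n == 1%N) (primes n) then (-1) ^+ size (primes n)
  else 0.

Lemma mobius_primeM (p d : nat) : prime p -> (0 < d)%N ->
  mobius (p * d) = if (p %| d)%N then 0 else - mobius d.
Proof.
move=> pp d0; have p0 := prime_gt0 pp.
rewrite /mobius; case: (boolP (p %| d)%N) => pd.
  case: ifP => // al; have := allP al p.
  rewrite mem_primes pp muln_gt0 p0 d0 dvdn_mulr //= lognM //.
  rewrite logn_prime // eqxx => /(_ isT)/eqP.
  have : (0 < logn p d)%N by rewrite logn_gt0 mem_primes pp d0.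
  by case: (logn p d).
have pe : perm_eq (primes (p * d)) (p :: primes d).
  apply: uniq_perm; rewrite ?primes_uniq //=.
    by rewrite primes_uniq mem_primes pp d0 pd.
  by move=> q; rewrite primesM // primes_prime // !inE.
rewrite (perm_all _ pe) (perm_size pe) /=.
have -> : logn p (p * d) == 1%N.
  by rewrite lognM // logn_prime // eqxx (lognE p d) (negPf pd) !andbF.
rewrite /= (eq_in_all (a2 := fun q => logn q d == 1%N)) => [|q].
  by case: ifP; rewrite ?oppr0 // exprS mulN1r.
rewrite mem_primes => /andP[pq /andP[_ qd]].
rewrite lognM // logn_prime //; case: (q =P p) => // e.
by rewrite -e qd in pd.
Qed.

(** Pairing each divisor [d] prime to [p] with [p d], for a fixed prime
    factor [p] of [n], cancels the whole sum. *)
Lemma sum_mobius (n : nat) : (0 < n)%N ->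
  \sum_(d <- divisors n) mobius d = (n == 1%N)%:R.
Proof.
move=> n0; case: eqP => [->|/eqP n1].
  by rewrite (_ : divisors 1 = [:: 1%N]) // big_seq1 /mobius.
have n2 : (1 < n)%N by rewrite ltn_neqAle eq_sym n1.
have pp := pdiv_prime n2; have pn := pdiv_dvd n.
set p := pdiv n in pp pn; have p0 := prime_gt0 pp.
have [m def_n] : exists m, n = (p * m)%N.
  by case/dvdnP: pn => m ->; exists m; rewrite mulnC.
have m0 : (0 < m)%N by move: n0; rewrite def_n muln_gt0 => /andP[].
rewrite (sum_divisors _ n0 (leqnn n)) (bigID (fun d => p %| d)%N) /=.
rewrite (eq_bigl (fun d => (p %| d) && (d %| n))%N) => [|d]; last first.
  by rewrite andbC.
rewrite big_mkcondr /=.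
have -> : \sum_(1 <= d < n.+1 | (p %| d)%N)
     (if (d %| n)%N then mobius d else 0) =
   \sum_(1 <= d < n.+1 | (p %| d)%N)
     (if (p * (d %/ p) %| n)%N then mobius (p * (d %/ p)) else 0).
  by apply: eq_bigr => d pd; rewrite [(p * _)%N]mulnC divnK.
rewrite -(@sum_multiples _ (fun k => if (p * k %| n)%N then mobius (p * k)
   else 0) p n n) //.
rewrite -big_mkcondr /=.
have -> : \sum_(1 <= k < n.+1 | (p * k <= n)%N && (p * k %| n)%N)
   mobius (p * k) = \sum_(1 <= k < n.+1 | (k %| n)%N && ~~ (p %| k)%N)
   - mobius k.
  rewrite big_mkcond [RHS]big_mkcond /=.
  apply: eq_big_nat => k /andP[k0 _]; rewrite mobius_primeM //.
  case: (boolP (p %| k)%N) => pk; first by rewrite andbF; case: ifP.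
  rewrite andbT [in RHS]def_n Gauss_dvdr; last by rewrite coprime_sym prime_coprime.
  rewrite [in X in if X then _ else _]def_n dvdn_pmul2l // leq_pmul2l //.
  by case: (boolP (k %| m)%N) => km; rewrite ?andbF // (dvdn_leq m0 km).
by rewrite sumrN addNr.
Qed.

End Mobius.

Section VonMangoldt.
Variable R : realType.

Lemma ln_prod (r : seq nat) (P : pred nat) (F : nat -> R) :
  (forall i, P i -> 0 < F i) ->
  ln (\prod_(i <- r | P i) F i) = \sum_(i <- r | P i) ln (F i) /\
  0 < \prod_(i <- r | P i) F i.
Proof.
move=> F0; elim/big_ind2 : _ => [|x z y w [<- x0] [<- y0]|i Pi].
- by rewrite ln1.
- by rewrite lnM ?posrE // mulr_gt0.
- by split => //; exact: F0.
Qed.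

(** Writing the value at [n] as a sum over all prime powers up to [B] makes the
    sum over the divisors of a number a count of exponents. *)
Lemma von_mangoldtE (n B : nat) : (0 < n)%N -> (n <= B)%N ->
  von_mangoldt R n = \sum_(0 <= p < B.+1 | prime p)
    \sum_(1 <= k < B.+1) (n == p ^ k)%N%:R * ln p%:R.
Proof.
move=> n0 nB.
transitivity (\sum_(0 <= p < B.+1 | prime p && (n == p ^ (logn p n))%N && (0 < logn p n)%N) ln (p%:R : R)).
  rewrite /von_mangoldt.
  rewrite -(big_mkord (fun p => prime p && [exists k : 'I_n.+1, (0 < k)%N && (n == p ^ k)%N]) (fun p : nat => ln p%:R)).
  rewrite [LHS]big_mkcond [RHS]big_mkcond /=.
  rewrite [RHS](@big_cat_nat _ _ _ n.+1) //= [X in _ + X]big1_seq ?addr0.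
    apply: eq_big_nat => p /andP[_ pn]; congr (if _ then _ else _).
    case: (boolP (prime p)) => //= pp.
    apply/existsP/andP => [[k /andP[k0 /eqP ->]]|[/eqP e l0]].
      by rewrite pfactorK // eqxx.
    have ln : (logn p n < n.+1)%N by rewrite ltnS ltnW // ltn_logl.
    by exists (Ordinal ln); rewrite /= l0 e pfactorK //= eqxx.
  move=> p /andP[_]; rewrite mem_index_iota => /andP[np _].
  case: ifP => // /andP[/andP[pp _]]; rewrite logn_gt0 mem_primes => /andP[_ /andP[_ pdn]].
  by have := dvdn_leq n0 pdn; lia.
rewrite [LHS]big_mkcond [RHS]big_mkcond /=; apply: eq_bigr => p _.
case: (boolP (prime p)) => //= pp.
rewrite -big_distrl /=.
case: ifP => [/andP[/eqP e l0]|h].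
  rewrite (bigD1_seq (logn p n)) ?iota_uniq //=; last first.
    rewrite mem_index_iota l0 /= ltnS; apply: leq_trans nB.
    by rewrite ltnW // ltn_logl.
  rewrite -e eqxx big1_seq ?addr0 ?mul1r // => k /andP[kl _].
  case: eqP => // ek; move: kl; rewrite ek pfactorK // eqxx //.
rewrite big1_seq ?mul0r // => k /=; rewrite mem_index_iota => /andP[k0 _].
case: eqP => // ek; move: h; rewrite ek pfactorK // eqxx k0 //.
Qed.

(** Each prime [p] contributes [ln p] once for every exponent up to [logn p n],
    and these add up to the logarithm of the prime factorization. *)
Lemma sum_von_mangoldt (n : nat) : (0 < n)%N ->
  \sum_(d <- divisors n) von_mangoldt R d = ln n%:R.
Proof.
move=> n0; rewrite (sum_divisors _ n0 (leqnn n)).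
rewrite big_mkcond /=.
transitivity (\sum_(1 <= d < n.+1) \sum_(0 <= p < n.+1 | prime p)
    \sum_(1 <= k < n.+1) (if (d %| n)%N then (d == p ^ k)%N%:R * ln (p%:R : R) else 0)).
  apply: eq_big_nat => d /andP[d0 dn]; case: ifP => _.
    by rewrite (von_mangoldtE d0 dn).
  by rewrite big1 // => p _; rewrite big1.
rewrite exchange_big /=.
transitivity (\sum_(0 <= p < n.+1 | prime p) ln ((p%:R : R) ^+ logn p n)).
  rewrite big_nat_cond [RHS]big_nat_cond.
  apply: eq_bigr => p /andP[_ pp]; have p0 := prime_gt0 pp.
  rewrite lnXn ?ltr0n // exchange_big /=.
  transitivity (\sum_(1 <= k < n.+1 | (k <= logn p n)%N) ln (p%:R : R)).
    rewrite [RHS]big_mkcond /=; apply: eq_big_nat => k /andP[k0 kn].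
    rewrite -pfactor_dvdn //; case: (boolP (p ^ k %| n)%N) => pk.
      rewrite (bigD1_seq (p ^ k)%N) ?iota_uniq //=; last first.
        by rewrite mem_index_iota expn_gt0 p0 /= ltnS dvdn_leq.
      rewrite pk eqxx mul1r big1 ?addr0 // => d /negPf ->.
      by rewrite mul0r; case: ifP.
    rewrite big1 // => d _; case: ifP => // dn; case: eqP => [de|]; rewrite ?mul0r //.
    by rewrite -de dn in pk.
  have lb : (logn p n < n.+1)%N by rewrite ltnS ltnW // ltn_logl.
  rewrite (@big_cat_nat _ _ _ (logn p n).+1) //= [X in _ + X]big1_seq ?addr0.
    rewrite big_nat_cond (eq_bigl (fun i => (0 < i < (logn p n).+1)%N)).
      by rewrite -big_nat big_const_nat iter_addr addr0 subn1.
    by move=> i; lia.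
  by move=> k /andP[h]; rewrite mem_index_iota; lia.
have [|<- _] := @ln_prod (index_iota 0 n.+1) prime (fun p => (p%:R : R) ^+ logn p n).
  by move=> p pp; rewrite exprn_gt0 // ltr0n prime_gt0.
congr ln; rewrite -[in RHS](partn_pi n0) /partn natr_prod.
rewrite [LHS]big_mkcond [RHS]big_mkcond /=; apply: eq_big_nat => p /andP[_ pn].
rewrite natrX; case: (boolP (prime p)) => pp.
  case: ifP => //; rewrite mem_primes pp n0 /= => /negbT h.
  by rewrite lognE pp n0 (negPf h) expr0.
by case: ifP => // /=; rewrite mem_primes (negPf pp).
Qed.

Lemma von_mangoldt_ge0 (n : nat) : 0 <= von_mangoldt R n.
Proof.
rewrite /von_mangoldt; apply: sumr_ge0 => p /andP[pp _].
by rewrite ln_ge0 // ler1n prime_gt0.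
Qed.

Lemma von_mangoldt_le (n : nat) : (0 < n)%N -> von_mangoldt R n <= ln n%:R.
Proof.
move=> n0; rewrite -sum_von_mangoldt //.
rewrite (bigD1_seq n) ?divisors_uniq //=; last by rewrite -dvdn_divisors.
by rewrite lerDl sumr_ge0 // => d _; exact: von_mangoldt_ge0.
Qed.

End VonMangoldt.

(** * Vaughan's identity *)

Section Vaughan.
Variables (A : comNzRingType) (F : nat -> A) (N U : nat).

Definition low (f : nat -> A) n := if (n <= U)%N then f n else 0.
Definition high (f : nat -> A) n := if (n <= U)%N then 0 else f n.

Definition bilinear (f g : nat -> A) : A :=
  \sum_(1 <= m < N.+1) \sum_(1 <= k < N.+1 | (m * k <= N)%N)
     f m * g k * F (m * k)%N.

Lemma bilinear_eq f g f' g' :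
  (forall m k, (0 < m)%N -> (0 < k)%N -> (m * k <= N)%N -> f m * g k = f' m * g' k) ->
  bilinear f g = bilinear f' g'.
Proof.
move=> h; apply: eq_big_nat => m /andP[m0 _].
rewrite big_nat_cond [RHS]big_nat_cond; apply: eq_bigr => k /andP[/andP[k0 _] mk].
by rewrite h.
Qed.

Lemma bilinearC f g : bilinear f g = bilinear g f.
Proof.
rewrite /bilinear (exchange_big_dep xpredT) //=; apply: eq_bigr => k _.
rewrite (eq_bigl (fun m => k * m <= N)%N) => [|m]; last by rewrite mulnC.
by apply: eq_bigr => m _; rewrite mulnC [f m * _]mulrC.
Qed.

Lemma bilinearD f f' g g' : (forall n, f n = g n + g' n) ->
  bilinear f f' = bilinear g f' + bilinear g' f'.
Proof.
move=> h; rewrite /bilinear -big_split /=; apply: eq_bigr => m _.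
by rewrite -big_split /=; apply: eq_bigr => k _; rewrite h !mulrDl.
Qed.

Definition triple (f g : nat -> A) : A :=
  \sum_(1 <= d < N.+1) \sum_(1 <= e < N.+1) \sum_(1 <= r < N.+1 | (d * e * r <= N)%N)
     f d * g e * F (d * e * r)%N.

Lemma tripleC f g : triple f g = triple g f.
Proof.
rewrite /triple exchange_big /=; apply: eq_bigr => e _; apply: eq_bigr => d _.
rewrite (eq_bigl (fun r => e * d * r <= N)%N) => [|r]; last by rewrite (mulnC d).
by apply: eq_bigr => r _; rewrite (mulnC d) [f d * _]mulrC.
Qed.

Lemma tripleDl f f' g g' : (forall n, f n = g n + g' n) ->
  triple f f' = triple g f' + triple g' f'.
Proof.
move=> h; rewrite /triple -big_split /=; apply: eq_bigr => d _.
rewrite -big_split /=; apply: eq_bigr => e _.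
rewrite -big_split /=; apply: eq_bigr => r _.
by rewrite h !mulrDl.
Qed.

Lemma triple_groupr f g h :
  (forall n, (0 < n)%N -> \sum_(d <- divisors n) g d = h n) ->
  triple f g = bilinear f h.
Proof.
move=> gh; apply: eq_big_nat => d /andP[d0 dN].
have MN : (N %/ d <= N)%N by exact: leq_div.
transitivity (\sum_(1 <= e < N.+1) \sum_(1 <= r < N.+1 | (e * r <= N %/ d)%N)
   f d * g e * F (d * (e * r))%N).
  apply: eq_bigr => e _; apply: eq_big => [r|r _]; last by rewrite mulnA.
  by rewrite leq_divRL // -mulnA mulnC.
rewrite (sum_hyperbola (fun e r => f d * g e * F (d * (e * r))%N) MN).
transitivity (\sum_(1 <= n < (N %/ d).+1) f d * h n * F (d * n)%N).
  apply: eq_big_nat => n /andP[n0 _]; rewrite -gh // big_distrr big_distrl /=.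
  rewrite big_seq [RHS]big_seq; apply: eq_bigr => e; rewrite -dvdn_divisors // => en.
  by rewrite [(e * _)%N]mulnC divnK.
by rewrite (sum_nat_cut _ MN) // => k; rewrite leq_divRL // mulnC.
Qed.

Lemma triple_groupl f g h :
  (forall n, (0 < n)%N -> \sum_(d <- divisors n) f d * g (n %/ d)%N = h n) ->
  triple f g = bilinear h (fun=> 1).
Proof.
move=> fgh; rewrite /triple /bilinear.
under eq_bigr do rewrite (exchange_big_dep xpredT) //=.
rewrite exchange_big /=.
rewrite [RHS](exchange_big_dep xpredT) //=.
apply: eq_big_nat => r /andP[r0 rN].
have MN : (N %/ r <= N)%N by exact: leq_div.
transitivity (\sum_(1 <= d < N.+1) \sum_(1 <= e < N.+1 | (d * e <= N %/ r)%N)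
   f d * g e * F (d * e * r)%N).
  by apply: eq_bigr => d _; apply: eq_bigl => e; rewrite leq_divRL.
rewrite (sum_hyperbola (fun d e => f d * g e * F (d * e * r)%N) MN).
transitivity (\sum_(1 <= n < (N %/ r).+1) h n * 1 * F (n * r)%N).
  apply: eq_big_nat => n /andP[n0 _]; rewrite -fgh // mulr1 big_distrl /=.
  rewrite big_seq [RHS]big_seq; apply: eq_bigr => d; rewrite -dvdn_divisors // => dn.
  by rewrite [(d * _)%N]mulnC divnK.
by rewrite (sum_nat_cut _ MN) // => k; rewrite leq_divRL.
Qed.

Variables (mu lam lg : nat -> A).
Hypothesis mu_sum : forall n, (0 < n)%N ->
  \sum_(d <- divisors n) mu d = (n == 1%N)%:R.
Hypothesis lam_sum : forall n, (0 < n)%N -> \sum_(d <- divisors n) lam d = lg n.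

Lemma triple_mu g : triple mu g = \sum_(1 <= n < N.+1) g n * F n.
Proof.
rewrite tripleC (triple_groupr _ mu_sum); apply: eq_big_nat => n /andP[n0 nN].
rewrite big_mkcond (bigD1_seq 1%N) ?iota_uniq ?mem_index_iota //=; last by lia.
rewrite muln1 ltnS in nN *; rewrite nN mulr1 big1 ?addr0 // => k /negPf ->.
by rewrite mulr0 mul0r; case: ifP.
Qed.

(** Vaughan's identity: write [lam] as [mu * 1 * lam] and cut both [mu] and
    [lam] at [U]; the mixed piece with [mu] long and [lam] short is the
    difference of [lam] itself and the piece with both short. *)
Lemma vaughan :
  \sum_(1 <= n < N.+1) lam n * F n =
  \sum_(1 <= n < N.+1) low lam n * F n
  + bilinear (low mu) lg
  - bilinear (fun m => \sum_(d <- divisors m) low mu d * low lam (m %/ d)%N)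
           (fun=> 1)
  + bilinear (high mu) (fun n => \sum_(e <- divisors n) high lam e).
Proof.
have cut (f : nat -> A) n : f n = low f n + high f n.
  by rewrite /low /high; case: ifP; rewrite ?addr0 ?add0r.
rewrite -!triple_mu -(triple_groupr (low mu) lam_sum).
rewrite -(@triple_groupr (high mu) (high lam) _ (fun _ _ => erefl)).
rewrite -(@triple_groupl (low mu) (low lam) _ (fun _ _ => erefl)).
rewrite (tripleDl lam (cut mu)) (tripleC (high mu)) (tripleDl (high mu) (cut lam)).
rewrite (tripleDl (low lam) (cut mu)) !(tripleC _ (high mu)).
by ring.
Qed.

End Vaughan.

(** * Inequalities for finite sums *)

Section FiniteInequalities.
Variable R : realType.

Lemma ler_sum_nat_sub (f : nat -> R) (P : pred nat) (a b : nat) :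
  (forall i, 0 <= f i) ->
  \sum_(a <= i < b | P i) f i <= \sum_(a <= i < b) f i.
Proof.
move=> f0; rewrite big_mkcond /=; apply: ler_sum => i _.
by case: ifP.
Qed.

Lemma ler_sum_nat_widen (f : nat -> R) (a b b' : nat) :
  (forall i, 0 <= f i) -> (b <= b')%N ->
  \sum_(a <= i < b) f i <= \sum_(a <= i < b') f i.
Proof.
move=> f0 bb; have [ba|ab] := leqP b a.
  by rewrite (big_geq ba) sumr_ge0.
rewrite [leRHS](@big_cat_nat _ _ _ b) ?(ltnW ab) //=.
by rewrite lerDl sumr_ge0.
Qed.

(** Lagrange's identity exhibits the difference of both sides, squared, as a sum
    of squares. *)
Lemma cauchy_schwarz (I : Type) (r : seq I) (P : pred I) (a b : I -> R) :
  \sum_(i <- r | P i) a i * b i <=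
  Num.sqrt (\sum_(i <- r | P i) a i ^+ 2) * Num.sqrt (\sum_(i <- r | P i) b i ^+ 2).
Proof.
have A0 : 0 <= \sum_(i <- r | P i) a i ^+ 2 by apply: sumr_ge0 => i _; rewrite sqr_ge0.
have B0 : 0 <= \sum_(i <- r | P i) b i ^+ 2 by apply: sumr_ge0 => i _; rewrite sqr_ge0.
rewrite -sqrtrM //; apply: le_trans (ler_norm _) _.
rewrite -sqrtr_sqr ler_wsqrtr //.
set A := \sum_(i <- r | P i) a i ^+ 2; set B := \sum_(i <- r | P i) b i ^+ 2.
set C := \sum_(i <- r | P i) a i * b i.
have : 0 <= \sum_(i <- r | P i) \sum_(j <- r | P j) (a i * b j - a j * b i) ^+ 2.
  by apply: sumr_ge0 => i _; apply: sumr_ge0 => j _; rewrite sqr_ge0.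
suff -> : \sum_(i <- r | P i) \sum_(j <- r | P j) (a i * b j - a j * b i) ^+ 2 =
  A * B + B * A - 2 * C ^+ 2 by lra.
transitivity (\sum_(i <- r | P i) (a i ^+ 2 * B + b i ^+ 2 * A - 2 * (a i * b i) * C)).
  apply: eq_bigr => i _; rewrite /A /B /C !big_distrr /= -!big_split /= -sumrN -big_split /=.
  by apply: eq_bigr => j _; ring.
rewrite big_split /= big_split /= sumrN -!big_distrl /= -big_distrr /=.
by rewrite -/A -/B -/C; ring.
Qed.

(** Summation by parts: the increments of a monotone weight add up to at most
    its last value, as does the boundary term. *)
Lemma abel_bound (w : nat -> R) (g : nat -> R[i]) (n : nat) (B : R) :
  (forall k, 0 <= w k) -> (forall k, w k <= w k.+1) ->
  (forall k, (k <= n)%N -> cabs (\sum_(0 <= j < k) g j) <= B) ->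
  cabs (\sum_(0 <= k < n) (w k)%:C%C * g k) <= 2 * w n * B.
Proof.
move=> w0 wm gB.
have B0 : 0 <= B by apply: le_trans (gB 0%N _) => //; exact: cabs_ge0.
pose G k := \sum_(0 <= j < k) g j.
have -> : \sum_(0 <= k < n) (w k)%:C%C * g k =
   (w n)%:C%C * G n - \sum_(0 <= k < n) (w k.+1 - w k)%:C%C * G k.+1.
  elim: n {gB} => [|n IH]; first by rewrite /G !big_geq // mulr0 subr0.
  have Gr : G n.+1 = G n + g n by rewrite /G big_nat_recr.
  rewrite [LHS]big_nat_recr //= IH [in RHS]big_nat_recr //= Gr rmorphB /=.
  by ring.
rewrite (le_trans (cabsD _ _)) // cabsN cabsM cabs_real ger0_norm //.
have -> : 2 * w n * B = w n * B + w n * B by ring.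
apply: lerD; first by rewrite ler_wpM2l // gB.
apply: (@le_trans _ _ (\sum_(0 <= k < n) (w k.+1 - w k) * B)).
  apply: (le_trans (cabs_sum _ _ _)); apply: ler_sum_nat => k /andP[_ kn].
  rewrite cabsM cabs_real ger0_norm ?subr_ge0 // ler_wpM2l ?subr_ge0 //.
  exact: gB.
rewrite -big_distrl /= telescope_sumr // ler_wpM2r // lerBlDr lerDl //.
Qed.

Lemma dyadic_sum (f : nat -> R) (l : nat) :
  \sum_(1 <= m < 2 ^ l) f m =
  \sum_(0 <= i < l) \sum_(2 ^ i <= m < 2 ^ i.+1) f m.
Proof.
elim: l => [|l IH]; first by rewrite !big_geq.
rewrite big_nat_recr //= -IH -big_cat_nat //= ?expn_gt0 //.
by rewrite leq_exp2l.
Qed.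

Definition harm (n : nat) : R := \sum_(1 <= k < n.+1) k%:R^-1.

Lemma harm_le (n l : nat) : (n < 2 ^ l)%N -> harm n <= l%:R.
Proof.
move=> nl; rewrite /harm.
have p0 (k : nat) : 0 <= k%:R^-1 :> R by rewrite invr_ge0.
apply: (le_trans (ler_sum_nat_widen _ p0 nl)); rewrite dyadic_sum.
have -> : l%:R = \sum_(0 <= i < l) (1 : R).
  by rewrite big_const_nat iter_addr addr0 subn0.
apply: ler_sum => i _.
apply: (@le_trans _ _ (\sum_(2 ^ i <= m < 2 ^ i.+1) (2 ^ i)%:R^-1)).
  apply: ler_sum_nat => m /andP[im _].
  by rewrite lef_pV2 ?posrE ?ltr0n ?expn_gt0 ?ler_nat // (leq_trans _ im) ?expn_gt0.
rewrite big_const_nat iter_addr addr0 expnS mul2n -addnn addnK.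
by rewrite -[_ *+ _]mulr_natl divff // pnatr_eq0 -lt0n expn_gt0.
Qed.

Lemma harm_ge0 n : 0 <= harm n.
Proof. by apply: sumr_ge0 => k _; rewrite invr_ge0. Qed.

Lemma harm_ge1 n : (0 < n)%N -> 1 <= harm n.
Proof.
move=> n0; rewrite /harm big_ltn // invr1 lerDl.
by apply: sumr_ge0 => k _; rewrite invr_ge0.
Qed.

End FiniteInequalities.

(** * The divisor function *)

Section DivisorFunction.

Definition ndiv (n : nat) : nat := size (divisors n).

(** A divisor [e] of [a b] is recovered from the divisor [gcdn e a] of [a] and
    the divisor [e / gcdn e a] of [b]. *)
Lemma ndivM (a b : nat) : (0 < a)%N -> (0 < b)%N ->
  (ndiv (a * b) <= ndiv a * ndiv b)%N.
Proof.
move=> a0 b0; rewrite /ndiv -(size_allpairs (fun x y => x * y)%N).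
apply: uniq_leq_size; first exact: divisors_uniq.
move=> e; rewrite -dvdn_divisors ?muln_gt0 ?a0 // => eab.
have e0 : (0 < e)%N by apply: dvdn_gt0 eab; rewrite muln_gt0 a0.
have g0 : (0 < gcdn e a)%N by rewrite gcdn_gt0 e0.
apply/allpairsP; exists (gcdn e a, e %/ gcdn e a)%N => /=; split.
- by rewrite -dvdn_divisors // dvdn_gcdr.
- rewrite -dvdn_divisors //.
  have cop : coprime (e %/ gcdn e a) (a %/ gcdn e a).
    rewrite /coprime -(eqn_pmul2r g0) muln_gcdl mul1n.
    by rewrite !divnK ?dvdn_gcdl ?dvdn_gcdr.
  rewrite -(Gauss_dvdr _ cop) -(dvdn_pmul2r g0) mulnAC !divnK ?dvdn_gcdl ?dvdn_gcdr //.
- by rewrite mulnC divnK // dvdn_gcdl.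
Qed.

Lemma ndivX (p k : nat) : prime p -> (ndiv (p ^ k) <= k.+1)%N.
Proof.
move=> pp; rewrite /ndiv (_ : k.+1 = size [seq (p ^ i)%N | i <- iota 0 k.+1]); last first.
  by rewrite size_map size_iota.
apply: uniq_leq_size; first exact: divisors_uniq.
move=> e; rewrite -dvdn_divisors ?expn_gt0 ?prime_gt0 // => /(dvdn_pfactor _ _ pp)[m mk ->].
by apply: map_f; rewrite mem_iota.
Qed.

Variable R : realType.

Lemma ndiv_sum (n : nat) : (ndiv n)%:R = \sum_(d <- divisors n) (1 : R).
Proof. by rewrite /ndiv big_const_seq count_predT iter_addr addr0. Qed.

(** Only the finitely many primes [p] with [p `^ delta < 2] contribute a
    constant factor; for the others [k + 1 <= 2 ^ k <= p ^ (k delta)]. *)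
Lemma ndiv_bound (delta : R) : 0 < delta ->
  exists2 C : R, 0 < C & forall n : nat, (0 < n)%N ->
    (ndiv n)%:R <= C * n%:R `^ delta.
Proof.
move=> d0.
have [T hT] : exists T : nat, forall p : nat, (T <= p)%N -> 2 <= p%:R `^ delta.
  exists (Num.truncn (2 `^ delta^-1 : R)).+1 => p hp.
  have h : 2 `^ delta^-1 <= p%:R :> R.
    by apply: ltW; apply: (lt_le_trans (truncnS_gt _)); rewrite ler_nat.
  apply: le_trans (ge0_ler_powR (ltW d0) _ _ h); rewrite ?nnegrE ?powR_ge0 //.
  by rewrite -powRrM mulVf ?gt_eqF // powRr1.
have l2 : 0 < ln 2 :> R by rewrite ln_gt0 // ltr1n.
pose c0 : R := 1 + (delta * ln 2)^-1.
have c01 : 1 <= c0 by rewrite lerDl invr_ge0 mulr_ge0 ?(ltW d0) ?(ltW l2).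
pose c (p : nat) : R := if (p < T)%N then c0 else 1.
have c1 p : 1 <= c p by rewrite /c; case: ifP.
have step (p k : nat) : prime p -> (k.+1)%:R <= c p * (p ^ k)%:R `^ delta.
  move=> pp; have p2 := prime_gt1 pp.
  have -> : (p ^ k)%:R `^ delta = (p%:R `^ delta) ^+ k :> R.
    by rewrite natrX -powR_mulrn // -powRrM mulrC powRrM powR_mulrn ?powR_ge0.
  rewrite /c; case: ltnP => pT; last first.
    rewrite mul1r; apply: (@le_trans _ _ (2 ^+ k)).
      by rewrite -natrX ler_nat ltn_expl.
    by rewrite lerXn2r ?nnegrE ?powR_ge0 // hT.
  apply: (@le_trans _ _ (c0 * (2 `^ delta) ^+ k)); last first.
    rewrite ler_wpM2l ?(le_trans _ c01) // lerXn2r ?nnegrE ?powR_ge0 //.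
    by apply: ge0_ler_powR; rewrite ?nnegrE ?(ltW d0) // ler_nat.
  rewrite -powR_mulrn ?powR_ge0 // -powRrM /powR gt_eqF //.
  have := expR_ge1Dx (delta * k%:R * ln 2 : R).
  move=> h; apply: (@le_trans _ _ (c0 * (1 + delta * k%:R * ln 2))); last first.
    by rewrite ler_wpM2l // (le_trans _ c01).
  rewrite /c0 mulrDl mul1r mulrDr mulr1.
  have -> : (delta * ln 2)^-1 * (delta * k%:R * ln 2) = k%:R.
    by field; rewrite ?gt_eqF.
  rewrite -natr1; have : 0 <= (delta * ln 2)^-1 by rewrite invr_ge0 mulr_ge0 ?(ltW d0) ?(ltW l2).
  have : 0 <= delta * k%:R * ln 2 by rewrite !mulr_ge0 ?(ltW d0) ?(ltW l2).
  by lra.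
have prodc n : \prod_(0 <= p < n) c p <= c0 ^+ (minn n T).
  elim: n => [|n IH]; first by rewrite big_geq // min0n expr0.
  rewrite big_nat_recr //=.
  apply: le_trans (ler_wpM2r _ IH) _; first by rewrite (le_trans _ (c1 n)).
  rewrite /c; case: ltnP => nT.
    have -> : minn n.+1 T = n.+1 by lia.
    by rewrite exprSr.
  have -> : minn n.+1 T = T by lia.
  by rewrite mulr1.
exists (c0 ^+ T) => [|n n0]; first by rewrite exprn_gt0 // (lt_le_trans _ c01).
have gen (r : seq nat) (P : pred nat) (e : nat -> nat) :
  (forall p, P p -> prime p) ->
  (ndiv (\prod_(p <- r | P p) p ^ e p)%N)%:R <=
    \prod_(p <- r | P p) c p * (\prod_(p <- r | P p) p ^ e p)%N%:R `^ delta /\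
  (0 < \prod_(p <- r | P p) p ^ e p)%N.
  move=> Pp; elim: r => [|p r [IH1 IH2]].
    by rewrite !big_nil mul1r powR1 (_ : ndiv 1 = 1%N).
  rewrite !big_cons; case: ifP => // /Pp pp.
  have pe0 : (0 < p ^ e p)%N by rewrite expn_gt0 prime_gt0.
  split; last by rewrite muln_gt0 pe0.
  apply: (@le_trans _ _ ((e p).+1%:R * (ndiv (\prod_(j <- r | P j) j ^ e j)%N)%:R)).
    rewrite -natrM ler_nat; apply: leq_trans (ndivM pe0 IH2) _.
    by rewrite leq_mul2r ndivX ?orbT.
  rewrite natrM powRM ?ler0n // mulrACA ler_pM //.
  exact: step.
have [] := gen (index_iota 0 n.+1) (fun p => p \in \pi(n)) (fun p => logn p n).
  by move=> p; rewrite mem_primes => /andP[].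
rewrite -[(\prod_(p <- _ | _) _)%N]/(n`_\pi(n))%N partn_pi // => h _.
apply: (le_trans h); rewrite ler_wpM2r ?powR_ge0 //.
apply: (@le_trans _ _ (\prod_(0 <= p < n.+1) c p)).
  rewrite big_mkcond /=; apply: ler_prod => p _; case: ifP => _; rewrite ?lexx ?andbT.
    by rewrite (le_trans _ (c1 p)).
  by rewrite ler01 c1.
by apply: (le_trans (prodc _)); rewrite ler_weXn2l // geq_minr.
Qed.

Lemma sum_ndiv_le (X : nat) : \sum_(1 <= l < X.+1) (ndiv l)%:R <= X%:R * harm R X.
Proof.
under eq_bigr do rewrite ndiv_sum.
rewrite -(@sum_hyperbola _ (fun _ _ => 1) X X) // /harm big_distrr /=.
apply: ler_sum_nat => d /andP[d0 dX].
rewrite (@sum_nat_cut _ _ _ X (X %/ d)) ?leq_div // => [|k]; last first.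
  by rewrite leq_divRL // mulnC.
rewrite big_const_nat iter_addr addr0 subn1 /= ler_pdivlMr ?ltr0n //.
by rewrite -natrM ler_nat leq_divM.
Qed.

Lemma sum_ndivV_le (X : nat) :
  \sum_(1 <= l < X.+1) (ndiv l)%:R / l%:R <= harm R X ^+ 2.
Proof.
have -> : \sum_(1 <= l < X.+1) (ndiv l)%:R / l%:R =
   \sum_(1 <= l < X.+1) \sum_(d <- divisors l) (d%:R^-1 * (l %/ d)%:R^-1 : R).
  apply: eq_big_nat => l /andP[l0 _].
  rewrite ndiv_sum big_distrl /= big_seq [RHS]big_seq; apply: eq_bigr => d.
  rewrite -dvdn_divisors // => dl; rewrite mul1r -invfM -natrM.
  by rewrite mulnC divnK.
rewrite -(@sum_hyperbola _ (fun d k => d%:R^-1 * k%:R^-1) X X) // expr2.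
rewrite {1}/harm big_distrl /=; apply: ler_sum => d _.
rewrite -big_distrr /= ler_wpM2l ?invr_ge0 //.
by apply: ler_sum_nat_sub => k; rewrite invr_ge0.
Qed.

(** One factor of the square is expanded as a sum over factorizations
    [l = d k], and submultiplicativity separates [d] from [k]. *)
Lemma sum_ndiv_sqr_le (X : nat) :
  \sum_(1 <= l < X.+1) (ndiv l)%:R ^+ 2 <= X%:R * harm R X ^+ 3.
Proof.
have hm (a b : nat) : (a <= b)%N -> harm R a <= harm R b.
  by move=> ab; apply: ler_sum_nat_widen => // k; rewrite invr_ge0.
have -> : \sum_(1 <= l < X.+1) (ndiv l)%:R ^+ 2 =
   \sum_(1 <= l < X.+1) \sum_(d <- divisors l) ((ndiv (d * (l %/ d)))%:R : R).
  apply: eq_big_nat => l /andP[l0 _].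
  rewrite expr2 {1}ndiv_sum big_distrl /= big_seq [RHS]big_seq; apply: eq_bigr => d.
  by rewrite -dvdn_divisors // => dl; rewrite mul1r mulnC divnK.
rewrite -(@sum_hyperbola _ (fun d k => (ndiv (d * k))%:R) X X) //.
apply: (@le_trans _ _ (\sum_(1 <= d < X.+1) (ndiv d)%:R * ((X%:R / d%:R) * harm R X))).
  apply: ler_sum_nat => d /andP[d0 dX].
  rewrite (@sum_nat_cut _ _ _ X (X %/ d)) ?leq_div // => [|k]; last first.
    by rewrite leq_divRL // mulnC.
  apply: (@le_trans _ _ (\sum_(1 <= k < (X %/ d).+1) (ndiv d)%:R * (ndiv k)%:R)).
    apply: ler_sum_nat => k /andP[k0 _]; rewrite -natrM ler_nat; exact: ndivM.
  rewrite -big_distrr /= ler_wpM2l //.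
  apply: (le_trans (sum_ndiv_le _)); apply: ler_pM; rewrite ?harm_ge0 ?hm ?leq_div //.
  by rewrite ler_pdivlMr ?ltr0n // -natrM ler_nat leq_divM.
rewrite (eq_bigr (fun d : nat => (ndiv d)%:R / d%:R * (X%:R * harm R X))) => [|d _]; last first.
  by ring.
rewrite -big_distrl /= (_ : X%:R * harm R X ^+ 3 = harm R X ^+ 2 * (X%:R * harm R X)).
  by rewrite ler_wpM2r ?mulr_ge0 ?harm_ge0 // sum_ndivV_le.
by ring.
Qed.

(** The multiplicity of [l] among the products [h m] is at most the number of
    divisors of [l]. *)
Lemma sum_products_le (g : nat -> R) (H M : nat) :
  (forall l, 0 <= g l) ->
  \sum_(1 <= h < H.+1) \sum_(1 <= m < M.+1) g (h * m)%N <=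
  \sum_(1 <= l < (H * M).+1) (ndiv l)%:R * g l.
Proof.
move=> g0.
have [->|H0] := posnP H; first by rewrite big_geq // sumr_ge0 // => l _; rewrite mulr_ge0.
have [->|M0] := posnP M.
  by rewrite big1 ?muln0 ?big_geq // => h _; rewrite big_geq.
have -> : \sum_(1 <= l < (H * M).+1) (ndiv l)%:R * g l =
   \sum_(1 <= l < (H * M).+1) \sum_(d <- divisors l) g (d * (l %/ d))%N.
  apply: eq_big_nat => l /andP[l0 _].
  rewrite ndiv_sum big_distrl /= big_seq [RHS]big_seq; apply: eq_bigr => d.
  by rewrite -dvdn_divisors // => dl; rewrite mul1r mulnC divnK.
rewrite -(@sum_hyperbola _ (fun d k => g (d * k)%N) (H * M) (H * M)) //.
have HB : (H <= H * M)%N by rewrite leq_pmulr.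
have MB : (M <= H * M)%N by rewrite leq_pmull.
apply: (@le_trans _ _ (\sum_(1 <= h < H.+1)
    \sum_(1 <= k < (H * M).+1 | (h * k <= H * M)%N) g (h * k)%N)).
  apply: ler_sum_nat => h /andP[_ hH].
  rewrite [leRHS](@big_cat_nat _ _ _ M.+1) //= [X in _ <= X + _](_ : _ = \sum_(1 <= m < M.+1) g (h * m)%N).
    by rewrite lerDl sumr_ge0.
  rewrite [RHS]big_nat big_nat_cond; apply: eq_bigl => k.
  rewrite !ltnS in hH *; case: (boolP (0 < k <= M)%N) => //= /andP[_ kM].
  exact: leq_mul.
by apply: ler_sum_nat_widen => // i; apply: sumr_ge0.
Qed.

End DivisorFunction.

(** * Multiples of a number close to a fraction *)

Section RationalApproximation.
Variable R : realType.
Variables (theta kappa : R) (a : int) (q k1 : nat).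
Hypothesis q0 : (0 < q)%N.
Hypothesis aq : coprimez a q.
Hypothesis kappa0 : 0 <= kappa.
Hypothesis approx : `|theta - a%:~R / q%:R| <= kappa / q%:R ^+ 2.
Hypothesis k1_ge : 2 * pi * (1 + kappa) <= k1%:R.

Let qR : 0 < q%:R :> R. Proof. by rewrite ltr0n. Qed.

(** As [t] runs over a complete residue system modulo [q], so do the numerators
    [t a + c], where [c / q] approximates [gamma]. The points [t theta + gamma]
    are therefore at distance [O(1 / q)] from the distinct fractions [r / q]. *)
Lemma block_sum (gamma Y : R) : 0 < Y ->
  \sum_(0 <= t < q) chord_cap Y (t%:R * theta + gamma) <=
  2 * k1%:R * Y + 2 * q%:R * harm R q.
Proof.
move=> Y0.
pose c := Num.floor (q%:R * gamma); pose rho := q%:R * gamma - c%:~R.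
have rho0 : 0 <= rho by rewrite subr_ge0 ge_floor.
have rho1 : rho <= 1.
  have := ltW (floorD1_gt (q%:R * gamma)); rewrite -/c /rho intrD; lra.
pose res (t : nat) := `|((t%:Z * a + c) %% q%:Z)%Z|%N.
have qn0 : (q%:Z != 0)%R by rewrite eqz_nat -lt0n.
have resE t : (res t)%:Z = ((t%:Z * a + c) %% q%:Z)%Z.
  by rewrite /res gez0_abs // modz_ge0.
have res_lt t : (res t < q)%N by rewrite -ltz_nat resE ltz_pmod.
have chord_res (t : nat) : (t < q)%N ->
    (2 * (minn (res t) (q - res t))%:R - k1%:R) / q%:R <= chord (t%:R * theta + gamma).
  move=> tq.
  pose d := t%:R * (theta - a%:~R / q%:R) + rho / q%:R.
  have def_x : t%:R * theta + gamma = ((res t)%:R / q%:R + d) +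
      ((t%:Z * a + c) %/ q%:Z)%Z%:~R.
    have e : (t%:Z * a + c)%:~R = ((t%:Z * a + c) %/ q%:Z)%Z%:~R * q%:R + (res t)%:R :> R.
      by rewrite [in LHS](divz_eq (t%:Z * a + c) q%:Z) intrD intrM -resE.
    have -> : (res t)%:R = t%:R * a%:~R + c%:~R - ((t%:Z * a + c) %/ q%:Z)%Z%:~R * q%:R :> R.
      by rewrite -[t%:R]/(t%:Z%:~R) -intrM -intrD e; ring.
    by rewrite /d /rho; field; rewrite gt_eqF.
  have dle : `|d| <= (1 + kappa) / q%:R.
    rewrite /d; apply: (le_trans (ler_normD _ _)); rewrite [leRHS]mulrDl mul1r addrC; apply: lerD.
      by rewrite ger0_norm ?divr_ge0 // -[leRHS]mul1r ler_wpM2r ?invr_ge0.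
    rewrite normrM normr_nat (le_trans (ler_wpM2l _ approx)) //.
    rewrite expr2 invfM mulrA mulrA ler_wpM2r ?invr_ge0 // mulrC mulrA.
    by rewrite ler_piMl // ler_pdivrMl // mulr1 ler_nat ltnW.
  rewrite def_x chordD_int.
  have h1 := @chord_frac_ge R (res t) q q0 (ltnW (res_lt t)).
  have h2 : chord ((res t)%:R / q%:R) - chord d <= chord ((res t)%:R / q%:R + d).
    by rewrite -[d in leRHS]opprK -{1}(chordN d); exact: chord_sub.
  have h3 : chord d <= k1%:R / q%:R.
    apply: (le_trans (chord_le _)).
    apply: (@le_trans _ _ (2 * pi * ((1 + kappa) / q%:R))).
      by rewrite ler_wpM2l // mulr_ge0 // pi_ge0.
    by rewrite mulrA ler_wpM2r ?invr_ge0.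
  by rewrite mulrBl; lra.
(* Residues closer than [k1] to a multiple of [q] get the trivial bound [Y]; for
     [r = 0] the term [q / r] has its default value [0]. *)
pose B (r : nat) : R := (if (r < k1)%N then Y else 0)
  + (if (q - r < k1)%N then Y else 0) + q%:R / r%:R + q%:R / (q - r)%:R.
have mnB (t : nat) : (t < q)%N -> chord_cap Y (t%:R * theta + gamma) <= B (res t).
  move=> tq; have := chord_res t tq; have rq := res_lt t; rewrite /B.
  set r := res t in rq *; set x := _ + gamma => h.
  have f1 : 0 <= q%:R / r%:R :> R by rewrite divr_ge0.
  have f2 : 0 <= q%:R / (q - r)%:R :> R by rewrite divr_ge0.
  have mY := chord_cap_le x Y0.
  case: (ltnP r k1) => rk; first by case: ifP => _; lra.
  case: (ltnP (q - r) k1) => qrk; first by lra.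
  have k10 : (0 < k1)%N.
    by rewrite -(ltr0n R); apply: lt_le_trans k1_ge; rewrite !mulr_gt0 ?pi_gt0 // ltr_wpDr.
  have m0 : (0 < minn r (q - r))%N by rewrite leq_min (leq_trans k10 rk) (leq_trans k10 qrk).
  have m0' : 0 < (minn r (q - r))%:R / q%:R :> R by rewrite divr_gt0 ?ltr0n.
  have : chord_cap Y x <= ((minn r (q - r))%:R / q%:R)^-1.
    apply: chord_cap_le_inv => //; apply: le_trans h; rewrite ler_wpM2r ?invr_ge0 //.
    have : k1%:R <= (minn r (q - r))%:R :> R by rewrite ler_nat leq_min rk.
    by lra.
  rewrite invf_div => h'.
  by move: h'; rewrite /minn; case: ifP => _; lra.
apply: (@le_trans _ _ (\sum_(0 <= t < q) B (res t))).
  by apply: ler_sum_nat => t /andP[_]; exact: mnB.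
have -> : \sum_(0 <= t < q) B (res t) = \sum_(0 <= r < q) B r.
  rewrite !big_mkord; pose f (i : 'I_q) := Ordinal (res_lt i).
  rewrite [RHS](reindex_inj (h := f)) // => i j /(congr1 val) /= /(congr1 Posz).
  rewrite !resE => /eqP; rewrite eqz_mod_dvd opprD addrACA subrr addr0 -mulrBl.
  rewrite Gauss_dvdzl; last by rewrite coprimez_sym.
  rewrite -eqz_mod_dvd !modz_nat eqz_nat !modn_small // => /eqP; exact: val_inj.
have Pk (P : pred nat) (e : nat) : (forall i, P i -> (i < e)%N) ->
    \sum_(0 <= r < q) (if P r then Y else 0) <= e%:R * Y.
  move=> Pe; rewrite -big_mkcond /=.
  apply: (@le_trans _ _ (\sum_(0 <= r < e) Y)); last first.
    by rewrite big_const_nat iter_addr addr0 subn0 mulr_natl.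
  rewrite big_mkcond /= [leRHS](_ : _ = \sum_(0 <= r < e) (if (r < e)%N then Y else 0)).
    apply: (@le_trans _ _ (\sum_(0 <= r < q) (if (r < e)%N then Y else 0))).
      apply: ler_sum => r _; case: ifP => [/Pe -> //|_]; case: ifP => _ //; exact: ltW.
    apply: (@le_trans _ _ (\sum_(0 <= r < q + e) (if (r < e)%N then Y else 0))).
      by apply: ler_sum_nat_widen => [r|]; rewrite ?leq_addr //; case: ifP => _ //; exact: ltW.
    rewrite (@big_cat_nat _ _ _ e) ?leq_addl //= [X in _ + X]big1_seq ?addr0 // => r /andP[_].
    by rewrite mem_index_iota => /andP[er _]; rewrite ltnNge er.
  by apply: eq_big_nat => r /andP[_ ->].
have rv (f : nat -> R) : \sum_(0 <= r < q) f (q - r)%N = \sum_(1 <= r < q.+1) f r.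
  rewrite big_nat_rev /= add0n [RHS]big_add1 /=; apply: eq_big_nat => r /andP[_ rq].
  by rewrite subKn.
rewrite /B !big_split /=.
have t1 := Pk (fun r => r < k1)%N k1 (fun i => id).
have t2 : \sum_(0 <= r < q) (if (q - r < k1)%N then Y else 0) <= k1%:R * Y.
  rewrite (rv (fun r => if (r < k1)%N then Y else 0)).
  apply: le_trans t1; rewrite [leRHS]big_ltn // big_nat_recr //= addrC lerD2r.
  by case: (ltnP q k1) => [|_]; [move=> h; rewrite (leq_trans _ h)|case: ifP => _ //; exact: ltW].
have t3 : \sum_(0 <= r < q) q%:R / r%:R <= q%:R * harm R q.
  rewrite big_ltn // invr0 mulr0 add0r /harm big_distrr /=.
  by apply: ler_sum_nat_widen => // i; rewrite divr_ge0.
have t4 : \sum_(0 <= r < q) q%:R / (q - r)%:R = q%:R * harm R q.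
  by rewrite (rv (fun r => q%:R / r%:R)) /harm big_distrr.
by lra.
Qed.

Lemma blocks_sum (gamma Y : R) (b : nat) : 0 < Y ->
  \sum_(0 <= j < b * q) chord_cap Y (j%:R * theta + gamma) <=
  b%:R * (2 * k1%:R * Y + 2 * q%:R * harm R q).
Proof.
move=> Y0; elim: b => [|b IH]; first by rewrite mul0n big_geq // mul0r.
rewrite mulSn addnC (@big_cat_nat _ _ _ (b * q)) ?leq_addr //=.
rewrite -natr1 mulrDl mul1r; apply: lerD => //.
rewrite -{1}[(b * q)%N]add0n big_addn addKn.
rewrite (eq_bigr (fun t : nat => chord_cap Y (t%:R * theta + ((b * q)%:R * theta + gamma)))) => [|t _].
  exact: block_sum.
by rewrite natrD mulrDl addrA.
Qed.

(** For [j] small compared with [q] the multiple [j theta] is not within [1 / q]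
    of an integer. Hence the term [Y] of a block matters only when [K] exceeds a
    constant multiple of [q], and then the number of blocks is [O(K / q)]. *)
Lemma multiples_sum (Y : R) (K : nat) : 0 < Y ->
  \sum_(1 <= j < K.+1) chord_cap Y (j%:R * theta) <=
  2 * (1 + k1%:R) ^+ 2 * (K%:R * Y / q%:R + (K%:R + q%:R) * harm R q).
Proof.
move=> Y0; have h1 := @harm_ge1 R _ q0.
have k1R : 0 <= k1%:R :> R by [].
have KY : 0 <= K%:R * Y / q%:R by rewrite divr_ge0 // mulr_ge0 // ltW.
have [Kq|Kq] := leqP (K * k1) q.
  have k12 : 2 <= k1%:R :> R.
    apply: le_trans k1_ge; have := pi_ge2 R => p2.
    by have : 0 <= pi * kappa by [rewrite mulr_ge0 // pi_ge0|]; nra.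
  have k1n : (2 <= k1)%N by rewrite -(ler_nat R).
  have [->|K0] := posnP K.
    rewrite big_geq // mulr_ge0 ?mulr_ge0 ?exprn_ge0 ?addr_ge0 //.
      by rewrite mul0r mul0r.
    by rewrite mulr_ge0 ?(le_trans _ h1) ?addr_ge0.
  have Kltq : (K < q)%N by apply: leq_trans Kq; rewrite ltn_Pmulr.
  apply: (@le_trans _ _ (\sum_(0 <= j < q) chord_cap q%:R (j%:R * theta + 0))).
    apply: (@le_trans _ _ (\sum_(1 <= j < K.+1) chord_cap q%:R (j%:R * theta))).
      apply: ler_sum_nat => j /andP[j0 jK]; apply: chord_cap_le_cap => //.
      pose d := j%:R * (theta - a%:~R / q%:R).
      have -> : j%:R * theta = (j%:Z * a)%:~R / q%:R + d.
        by rewrite /d intrM; ring.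
      have h3 : chord d <= q%:R^-1.
        apply: (le_trans (chord_le _)); rewrite normrM normr_nat.
        apply: (@le_trans _ _ (2 * pi * (j%:R * (kappa / q%:R ^+ 2)))).
          by rewrite ler_wpM2l ?mulr_ge0 ?pi_ge0 // ler_wpM2l.
        apply: (@le_trans _ _ ((k1%:R * j%:R) / q%:R ^+ 2)).
          rewrite !mulrA ler_wpM2r ?invr_ge0 ?exprn_ge0 //.
          rewrite mulrAC ler_wpM2r // (le_trans _ k1_ge) //.
          by have := pi_ge2 R; nra.
        rewrite expr2 invfM mulrA -[leRHS]mul1r ler_wpM2r ?invr_ge0 //.
        rewrite ler_pdivrMr // mul1r -natrM ler_nat mulnC.
        by apply: leq_trans Kq; rewrite leq_mul2r -ltnS jK orbT.
      have h2 : chord ((j%:Z * a)%:~R / q%:R) - chord d <= chord ((j%:Z * a)%:~R / q%:R + d).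
        by rewrite -[d in leRHS]opprK -{1}(chordN d); exact: chord_sub.
      have h4 : 2 / q%:R <= chord ((j%:Z * a)%:~R / q%:R : R).
        have -> : (j%:Z * a)%:~R / q%:R =
            ((j%:Z * a) %% q%:Z)%Z%:~R / q%:R + ((j%:Z * a) %/ q%:Z)%Z%:~R :> R.
          rewrite [in LHS](divz_eq (j%:Z * a) q%:Z) intrD intrM -[q%:Z%:~R]/(q%:R : R).
          by field; rewrite gt_eqF.
        rewrite chordD_int.
        have qn0 : (q%:Z != 0)%R by rewrite eqz_nat -lt0n.
        have r0 := modz_ge0 (j%:Z * a) qn0.
        have rq := ltz_pmod (j%:Z * a) (d := q%:Z) ltac:(by []).
        have rn : ((j%:Z * a) %% q%:Z)%Z != 0.
          apply/eqP => /dvdz_mod0P; rewrite Gauss_dvdzl; last by rewrite coprimez_sym.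
          by rewrite -[(_ %| _)%Z]/(q %| j)%N => /(dvdn_leq j0); rewrite leqNgt (leq_ltn_trans _ Kltq).
        case: ((j%:Z * a) %% q%:Z)%Z r0 rq rn => // r _ rq rn.
        apply: le_trans (chord_frac_ge R q0 (ltnW _)); last by [].
        rewrite ler_wpM2r ?invr_ge0 // -[leLHS]mulr1 ler_wpM2l //.
        by rewrite ler1n leq_min lt0n subn_gt0 -eqz_nat rn; exact: rq.
      by lra.
    rewrite [leRHS]big_ltn // -[leLHS]add0r; apply: lerD; first exact: chord_cap_ge0.
    under [leRHS]eq_bigr do rewrite addr0.
    by apply: ler_sum_nat_widen => // i; exact: chord_cap_ge0.
  apply: (le_trans (block_sum _ _)) => //.
  have Kh : 0 <= K%:R * harm R q by rewrite mulr_ge0 // (le_trans _ h1).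
  have qh : q%:R <= q%:R * harm R q by rewrite ler_peMr // ltW.
  have tw : q%:R * harm R q <= K%:R * Y / q%:R + (K%:R + q%:R) * harm R q by lra.
  have c2 : 1 + 2 * k1%:R <= (1 + k1%:R) ^+ 2 :> R by have := sqr_ge0 (k1%:R : R); lra.
  apply: (@le_trans _ _ (2 * (1 + 2 * k1%:R) * (q%:R * harm R q))).
    have : 0 <= k1%:R * (q%:R * harm R q - q%:R) by rewrite mulr_ge0 // subr_ge0.
    have : 0 <= k1%:R * (q%:R * harm R q) by rewrite !mulr_ge0 // (le_trans _ h1).
    by lra.
  apply: ler_pM => //; rewrite ?mulr_ge0 ?addr_ge0 ?mulr_ge0 ?(le_trans _ h1) //.
  by rewrite ler_wpM2l.
have K0 : (0 < K)%N by lia.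
have Kb : (K.+1 <= (K %/ q).+1 * q)%N by rewrite ltn_ceil.
apply: (@le_trans _ _ (\sum_(0 <= j < (K %/ q).+1 * q) chord_cap Y (j%:R * theta + 0))).
  under [leRHS]eq_bigr do rewrite addr0.
  rewrite [leRHS]big_ltn; last by rewrite muln_gt0.
  rewrite -[leLHS]add0r; apply: lerD; first exact: chord_cap_ge0.
  by apply: ler_sum_nat_widen => // i; exact: chord_cap_ge0.
apply: (le_trans (blocks_sum _ _ _)) => //.
have bK : (K %/ q).+1%:R <= (1 + k1%:R) * (K%:R / q%:R) :> R.
  rewrite -addn1 natrD addrC mulrDl mul1r addrC; apply: lerD.
    by rewrite ler_pdivlMr // -natrM ler_nat leq_divM.
  by rewrite mulrA ler_pdivlMr // mul1r -natrM ler_nat mulnC ltnW.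
apply: (le_trans (ler_wpM2r _ bK)).
  by rewrite addr_ge0 // !mulr_ge0 // ?(le_trans _ h1) // ltW.
have -> : (1 + k1%:R) * (K%:R / q%:R) * (2 * k1%:R * Y + 2 * q%:R * harm R q) =
  2 * (1 + k1%:R) * (k1%:R * (K%:R * Y / q%:R) + K%:R * harm R q).
  by field; rewrite gt_eqF.
have Kh : 0 <= K%:R * harm R q by rewrite mulr_ge0 // (le_trans _ h1).
have qh : 0 <= q%:R * harm R q by rewrite mulr_ge0 // (le_trans _ h1).
rewrite expr2 [2 * (_ * _)]mulrA -[leRHS]mulrA ler_wpM2l ?mulr_ge0 ?addr_ge0 //.
rewrite mulrDl [(K%:R + _) * _]mulrDl; set s := _ / q%:R in KY *.
by nra.
Qed.

End RationalApproximation.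

(** * Bilinear exponential sums *)

Section BilinearSums.
Variable R : realType.
Variables (alpha : R) (u v : nat).

(** The additive character of frequency [h alpha] restricted to the residue
    class of [u] modulo [v]. *)
Definition twist (h n : nat) : R[i] :=
  if n == u %[mod v] then e2pi (n%:R * (h%:R * alpha)) else 0.

Lemma cabs_twist_le1 h n : cabs (twist h n) <= 1.
Proof. by rewrite /twist; case: ifP; rewrite ?cabs_e2pi ?cabs0. Qed.

Hypothesis v0 : (0 < v)%N.

(** The congruence [m k = u] is detected by characters modulo [v]; each of them
    shifts the frequency by a fraction of denominator [v], which disappears
    after multiplication by [v]. *)
Lemma twist_progression (h m X : nat) : (0 < X)%N ->
  cabs (\sum_(1 <= k < X.+1) twist h (m * k)) <=
  2 * v%:R * chord_cap X%:R ((h * m)%:R * (v%:R * alpha)).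
Proof.
move=> X0; have vn0 : v%:R != 0 :> R[i] by rewrite pnatr_eq0 -lt0n.
have vn0' : v%:R != 0 :> R by rewrite pnatr_eq0 -lt0n.
pose x := (h * m)%:R * alpha.
have tw k : twist h (m * k) = v%:R^-1 * \sum_(0 <= r < v)
    (e2pi (- (r%:R * (u%:R / v%:R))) * e2pi (k%:R * (x + (r * m)%:R / v%:R))).
  have dv : (v%:Z %| ((m * k)%N%:Z - u%:Z))%Z = (m * k == u %[mod v])%N.
    by rewrite -eqz_mod_dvd !modz_nat eqz_nat.
  have := sum_unity_roots R ((m * k)%N%:Z - u%:Z) v0; rewrite dv => su.
  transitivity (v%:R^-1 * (e2pi (k%:R * x) * \sum_(0 <= t < v)
      e2pi (t%:R * (((m * k)%N%:Z - u%:Z)%:~R / v%:R)))); last first.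
    congr (_ * _); rewrite big_distrr /=; apply: eq_bigr => r _.
    rewrite -!e2piD; congr e2pi; rewrite intrB /= /x !natrM.
    by field.
  rewrite su /twist; case: ifP => _; last by rewrite !mulr0.
  rewrite [RHS]mulrCA mulVf // mulr1; congr e2pi; rewrite /x !natrM; ring.
rewrite (eq_bigr _ (fun k _ => tw k)) -big_distrr /= exchange_big /=.
rewrite cabsM cabsV cabs_nat.
apply: (@le_trans _ _ (v%:R^-1 * \sum_(0 <= r < v)
    (2 * (v%:R * chord_cap X%:R ((h * m)%:R * (v%:R * alpha)))))).
  rewrite ler_wpM2l ?invr_ge0 //; apply: (le_trans (cabs_sum _ _ _)).
  apply: ler_sum => r _; rewrite -big_distrr /= cabsM cabs_e2pi mul1r.
  apply: (le_trans (geom_le _ _ _)); rewrite subn1 /= ler_wpM2l //.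
  apply: chord_cap_mulr => //; first by rewrite ltr0n.
  have -> : v%:R * (x + (r * m)%:R / v%:R) = (h * m)%:R * (v%:R * alpha) + (r * m)%N%:Z%:~R.
    by rewrite -[(r * m)%N%:Z%:~R]/((r * m)%:R : R) /x; field.
  by rewrite chordD_int.
rewrite big_const_nat iter_addr addr0 subn0 -[X in _ * X]mulr_natl mulKf //.
by rewrite mulrA.
Qed.

Lemma twist_weighted (N h m : nat) (w : nat -> R) : (0 < m)%N -> (m <= N)%N ->
  (forall k, 0 <= w k) -> (forall k, w k <= w k.+1) ->
  cabs (\sum_(1 <= k < N.+1 | (m * k <= N)%N) (w k)%:C%C * twist h (m * k)) <=
  4 * v%:R * w N.+1 * chord_cap (N %/ m)%:R ((h * m)%:R * (v%:R * alpha)).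
Proof.
move=> m0 mN w0 wm; have X0 : (0 < N %/ m)%N by rewrite divn_gt0.
rewrite (@sum_nat_cut _ _ _ N (N %/ m)) ?leq_div // => [|k]; last first.
  by rewrite leq_divRL // mulnC.
rewrite big_add1 /=.
set X := (N %/ m)%N in X0 *; set M := chord_cap _ _.
have M0 : 0 <= M by exact: chord_cap_ge0.
have wmono a b : (a <= b)%N -> w a <= w b.
  by move=> /subnK <-; elim: (b - a)%N => // d IH; rewrite addSn (le_trans IH).
apply: (@le_trans _ _ (2 * w X.+1 * (2 * v%:R * M))); last first.
  have : w X.+1 <= w N.+1 by rewrite wmono // ltnS leq_div.
  move=> /(ler_wpM2r (mulr_ge0 (ler0n R v) M0)); lra.
apply: (@abel_bound _ (fun k => w k.+1) (fun k => twist h (m * k.+1)%N)) => // k kX.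
have -> : \sum_(0 <= j < k) twist h (m * j.+1) = \sum_(1 <= j < k.+1) twist h (m * j).
  by rewrite [RHS]big_add1.
have [->|k0] := posnP k; first by rewrite big_geq // cabs0 !mulr_ge0.
apply: (le_trans (twist_progression _ _ k0)).
by rewrite ler_wpM2l ?mulr_ge0 // chord_cap_mono ?ltr0n // ler_nat.
Qed.

Variables (a : int) (q k1 : nat) (kappa : R).
Hypothesis q0 : (0 < q)%N.
Hypothesis aq : coprimez a q.
Hypothesis kappa0 : 0 <= kappa.
Hypothesis approx : `|v%:R * alpha - a%:~R / q%:R| <= kappa / q%:R ^+ 2.
Hypothesis k1_ge : 2 * pi * (1 + kappa) <= k1%:R.
Variables (N l : nat).
Hypothesis N0 : (0 < N)%N.
Hypothesis Nl : (N < 2 ^ l)%N.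
Hypothesis ql : (q < 2 ^ l)%N.

Let theta := v%:R * alpha.
Definition sieve_const : R := 2 * (1 + k1%:R) ^+ 2.

Lemma sieve_const_ge1 : 1 <= sieve_const.
Proof. by rewrite /sieve_const; have := ler0n R k1; nra. Qed.

Let C0p : 0 <= sieve_const := le_trans ler01 sieve_const_ge1.
Let hql : harm R q <= l%:R := harm_le R ql.
Let qR : 0 < q%:R :> R. Proof. by rewrite ltr0n. Qed.
Let l1 : 1 <= l%:R :> R. Proof. exact: le_trans (harm_ge1 R q0) hql. Qed.
Let v1 : 1 <= v%:R :> R. Proof. by rewrite ler1n. Qed.

Lemma multiples_sum_l (Y : R) (K : nat) : 0 < Y ->
  \sum_(1 <= j < K.+1) chord_cap Y (j%:R * theta) <=
  sieve_const * (K%:R * Y / q%:R + (K%:R + q%:R) * l%:R).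
Proof.
move=> Y0; apply: (le_trans (multiples_sum q0 aq kappa0 approx k1_ge K Y0)).
rewrite ler_wpM2l // lerD2l ler_wpM2l ?addr_ge0 //.
Qed.

(** Sums in which the long variable carries a smooth weight. The product
    [h m] of the frequency and the short variable is treated as one variable,
    at the cost of its divisor function. *)
Lemma type1_sum (H U : nat) (f : nat -> R) (w : nat -> R) (A D : R) :
  (U <= N)%N -> (forall m, `|f m| <= A) -> (forall m, (U < m)%N -> f m = 0) ->
  (forall k, 0 <= w k) -> (forall k, w k <= w k.+1) ->
  (forall n, (0 < n)%N -> (n <= 2 * H * U)%N -> (ndiv n)%:R <= D) ->
  0 <= D ->
  \sum_(1 <= h < H.+1) cabs (bilinear (twist h) N (fun m => (f m)%:C%C) (fun k => (w k)%:C%C)) <=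
  4 * v%:R * sieve_const * l%:R * A * w N.+1 * D *
    (2 * (H * N)%:R / q%:R + (2 * (H * U)%:R + q%:R) * l%:R).
Proof.
move=> UN fA fU w0 wm dD D0.
have A0 : 0 <= A by apply: le_trans (fA 0%N).
set E := _ + _ * l%:R.
have E0 : 0 <= E by rewrite addr_ge0 ?divr_ge0 ?mulr_ge0 ?addr_ge0 ?mulr_ge0.
have vr : 0 <= v%:R :> R by [].
pose c := 4 * v%:R * w N.+1 * A.
have c0 : 0 <= c by rewrite !mulr_ge0.
pose g (h m : nat) := if (m <= U)%N then chord_cap (N %/ m)%:R ((h * m)%:R * theta) else 0.
have g0 h m : 0 <= g h m by rewrite /g; case: ifP => // _; exact: chord_cap_ge0.
apply: (@le_trans _ _ (\sum_(1 <= h < H.+1) c * \sum_(0 <= i < l)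
     \sum_(2 ^ i <= m < 2 ^ i.+1) g h m)).
  apply: ler_sum => h _; rewrite -dyadic_sum.
  apply: (le_trans (cabs_sum _ _ _)).
  apply: (@le_trans _ _ (\sum_(1 <= m < N.+1) c * g h m)).
    apply: ler_sum_nat => m /andP[m0 mN].
    rewrite (eq_bigr (fun k => (f m)%:C%C * ((w k)%:C%C * twist h (m * k)))) => [|k _]; last by rewrite mulrA.
    rewrite -big_distrr /= cabsM cabs_real /g.
    case: leqP => mU; last by rewrite fU // normr0 mul0r mulr0.
    apply: (@le_trans _ _ (A * (4 * v%:R * w N.+1 * chord_cap (N %/ m)%:R ((h * m)%:R * (v%:R * alpha))))).
      by apply: ler_pM => //; [exact: cabs_ge0|exact: twist_weighted].
    by rewrite /c le_eqVlt; apply/orP; left; apply/eqP; rewrite /theta; ring.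
  rewrite -big_distrr /= ler_wpM2l //.
  exact: ler_sum_nat_widen.
rewrite -big_distrr /= exchange_big /=.
apply: (@le_trans _ _ (c * \sum_(0 <= i < l) (D * sieve_const * E))); last first.
  rewrite big_const_nat iter_addr addr0 subn0 -[_ *+ l]mulr_natl.
  by rewrite le_eqVlt; apply/orP; left; apply/eqP; rewrite /c; ring.
rewrite ler_wpM2l //; apply: ler_sum => i _.
have D'0 : 0 <= D * sieve_const * E by rewrite mulr_ge0 // mulr_ge0.
have [iU|iU] := leqP (2 ^ i) U; last first.
  rewrite big1 // => h _; rewrite big1_seq // => m /andP[_].
  rewrite mem_index_iota => /andP[im _]; rewrite /g leqNgt.
  by rewrite (leq_trans iU im).
have i0 : (0 < 2 ^ i)%N by rewrite expn_gt0.
have iN := leq_trans iU UN; have Y0 : (0 < N %/ 2 ^ i)%N by rewrite divn_gt0.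
pose M := (2 ^ i.+1).-1; have M1 : M.+1 = (2 ^ i.+1)%N by rewrite prednK // expn_gt0.
pose Y := (N %/ 2 ^ i)%N.
apply: (@le_trans _ _ (\sum_(1 <= h < H.+1) \sum_(1 <= m < M.+1) chord_cap Y%:R ((h * m)%:R * theta))).
  apply: ler_sum => h _; rewrite M1.
  rewrite [leRHS](@big_cat_nat _ _ _ (2 ^ i)) ?leq_exp2l //=.
  rewrite -[leLHS]add0r; apply: lerD; first by apply: sumr_ge0 => m _; exact: chord_cap_ge0.
  apply: ler_sum_nat => m /andP[im _]; rewrite /g; case: ifP => mU; last exact: chord_cap_ge0.
  have m0 : (0 < m)%N by exact: leq_trans i0 im.
  rewrite chord_cap_mono ?ltr0n ?divn_gt0 // ?(leq_trans mU) //.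
  by rewrite ler_nat leq_div2l.
apply: (le_trans (@sum_products_le _ (fun n => chord_cap Y%:R (n%:R * theta)) H M _)).
  by move=> n; exact: chord_cap_ge0.
have ML : (M < 2 * 2 ^ i)%N by rewrite -expnS -M1.
have HML : (H * M <= 2 * (H * U))%N.
  rewrite mulnCA leq_mul2l (leq_trans (ltnW ML)) ?orbT //.
  by rewrite leq_mul2l iU orbT.
apply: (@le_trans _ _ (\sum_(1 <= n < (H * M).+1) D * chord_cap Y%:R (n%:R * theta))).
  apply: ler_sum_nat => n /andP[n0 nH]; rewrite ler_wpM2r ?chord_cap_ge0 // dD //.
  by rewrite -mulnA; exact: leq_trans HML.
rewrite -big_distrr -mulrA ler_wpM2l //=.
apply: (le_trans (multiples_sum_l _ _)); first by rewrite ltr0n.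
rewrite ler_wpM2l //; apply: lerD.
  rewrite ler_wpM2r ?invr_ge0 // -!natrM ler_nat.
  rewrite -mulnA [(2 * _)%N]mulnCA leq_mul2l; apply/orP; right.
  apply: leq_trans (leq_mul (ltnW ML) (leqnn Y)) _.
  by rewrite -mulnA leq_mul2l /= mulnC leq_divM.
rewrite ler_wpM2r // lerD2r -natrM ler_nat //.
Qed.

(** The dual form of the large sieve inequality at the points [n alpha]:
    expanding the square leaves geometric sums of frequency [(k - k') alpha]. *)
Lemma large_sieve (X K : nat) (beta : nat -> R[i]) (B : R) :
  (0 < X)%N -> (forall k, cabs (beta k) <= B) ->
  \sum_(1 <= n < X.+1)
    cabs (\sum_(1 <= k < K.+1) beta k * e2pi (k%:R * (n%:R * alpha))) ^+ 2 <=
  B ^+ 2 * (2 * K%:R * (X%:R + 2 * v%:R * sieve_const *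
     (K%:R * X%:R / q%:R + (K%:R + q%:R) * l%:R))).
Proof.
move=> X0 bB; have B0 : 0 <= B by apply: le_trans (bB 0%N); exact: cabs_ge0.
have X0' : 0 < X%:R :> R by rewrite ltr0n.
set L := \sum_(1 <= n < X.+1) _.
have L0 : 0 <= L by apply: sumr_ge0 => n _; rewrite exprn_ge0 // cabs_ge0.
rewrite -[L]ger0_norm // -cabs_real.
have -> : (L%:C)%C = \sum_(1 <= k < K.+1) \sum_(1 <= j < K.+1)
    (beta k * (beta j)^*%C) * \sum_(1 <= n < X.+1) e2pi (n%:R * ((k%:R - j%:R) * alpha)).
  rewrite /L rmorph_sum /=.
  under [RHS]eq_bigr do (under eq_bigr do rewrite big_distrr /=).
  under [RHS]eq_bigr do rewrite exchange_big /=.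
  rewrite [RHS]exchange_big /=; apply: eq_bigr => n _.
  rewrite cabs_sqr rmorph_sum /= big_distrl /=; apply: eq_bigr => k _.
  rewrite big_distrr /=; apply: eq_bigr => j _.
  rewrite conjc_mul -e2piN mulrACA -e2piD; congr (_ * e2pi _); ring.
have row (k : nat) : (0 < k)%N -> (k <= K)%N ->
   \sum_(1 <= j < K.+1) chord_cap X%:R ((k%:R - j%:R) * alpha) <=
   X%:R + 2 * \sum_(1 <= j < K.+1) chord_cap X%:R (j%:R * alpha).
  move=> k0 kK.
  rewrite (@big_cat_nat _ _ _ k) //=; last exact: leqW.
  rewrite [X in _ + X]big_ltn ?ltnS //.
  have p1 : \sum_(1 <= j < k) chord_cap X%:R ((k%:R - j%:R) * alpha) <=
      \sum_(1 <= j < K.+1) chord_cap X%:R (j%:R * alpha).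
    rewrite big_nat_rev /= add1n; apply: (@le_trans _ _ (\sum_(1 <= j < k) chord_cap X%:R (j%:R * alpha))).
      apply: ler_sum_nat => j /andP[j0 jk].
      by rewrite subSS natrB ?(ltnW jk) // subKr.
    by apply: ler_sum_nat_widen; [move=> j; exact: chord_cap_ge0|exact: leqW].
  have p2 : \sum_(k.+1 <= j < K.+1) chord_cap X%:R ((k%:R - j%:R) * alpha) <=
      \sum_(1 <= j < K.+1) chord_cap X%:R (j%:R * alpha).
    rewrite -[k.+1]add1n big_addn; apply: (@le_trans _ _ (\sum_(1 <= j < K.+1 - k) chord_cap X%:R (j%:R * alpha))).
      apply: ler_sum_nat => j _; rewrite -chord_capN -mulNr opprB natrD addrK //.
    by apply: ler_sum_nat_widen; [move=> j; exact: chord_cap_ge0|exact: leq_subr].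
  have p3 : chord_cap X%:R ((k%:R - k%:R) * alpha) <= X%:R by exact: chord_cap_le.
  by lra.
set S := \sum_(1 <= j < K.+1) chord_cap X%:R (j%:R * alpha) in row *.
have SB : S <= v%:R * (sieve_const * (K%:R * X%:R / q%:R + (K%:R + q%:R) * l%:R)).
  apply: (@le_trans _ _ (v%:R * \sum_(1 <= j < K.+1) chord_cap X%:R (j%:R * theta))).
    rewrite big_distrr /=; apply: ler_sum => j _; apply: chord_cap_mulr => //.
    by rewrite /theta mulrCA.
  by rewrite ler_wpM2l // multiples_sum_l.
apply: (@le_trans _ _ (\sum_(1 <= k < K.+1) \sum_(1 <= j < K.+1)
    B ^+ 2 * (2 * chord_cap X%:R ((k%:R - j%:R) * alpha)))).
  apply: (le_trans (cabs_sum _ _ _)); apply: ler_sum => k _.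
  apply: (le_trans (cabs_sum _ _ _)); apply: ler_sum => j _.
  rewrite !cabsM cabsJ expr2; apply: ler_pM; rewrite ?mulr_ge0 ?cabs_ge0 //.
    by apply: ler_pM; rewrite ?cabs_ge0.
  by apply: (le_trans (geom_le _ _ _)); rewrite subn1.
apply: (@le_trans _ _ (\sum_(1 <= k < K.+1) B ^+ 2 * (2 * (X%:R + 2 * S)))).
  apply: ler_sum_nat => k /andP[k0 kK].
  by rewrite -big_distrr /= -big_distrr /= ler_wpM2l ?sqr_ge0 // ler_wpM2l // row.
rewrite big_const_nat iter_addr addr0 subn1 /= -[_ *+ K]mulr_natl mulrCA.
rewrite ler_wpM2l ?sqr_ge0 // mulrCA mulrA ler_wpM2l ?mulr_ge0 //.
by rewrite lerD2l; move: SB; set T := _ + _ * l%:R; lra.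
Qed.

Lemma frac_weight (P t : nat) (Y : R) : (0 < t)%N -> (t < P)%N ->
  P%:R^-1 * (2 * chord_cap Y (t%:R / P%:R)) <= t%:R^-1 + (P - t)%:R^-1.
Proof.
move=> t0 tP; have P0 : (0 < P)%N := leq_trans t0 (ltnW tP).
have PR : 0 < P%:R :> R by rewrite ltr0n.
pose M := (minn t (P - t))%:R : R.
have M0 : 0 < M by rewrite ltr0n leq_min t0 subn_gt0.
apply: (@le_trans _ _ (P%:R^-1 * (2 * (2 * M / P%:R)^-1))).
  rewrite ler_wpM2l ?invr_ge0 // ler_wpM2l //; apply: chord_cap_le_inv.
    by rewrite divr_gt0 // mulr_gt0.
  exact: chord_frac_ge (ltnW tP).
have -> : P%:R^-1 * (2 * (2 * M / P%:R)^-1) = M^-1.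
  by field; rewrite !gt_eqF.
by rewrite /M; case: (leqP t (P - t)) => _; rewrite ?lerDl ?lerDr invr_ge0.
Qed.

Lemma frac_weights (P : nat) :
  \sum_(1 <= t < P) (t%:R^-1 + (P - t)%:R^-1 : R) <= 2 * harm R P.-1.
Proof.
case: P => [|P]; first by rewrite big_geq // mulr_ge0 // harm_ge0.
rewrite big_split /= [X in _ + X]big_nat_rev /=.
rewrite [X in _ + X](eq_big_nat _ _ (F2 := fun t => t%:R^-1)) => [|t /andP[t0 tP]].
  by rewrite /harm; lra.
by rewrite add1n subSS subKn // ltnW.
Qed.

(** Completing the sum over [k] frees it from the condition [m k <= N], at the
    cost of weights whose sum is logarithmic. Afterwards [h] and [m] enter only
    through their product and through the class of [m] modulo [v]. *)
Lemma inner_complete (h m K P : nat) (g : nat -> R) : (0 < m)%N -> (m <= N)%N ->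
  (forall k, (K < k)%N -> g k = 0) -> (minn K (N %/ m) < P)%N ->
  cabs (\sum_(1 <= k < N.+1 | (m * k <= N)%N) (g k)%:C%C * twist h (m * k)) <=
  \sum_(0 <= t < P) (if t == 0%N then 1 else t%:R^-1 + (P - t)%:R^-1) *
    \sum_(0 <= r < v)
      cabs (\sum_(1 <= k < P)
        ((if r * k == u %[mod v] then (g k)%:C%C else 0) * e2pi (k%:R * (t%:R / P%:R))) *
        e2pi (k%:R * ((h * m)%:R * alpha))).
Proof.
move=> m0 mN gK XP; set X := minn K (N %/ m) in XP.
have P0 : (0 < P)%N by exact: leq_ltn_trans XP.
have PR : 0 < P%:R :> R by rewrite ltr0n.
pose c k := if k == 0%N then 0 else (g k)%:C%C * twist h (m * k).
have -> : \sum_(1 <= k < N.+1 | (m * k <= N)%N) (g k)%:C%C * twist h (m * k) =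
    \sum_(0 <= k < X.+1) c k.
  rewrite (bigID (fun k => k <= K)%N) /= [X in _ + X]big1 ?addr0; last first.
    by move=> k /andP[_]; rewrite -ltnNge => /gK ->; rewrite mul0r.
  rewrite (@sum_nat_cut _ _ _ N X); first last.
  - by move=> k; rewrite /X leq_min leq_divRL // mulnC andbC.
  - by rewrite /X geq_min leq_div orbT.
  rewrite [RHS]big_ltn // {1}/c eqxx add0r; apply: eq_big_nat => k /andP[k0 _].
  by rewrite /c eqn0Ngt k0.
pose G t := cabs (\sum_(0 <= k < P) c k * e2pi (k%:R * (t%:R / P%:R))).
have GB t : G t <= \sum_(0 <= r < v)
      cabs (\sum_(1 <= k < P)
        ((if r * k == u %[mod v] then (g k)%:C%C else 0) * e2pi (k%:R * (t%:R / P%:R))) *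
        e2pi (k%:R * ((h * m)%:R * alpha))).
  rewrite (bigD1_seq (m %% v)%N) ?iota_uniq ?mem_index_iota ?ltn_pmod //=.
  rewrite -[leLHS]addr0; apply: lerD; last by apply: sumr_ge0 => r _; exact: cabs_ge0.
  rewrite /G [X in cabs X <= _]big_ltn // {1}/c eqxx mul0r add0r le_eqVlt; apply/orP; left; apply/eqP.
  congr cabs; apply: eq_big_nat => k /andP[k0 _]; rewrite /c eqn0Ngt k0 /=.
  rewrite /twist modnMml; case: ifP => _; last by rewrite !mulr0 !mul0r.
  rewrite mulrAC; congr (_ * e2pi _); rewrite !natrM; ring.
have G0 t : 0 <= G t by exact: cabs_ge0.
have cS : cabs (\sum_(0 <= k < X.+1) c k) <= G 0%N + P%:R^-1 *
    \sum_(1 <= t < P) (2 * chord_cap X.+1%:R (t%:R / P%:R)) * G t.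
  have := completing c P0 XP; set S := \sum_(0 <= k < X.+1) c k.
  have -> : \sum_(0 <= k < P) c k = \sum_(0 <= k < P) c k * e2pi (k%:R * (0%:R / P%:R)).
    by apply: eq_bigr => k _; rewrite mul0r mulr0 e2pi0 mulr1.
  set S0 := \sum_(0 <= k < P) _ => h1.
  have h2 : cabs S <= cabs (S - X.+1%:R / P%:R * S0) + cabs (X.+1%:R / P%:R * S0).
    by apply: le_trans (cabsD _ _); rewrite subrK.
  apply: (le_trans h2); rewrite addrC; apply: lerD => //.
  rewrite !cabsM cabsV !cabs_nat -[leRHS]mul1r ler_wpM2r ?cabs_ge0 //.
  by rewrite ler_pdivrMr // mul1r ler_nat.
apply: (le_trans cS); rewrite [leRHS]big_ltn // eqxx mul1r.
apply: lerD; first exact: GB.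
rewrite big_distrr /=; apply: ler_sum_nat => t /andP[t0 tP].
rewrite eqn0Ngt t0 /= mulrA; apply: ler_pM => //; last exact: frac_weight.
by rewrite mulr_ge0 ?invr_ge0 // mulr_ge0 // chord_cap_ge0.
Qed.

Let sieve_bound (x k k0 hn hs : R) : 0 <= x -> 0 <= k -> 0 <= hs -> 0 <= hn ->
  k <= k0 -> k * x <= 2 * hn -> x <= 2 * hs ->
  x + 2 * v%:R * sieve_const * (k * x / q%:R + (k + q%:R) * l%:R) <=
  4 * v%:R * sieve_const * l%:R * (hn / q%:R + hs + k0 + q%:R).
Proof.
move=> x0 k0' hs0 hn0 kk kx xh.
have W1 : 1 <= v%:R * sieve_const by rewrite mulr_ege1 // sieve_const_ge1.
rewrite -[2 * v%:R * sieve_const]mulrA -[4 * v%:R * sieve_const]mulrA; set W := v%:R * sieve_const in W1 *.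
have W0 : 0 <= W by exact: le_trans ler01 W1.
have p0 : 0 <= hn / q%:R by rewrite divr_ge0.
have kxq : k * x / q%:R <= 2 * (hn / q%:R) by rewrite mulrA ler_wpM2r ?invr_ge0.
set p := hn / q%:R in p0 kxq *; set y := k * x / q%:R in kxq *.
have l1' := l1; have qR' := qR.
set L := l%:R in l1' *; set r := q%:R in qR' *.
have L0 : 0 <= L := le_trans ler01 l1'.
have WL : W <= W * L by rewrite ler_peMr.
have a1 : 0 <= (W * L - 1) * hs by rewrite mulr_ge0 // subr_ge0 mulr_ege1.
have a2 : 0 <= (W * L - W) * p by rewrite mulr_ge0 // subr_ge0.
have a3 : 0 <= W * (2 * p - y) by rewrite mulr_ge0 // subr_ge0.
have a4 : 0 <= W * L * (k0 - k).
  by apply: mulr_ge0; [exact: mulr_ge0|rewrite subr_ge0].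
have a5 : 0 <= W * L * hs := mulr_ge0 (mulr_ge0 W0 L0) hs0.
have a6 : 0 <= W * L * k := mulr_ge0 (mulr_ge0 W0 L0) k0'.
have a7 : 0 <= W * L * r := mulr_ge0 (mulr_ge0 W0 L0) (ltW qR').
have a8 : 0 <= W * L * p := mulr_ge0 (mulr_ge0 W0 L0) p0.
by lra.
Qed.

(** Neither variable carries a smooth weight. With [m] in a dyadic range
    [2 ^ i <= m < 2 ^ (i + 1)], Cauchy's inequality is applied to the sum over
    [n = h m], in which [n] occurs at most [ndiv n] times. These multiplicities
    are then counted in mean square, so that no power of [N] is lost: the large
    sieve inequality has about [H 2 ^ i] points and [min K0 (N / 2 ^ i)]
    coefficients. *)
Lemma type2_half (H s K0 : nat) (f g : nat -> R) (A B : R) :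
  (0 < H)%N -> (s <= N)%N -> (2 * H * s < 2 ^ l)%N ->
  (forall m, `|f m| <= A) -> (forall m, (s < m)%N -> f m = 0) ->
  (forall k, `|g k| <= B) -> (forall k, (K0 < k)%N -> g k = 0) ->
  \sum_(1 <= h < H.+1) cabs (bilinear (twist h) N (fun m => (f m)%:C%C) (fun k => (g k)%:C%C)) <=
  12 * v%:R ^+ 2 * sieve_const * A * B * l%:R ^+ 4 * Num.sqrt ((H * N)%:R *
     ((H * N)%:R / q%:R + (H * s)%:R + K0%:R + q%:R)).
Proof.
move=> H0 sN Hsl fA fs gB gK.
have A0 : 0 <= A by apply: le_trans (fA 0%N).
have B0 : 0 <= B by apply: le_trans (gB 0%N).
have l0 : 0 <= l%:R :> R by [].
set E := (H * N)%:R / q%:R + (H * s)%:R + K0%:R + q%:R.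
have E0 : 0 <= E by rewrite !addr_ge0 // divr_ge0.
set Q := Num.sqrt _.
have Q0 : 0 <= Q by exact: sqrtr_ge0.
pose inner h m := cabs (\sum_(1 <= k < N.+1 | (m * k <= N)%N) (g k)%:C%C * twist h (m * k)).
pose I h m := if (m <= s)%N then inner h m else 0.
have I0 h m : 0 <= I h m by rewrite /I; case: ifP => // _; exact: cabs_ge0.
apply: (@le_trans _ _ (\sum_(1 <= h < H.+1) A * \sum_(0 <= i < l)
     \sum_(2 ^ i <= m < 2 ^ i.+1) I h m)).
  apply: ler_sum => h _; rewrite -dyadic_sum.
  apply: (le_trans (cabs_sum _ _ _)).
  apply: (@le_trans _ _ (\sum_(1 <= m < N.+1) A * I h m)).
    apply: ler_sum_nat => m /andP[m0 mN].
    rewrite (eq_bigr (fun k => (f m)%:C%C * ((g k)%:C%C * twist h (m * k)))) => [|k _]; last by rewrite mulrA.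
    rewrite -big_distrr /= cabsM cabs_real /I.
    case: leqP => ms; last by rewrite fs // normr0 mul0r mulr0.
    by rewrite ler_wpM2r ?cabs_ge0.
  rewrite -big_distrr /= ler_wpM2l //.
  exact: ler_sum_nat_widen.
rewrite -big_distrr /= exchange_big /=.
apply: (@le_trans _ _ (A * \sum_(0 <= i < l) (3 * l%:R * (v%:R * (4 * v%:R * sieve_const * l%:R ^+ 2 * B * Q))))); last first.
  rewrite big_const_nat iter_addr addr0 subn0 -[X in _ * X]mulr_natl.
  by rewrite le_eqVlt; apply/orP; left; apply/eqP; ring.
rewrite ler_wpM2l //; apply: ler_sum => i _.
have RHS0 : 0 <= 3 * l%:R * (v%:R * (4 * v%:R * sieve_const * l%:R ^+ 2 * B * Q)).
  by rewrite !(C0p, mulr_ge0, exprn_ge0).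
have [is_|is_] := leqP (2 ^ i) s; last first.
  rewrite big1 // => h _; rewrite big1_seq // => m /andP[_].
  rewrite mem_index_iota => /andP[im _]; rewrite /I leqNgt.
  by rewrite (leq_trans is_ im).
have i0 : (0 < 2 ^ i)%N by rewrite expn_gt0.
pose M := (2 ^ i.+1).-1; have M1 : M.+1 = (2 ^ i.+1)%N by rewrite prednK // expn_gt0.
have ML : (M < 2 * 2 ^ i)%N by rewrite -expnS -M1.
have M0 : (0 < M)%N by rewrite -ltnS M1 -(expn0 2) ltn_exp2l.
pose K := minn K0 (N %/ 2 ^ i).
have KN : (K <= N)%N by rewrite /K geq_min leq_div orbT.
pose om (t : nat) : R := if t == 0%N then 1 else t%:R^-1 + (K.+1 - t)%:R^-1.
have om0 t : 0 <= om t by rewrite /om; case: ifP => // _; rewrite addr_ge0 ?invr_ge0.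
pose beta t r k := (if r * k == u %[mod v] then (g k)%:C%C else 0) * e2pi (k%:R * (t%:R / K.+1%:R : R)).
have betaB t r k : cabs (beta t r k) <= B.
  rewrite /beta cabsM cabs_e2pi mulr1; case: ifP => _; last by rewrite cabs0.
  by rewrite cabs_real.
pose G t r n := cabs (\sum_(1 <= k < K.+1) beta t r k * e2pi (k%:R * (n%:R * alpha))).
have G0 t r n : 0 <= G t r n by exact: cabs_ge0.
apply: (@le_trans _ _ (\sum_(1 <= h < H.+1) \sum_(1 <= m < M.+1)
    \sum_(0 <= t < K.+1) om t * \sum_(0 <= r < v) G t r (h * m)%N)).
  have S0 h m : 0 <= \sum_(0 <= t < K.+1) om t * \sum_(0 <= r < v) G t r (h * m)%N.
    by apply: sumr_ge0 => t _; rewrite mulr_ge0 // sumr_ge0.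
  apply: ler_sum => h _; rewrite M1 [leRHS](@big_cat_nat _ _ _ (2 ^ i)) ?leq_exp2l //=.
  rewrite -[leLHS]add0r; apply: lerD; first by apply: sumr_ge0.
  apply: ler_sum_nat => m /andP[im _]; rewrite /I; case: ifP => // ms.
  have m0 : (0 < m)%N by exact: leq_trans i0 im.
  apply: (@inner_complete h m K0 K.+1 g m0 (leq_trans ms sN) gK).
  rewrite ltnS /K leq_min geq_minl /=; apply: leq_trans (geq_minr _ _) _.
  exact: leq_div2l.
have block t r : \sum_(1 <= h < H.+1) \sum_(1 <= m < M.+1) G t r (h * m)%N <=
    4 * v%:R * sieve_const * l%:R ^+ 2 * B * Q.
  apply: (le_trans (sum_products_le _ _ (G0 t r))).
  apply: (le_trans (cauchy_schwarz _ _ _ _)).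
  have HM0 : (0 < H * M)%N by rewrite muln_gt0 H0.
  have HMs : (H * M <= 2 * H * s)%N.
    rewrite mulnAC mulnC leq_mul2r (leq_trans (ltnW ML)) ?orbT //.
    by rewrite leq_mul2l is_ orbT.
  have d2 := sum_ndiv_sqr_le R (H * M).
  have hHM := harm_le R (leq_ltn_trans HMs Hsl).
  have ls := large_sieve K HM0 (betaB t r).
  rewrite -sqrtrM; last by apply: sumr_ge0 => n _; rewrite sqr_ge0.
  set T := 4 * v%:R * sieve_const * l%:R ^+ 2 * B.
  have T0 : 0 <= T by rewrite !(C0p, mulr_ge0, exprn_ge0).
  rewrite -[T]ger0_norm // -sqrtr_sqr -sqrtrM ?sqr_ge0 // ler_wsqrtr //.
  have KX : K%:R * (H * M)%:R <= 2 * (H * N)%:R :> R.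
    rewrite -!natrM ler_nat mulnCA [(2 * _)%N]mulnCA leq_mul2l; apply/orP; right.
    apply: leq_trans (leq_mul (geq_minr _ _) (ltnW ML)) _.
    by rewrite mulnCA leq_mul2l /= leq_divM.
  have KK0 : K%:R <= K0%:R :> R by rewrite ler_nat geq_minl.
  have HMR : (H * M)%:R <= 2 * (H * s)%:R :> R by rewrite -natrM ler_nat mulnA.
  apply: (@le_trans _ _ (((H * M)%:R * l%:R ^+ 3) * (B ^+ 2 * (2 * K%:R * (4 * v%:R * sieve_const * l%:R * E))))).
    apply: ler_pM.
    - by apply: sumr_ge0 => n _; rewrite sqr_ge0.
    - by apply: sumr_ge0 => n _; rewrite sqr_ge0.
    - apply: (le_trans d2); rewrite ler_wpM2l // lerXn2r ?nnegrE ?harm_ge0 //.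
    apply: (le_trans ls); rewrite ler_wpM2l ?sqr_ge0 // ler_wpM2l ?mulr_ge0 //.
    exact: sieve_bound.
  have W1 : 1 <= v%:R * sieve_const by rewrite mulr_ege1 // sieve_const_ge1.
  have Z0 : 0 <= 8 * l%:R ^+ 4 * B ^+ 2 * (v%:R * sieve_const) * E.
    by rewrite !(C0p, mulr_ge0, exprn_ge0).
  apply: (@le_trans _ _ ((2 * (v%:R * sieve_const) * (H * N)%:R) * (8 * l%:R ^+ 4 * B ^+ 2 * (v%:R * sieve_const) * E))).
    rewrite [leLHS](_ : _ = K%:R * (H * M)%:R * (8 * l%:R ^+ 4 * B ^+ 2 * (v%:R * sieve_const) * E)); last by ring.
    rewrite ler_wpM2r // (le_trans KX) // -[2 * _ * _]mulrA ler_wpM2l // ler_peMl //.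
  by rewrite le_eqVlt; apply/orP; left; apply/eqP; rewrite /T; ring.
apply: (@le_trans _ _ (\sum_(0 <= t < K.+1) om t * \sum_(0 <= r < v)
   \sum_(1 <= h < H.+1) \sum_(1 <= m < M.+1) G t r (h * m)%N)).
  rewrite le_eqVlt; apply/orP; left; apply/eqP.
  under eq_bigr do rewrite exchange_big /=.
  rewrite exchange_big /=; apply: eq_bigr => t _.
  under eq_bigr do rewrite -big_distrr /=.
  rewrite -big_distrr /=; congr (_ * _).
  under eq_bigr do rewrite exchange_big /=.
  by rewrite exchange_big.
set T := 4 * v%:R * sieve_const * l%:R ^+ 2 * B * Q in RHS0 block *.
have T0 : 0 <= T by rewrite !(C0p, mulr_ge0, exprn_ge0).
apply: (@le_trans _ _ (\sum_(0 <= t < K.+1) om t * (v%:R * T))).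
  apply: ler_sum => t _; rewrite ler_wpM2l //.
  apply: (@le_trans _ _ (\sum_(0 <= r < v) T)); first by apply: ler_sum => r _.
  by rewrite big_const_nat iter_addr addr0 subn0 [leRHS]mulr_natl.
rewrite -big_distrl /= ler_wpM2r //; first by rewrite mulr_ge0.
rewrite big_ltn // {1}/om eqxx.
have : \sum_(1 <= t < K.+1) om t <= 2 * l%:R.
  apply: le_trans (_ : 2 * harm R K <= _); last first.
    by rewrite ler_wpM2l // harm_le // (leq_ltn_trans KN).
  apply: le_trans (frac_weights K.+1).
  by apply: ler_sum_nat => t /andP[t0 _]; rewrite /om eqn0Ngt t0.
by move: l1; lra.
Qed.

(** Of two factors with product at most [N] one is at most [sqrt N]; this one
    takes the role of the short variable. *)
Lemma type2_sum (H s K0 : nat) (f g : nat -> R) (A B : R) :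
  (0 < H)%N -> (s <= N)%N -> (N < s.+1 ^ 2)%N -> (2 * H * s < 2 ^ l)%N ->
  (forall m, `|f m| <= A) -> (forall m, (K0 < m)%N -> f m = 0) ->
  (forall k, `|g k| <= B) -> (forall k, (K0 < k)%N -> g k = 0) ->
  \sum_(1 <= h < H.+1) cabs (bilinear (twist h) N (fun m => (f m)%:C%C) (fun k => (g k)%:C%C)) <=
  24 * v%:R ^+ 2 * sieve_const * A * B * l%:R ^+ 4 * Num.sqrt ((H * N)%:R *
     ((H * N)%:R / q%:R + (H * s)%:R + K0%:R + q%:R)).
Proof.
move=> H0 sN Ns Hsl fA fK gB gK.
have lowA (e : nat -> R) c : (forall n, `|e n| <= c) -> forall n, `|low s e n| <= c.
  by move=> ec n; rewrite /low; case: ifP => // _; rewrite normr0 (le_trans _ (ec 0%N)).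
have low0 (e : nat -> R) n : (s < n)%N -> low s e n = 0.
  by rewrite /low ltnNge => /negPf ->.
have split h : bilinear (twist h) N (fun m => (f m)%:C%C) (fun k => (g k)%:C%C) =
    bilinear (twist h) N (fun m => (low s f m)%:C%C) (fun k => (g k)%:C%C) +
    bilinear (twist h) N (fun m => (low s g m)%:C%C) (fun k => (high s f k)%:C%C).
  rewrite (@bilinearD _ _ _ _ _ (fun m => (low s f m)%:C%C) (fun m => (high s f m)%:C%C)); last first.
    by move=> n; rewrite /low /high; case: ifP; rewrite ?addr0 ?add0r.
  congr (_ + _); rewrite bilinearC; apply: bilinear_eq => m k m0 k0 mk.
  rewrite /low /high; case: (leqP m s) => // sm; case: (leqP k s) => [|sk]; first by rewrite !mulr0.
  have : (s.+1 ^ 2 <= m * k)%N by rewrite expnS expn1 leq_mul.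
  by move=> /leq_trans/(_ mk); rewrite leqNgt Ns.
apply: (@le_trans _ _ (\sum_(1 <= h < H.+1)
   (cabs (bilinear (twist h) N (fun m => (low s f m)%:C%C) (fun k => (g k)%:C%C)) +
    cabs (bilinear (twist h) N (fun m => (low s g m)%:C%C) (fun k => (high s f k)%:C%C))))).
  by apply: ler_sum => h _; rewrite split cabsD.
rewrite big_split /=.
have highA n : `|high s f n| <= A.
  by rewrite /high; case: ifP => // _; rewrite normr0 (le_trans _ (fA 0%N)).
have highK n : (K0 < n)%N -> high s f n = 0.
  by move=> nK; rewrite /high fK // if_same.
have t1 := type2_half H0 sN Hsl (lowA _ _ fA) (low0 f) gB gK.
have t2 := type2_half H0 sN Hsl (lowA _ _ gB) (low0 g) highA highK.
by move: t1 t2; set Q := Num.sqrt _; lra.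
Qed.

Lemma ln_le_l (n : nat) : (0 < n)%N -> (n <= 2 ^ l)%N -> ln n%:R <= l%:R :> R.
Proof.
move=> n0 nl; apply: (@le_trans _ _ (ln (2 ^ l)%:R)).
  by rewrite ler_ln ?posrE ?ltr0n ?expn_gt0 // ler_nat.
rewrite natrX lnXn // -[leLHS]mulr_natl -[leRHS]mulr1 ler_wpM2l //.
by have := @le_ln1Dx R 1; rewrite (_ : 1 + 1 = 2) //; apply; lra.
Qed.

Lemma mobius_norm (n : nat) : `|mobius R n| <= 1.
Proof. by rewrite /mobius; case: ifP => _; rewrite ?normr0 // normrX normrN1 expr1n. Qed.

(** Vaughan's identity with both cuts at [U] of size about [N ^ (1/3)]: only
    the variables up to [U] are summed as short variables against a smooth
    one, and in all remaining bilinear pieces both variables stay below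
    [N / U]. *)
Lemma prime_sum (H U s : nat) (D : R) :
  (0 < H)%N -> (U.+1 ^ 3 <= N)%N -> (s <= N)%N -> (N < s.+1 ^ 2)%N ->
  (2 * H * s < 2 ^ l)%N ->
  (forall n, (0 < n)%N -> (n <= 2 * H * U)%N -> (ndiv n)%:R <= D) -> 0 <= D ->
  \sum_(1 <= h < H.+1)
    cabs (\sum_(1 <= n < N.+1) (von_mangoldt R n)%:C%C * twist h n) <=
  (H * U)%:R * l%:R +
  8 * v%:R * sieve_const * l%:R ^+ 2 * D * (2 * (H * N)%:R / q%:R + (2 * (H * U)%:R + q%:R) * l%:R) +
  48 * v%:R ^+ 2 * sieve_const * l%:R ^+ 5 * Num.sqrt ((H * N)%:R *
     ((H * N)%:R / q%:R + (H * s)%:R + (N %/ U.+1)%:R + q%:R)).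
Proof.
move=> H0 U3 sN Ns Hsl dD D0.
pose K0 := (N %/ U.+1)%N.
have UK : (U * U <= K0)%N.
  rewrite leq_divRL //; apply: leq_trans U3.
  by rewrite !expnS expn0 muln1 mulnA !leq_mul.
have UN : (U <= N)%N.
  by apply: leq_trans U3; rewrite expnS -[U]muln1 leq_mul // ?expn_gt0 // leqW // muln1.
have K0N : (K0 <= N)%N by exact: leq_div.
have lnl n : (0 < n)%N -> (n <= N)%N -> ln n%:R <= l%:R :> R.
  by move=> n0 nN; apply: ln_le_l => //; rewrite ltnW // (leq_ltn_trans nN).
have Lam0 := von_mangoldt_ge0 R.
pose Lam := von_mangoldt R.
have Lam_0 : Lam 0%N = 0.
  rewrite /Lam /von_mangoldt big_pred0 // => p; apply/negbTE/negP => /andP[pp _].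
  by move: (prime_gt0 pp); case: p {pp} => -[|p].
have Lam_1 : Lam 1%N = 0.
  by apply/eqP; rewrite eq_le Lam0 andbT (le_trans (von_mangoldt_le R _)) // ln1.
have LaL n : (n <= N)%N -> Lam n <= l%:R.
  case: n => [_|n nN]; first by rewrite Lam_0.
  by apply: le_trans (von_mangoldt_le R _) (lnl _ _ nN).
pose c m := \sum_(d <- divisors m) low U (mobius R) d * low U Lam (m %/ d).
have cB m : (m <= N)%N -> `|c m| <= l%:R.
  case: m => [_|m mN].
    rewrite /c (_ : divisors 0 = [:: 1%N]) // big_seq1 div0n.
    by rewrite (_ : low U Lam 0 = 0) ?mulr0 ?normr0 // /low Lam_0.
  apply: le_trans (lnl m.+1 _ mN) => //; rewrite -sum_von_mangoldt //.
  apply: (@le_trans _ _ (\sum_(d <- divisors m.+1) Lam (m.+1 %/ d)%N)).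
    apply: (le_trans (ler_norm_sum _ _ _)); apply: ler_sum => d _.
    rewrite normrM -[leRHS]mul1r; apply: ler_pM => //.
      by rewrite /low; case: ifP => _; [exact: mobius_norm|rewrite normr0].
    by rewrite /low; case: ifP => _; rewrite ?normr0 // ger0_norm.
  rewrite le_eqVlt; apply/orP; left; apply/eqP.
  rewrite -(big_map (fun d => m.+1 %/ d)%N xpredT Lam); apply: perm_big.
  exact: perm_codivisors.
have cU m : (U * U < m)%N -> c m = 0.
  move=> Um; rewrite /c big_seq big1 // => d; rewrite -dvdn_divisors ?(leq_trans _ Um) // => dm.
  rewrite /low; case: leqP => dU; last by rewrite mul0r.
  case: leqP => eU; last by rewrite mulr0.
  by move: Um; rewrite -(divnK dm) ltnNge leq_mul.
pose lam n := \sum_(e <- divisors n) high U Lam e.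
have lamB n : (n <= N)%N -> `|lam n| <= l%:R.
  case: n => [_|n nN].
    by rewrite /lam (_ : divisors 0 = [:: 1%N]) // big_seq1 /high Lam_1 if_same normr0.
  apply: le_trans (lnl n.+1 _ nN) => //; rewrite -sum_von_mangoldt //.
  apply: (le_trans (ler_norm_sum _ _ _)); apply: ler_sum => d _.
  by rewrite /high; case: ifP => _; rewrite ?normr0 // ger0_norm.
have lamU n : (n <= U)%N -> lam n = 0.
  case: n => [_|n nU].
    by rewrite /lam (_ : divisors 0 = [:: 1%N]) // big_seq1 /high Lam_1 if_same.
  rewrite /lam big_seq big1 // => d; rewrite -dvdn_divisors // => /(dvdn_leq (ltn0Sn n)) dn.
  by rewrite /high (leq_trans dn).
pose cA := low U c; pose cC := high U c.
pose one n : R := if (n <= K0)%N then 1 else 0.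
pose mu' := low K0 (high U (mobius R)); pose lam' := low K0 lam.
have K0P m k : (U < m)%N -> (m * k <= N)%N -> (k <= K0)%N.
  by move=> Um mk; rewrite leq_divRL // mulnC (leq_trans _ mk) // leq_mul.
pose S h := \sum_(1 <= n < N.+1) (Lam n)%:C%C * twist h n.
pose T0 h := \sum_(1 <= n < N.+1) (low U Lam n)%:C%C * twist h n.
pose T1 h := bilinear (twist h) N (fun m => (low U (mobius R) m)%:C%C) (fun k => (ln (k%:R : R))%:C%C).
pose T2 h := bilinear (twist h) N (fun m => (cA m)%:C%C) (fun k => (1 : R)%:C%C).
pose T3 h := bilinear (twist h) N (fun m => (cC m)%:C%C) (fun k => (one k)%:C%C).
pose T4 h := bilinear (twist h) N (fun m => (mu' m)%:C%C) (fun k => (lam' k)%:C%C).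
have lowC V (f : nat -> R) n : low V (fun n => (f n)%:C%C) n = (low V f n)%:C%C.
  by rewrite /low; case: ifP.
have highC V (f : nat -> R) n : high V (fun n => (f n)%:C%C) n = (high V f n)%:C%C.
  by rewrite /high; case: ifP.
have Sdec h : S h = T0 h + T1 h - (T2 h + T3 h) + T4 h.
  rewrite /S (@vaughan _ (twist h) N U (fun n => (mobius R n)%:C%C) (fun n => (Lam n)%:C%C)
     (fun n => (ln (n%:R : R))%:C%C)); first last.
  - by move=> n n0; rewrite -(sum_von_mangoldt R n0) rmorph_sum.
  - by move=> n n0; rewrite -rmorph_sum /= (sum_mobius R n0); case: eqP.
  congr (_ + _ - _ + _).
  - by apply: eq_bigr => n _; rewrite lowC.
  - by apply: bilinear_eq => m k _ _ _; rewrite lowC.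
  - have -> : T3 h = bilinear (twist h) N (fun m => (cC m)%:C%C) (fun k => (1 : R)%:C%C).
      apply: bilinear_eq => m k m0 k0 mk; rewrite /cC /high /one.
      by case: leqP => Um; [rewrite !mul0r|rewrite (K0P m)].
    rewrite -(@bilinearD _ _ _ (fun m => (c m)%:C%C)) => [|n].
      apply: bilinear_eq => m k _ _ _; congr (_ * _); rewrite /c rmorph_sum /=.
      by apply: eq_bigr => d _; rewrite !lowC rmorphM.
    by rewrite /cA /cC /low /high; case: ifP; rewrite ?addr0 ?add0r.
  - apply: bilinear_eq => m k m0 k0 mk; rewrite highC.
    rewrite (eq_bigr (fun e => (high U Lam e)%:C%C)) => [|e _]; last by rewrite highC.
    rewrite -rmorph_sum /= -/(lam k) /mu' /lam' -!rmorphM /=; congr (_%:C)%C.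
    case: (leqP k U) => kU.
      by rewrite /low lamU // if_same !mulr0.
    have mK : (m <= K0)%N by apply: (K0P k) => //; rewrite mulnC.
    rewrite {1}/low mK; case: (leqP m U) => mU; first by rewrite /high mU !mul0r.
    by rewrite /low (K0P m).
have bT0 : \sum_(1 <= h < H.+1) cabs (T0 h) <= (H * U)%:R * l%:R.
  apply: (@le_trans _ _ (\sum_(1 <= h < H.+1) (U%:R * l%:R))); last first.
    by rewrite big_const_nat iter_addr addr0 subn1 /= natrM -mulrA [leRHS]mulr_natl.
  apply: ler_sum => h _; apply: (le_trans (cabs_sum _ _ _)).
  apply: (@le_trans _ _ (\sum_(1 <= n < N.+1 | (n <= U)%N) l%:R)).
    rewrite [leRHS]big_mkcond /=; apply: ler_sum_nat => n /andP[_ nN].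
    rewrite cabsM cabs_real /low; case: ifP => _; last by rewrite normr0 mul0r.
    rewrite ger0_norm // -[leRHS]mulr1; apply: ler_pM; rewrite ?cabs_ge0 ?cabs_twist_le1 //.
    exact: LaL.
  rewrite (@sum_nat_cut _ _ _ N U) // big_const_nat iter_addr addr0 subn1 /=.
  by rewrite [leRHS]mulr_natl.
have E0 : 0 <= 2 * (H * N)%:R / q%:R + (2 * (H * U)%:R + q%:R) * l%:R :> R.
  by rewrite addr_ge0 ?divr_ge0 ?mulr_ge0 ?addr_ge0 ?mulr_ge0.
have bT1 := @type1_sum H U (low U (mobius R)) (fun k => ln k%:R) 1 D UN.
have bT2 := @type1_sum H U cA (fun=> 1) l%:R D UN.
have bT3 := @type2_sum H s K0 cC one l%:R 1 H0 sN Ns Hsl.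
have bT4 := @type2_sum H s K0 mu' lam' 1 l%:R H0 sN Ns Hsl.
have {}bT1 : \sum_(1 <= h < H.+1) cabs (T1 h) <= 4 * v%:R * sieve_const * l%:R * l%:R * D *
    (2 * (H * N)%:R / q%:R + (2 * (H * U)%:R + q%:R) * l%:R).
  have lnN : ln N.+1%:R <= l%:R :> R by exact: ln_le_l.
  apply: le_trans (bT1 _ _ _ _ dD D0) _.
  - by move=> m; rewrite /low; case: ifP => _; [exact: mobius_norm|rewrite normr0].
  - by move=> m mU; rewrite /low leqNgt mU.
  - by case=> [|k]; [rewrite ln0|rewrite ln_ge0 // ler1n].
  - by case=> [|k]; [rewrite ln0 // ln1|rewrite ler_ln ?posrE ?ltr0n // ler_nat].
  apply: ler_wpM2r => //; apply: ler_wpM2r => //; rewrite mulr1; apply: ler_wpM2l lnN.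
  by rewrite !(C0p, mulr_ge0).
have {}bT2 : \sum_(1 <= h < H.+1) cabs (T2 h) <= 4 * v%:R * sieve_const * l%:R * l%:R * D *
    (2 * (H * N)%:R / q%:R + (2 * (H * U)%:R + q%:R) * l%:R).
  apply: le_trans (bT2 _ _ _ _ dD D0) _ => //; last by rewrite mulr1.
  - move=> m; rewrite /cA /low; case: ifP => mU; rewrite ?normr0 //.
    by rewrite cB // (leq_trans mU).
  - by move=> m mU; rewrite /cA /low leqNgt mU.
have {}bT3 := bT3 _ _ _ _; have {}bT4 := bT4 _ _ _ _.
set Q := Num.sqrt _ in bT3 bT4 *.
have {}bT3 : \sum_(1 <= h < H.+1) cabs (T3 h) <= 24 * v%:R ^+ 2 * sieve_const * l%:R ^+ 5 * Q.
  apply: le_trans (bT3 _ _ _ _) _.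
  - move=> m; rewrite /cC /high; case: ifP => mU; rewrite ?normr0 //.
    case: (leqP m (U * U)) => mUU; last by rewrite cU // normr0.
    by rewrite cB // (leq_trans mUU) // (leq_trans UK).
  - move=> m mK; rewrite /cC /high cU ?if_same //; exact: leq_ltn_trans mK.
  - by move=> k; rewrite /one; case: ifP => _; rewrite ?normr0 ?normr1.
  - by move=> k kK; rewrite /one leqNgt kK.
  by rewrite le_eqVlt; apply/orP; left; apply/eqP; ring.
have {}bT4 : \sum_(1 <= h < H.+1) cabs (T4 h) <= 24 * v%:R ^+ 2 * sieve_const * l%:R ^+ 5 * Q.
  apply: le_trans (bT4 _ _ _ _) _.
  - move=> m; rewrite /mu' /low /high; case: ifP => _; last by rewrite normr0.
    by case: ifP => _; [rewrite normr0|exact: mobius_norm].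
  - by move=> m mK; rewrite /mu' /low leqNgt mK.
  - move=> k; rewrite /lam' /low; case: ifP => kK; rewrite ?normr0 //.
    by rewrite lamB // (leq_trans kK).
  - by move=> k kK; rewrite /lam' /low leqNgt kK.
  by rewrite le_eqVlt; apply/orP; left; apply/eqP; ring.
apply: (@le_trans _ _ (\sum_(1 <= h < H.+1) (cabs (T0 h) + cabs (T1 h) + (cabs (T2 h) + cabs (T3 h)) + cabs (T4 h)))).
  apply: ler_sum => h _; rewrite -/(S h) Sdec.
  apply: (le_trans (cabsD _ _)); rewrite lerD2r.
  apply: (le_trans (cabsD _ _)); rewrite cabsN; apply: lerD; exact: cabsD.
rewrite !big_split /=.
move: bT0 bT1 bT2 bT3 bT4; set E := (_ + _ * l%:R : R); lra.
Qed.

End BilinearSums.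

(** * Windows of residues and arcs of the circle *)

Section Windows.
Variable R : realType.

(** The residues modulo [M] of [A n - B] that lie within [w] of zero form a
    window of [2 w + 1] consecutive classes after a shift by [w]; completing
    expresses the weighted number of hits by exponential sums. *)
Lemma window_sum (A B : int) (M u v N w : nat) (lam : nat -> R) :
  (0 < M)%N -> (2 * w < M)%N ->
  `|\sum_(1 <= n < N.+1 | n == u %[mod v])
       (if (`|((A * n%:Z - B + w%:Z) %% M%:Z)%Z| < (2 * w).+1)%N then lam n else 0)
    - (2 * w).+1%:R / M%:R * \sum_(1 <= n < N.+1 | n == u %[mod v]) lam n| <=
  M%:R^-1 * \sum_(1 <= t < M) (2 * chord_cap (2 * w).+1%:R (t%:R / M%:R)) *
    cabs (\sum_(1 <= n < N.+1) (lam n)%:C%C * twist (A%:~R / M%:R) u v t n).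
Proof.
move=> M0 wM; set X := (2 * w).+1.
pose y (n : nat) := `|((A * n%:Z - B + w%:Z) %% M%:Z)%Z|%N.
have Mn0 : (M%:Z != 0)%R by rewrite eqz_nat -lt0n.
have MR : M%:R != 0 :> R by rewrite pnatr_eq0 -lt0n.
have yE n : (y n)%:Z = ((A * n%:Z - B + w%:Z) %% M%:Z)%Z.
  by rewrite /y gez0_abs // modz_ge0.
have yM n : (y n < M)%N by rewrite -ltz_nat yE ltz_pmod.
pose c (k : nat) : R[i] := \sum_(1 <= n < N.+1 | n == u %[mod v]) (if k == y n then (lam n)%:C%C else 0).
have cg (X' : nat) (g : nat -> R[i]) : \sum_(0 <= k < X') c k * g k =
    \sum_(1 <= n < N.+1 | n == u %[mod v]) (if (y n < X')%N then (lam n)%:C%C * g (y n) else 0).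
  under eq_bigr do rewrite big_distrl /=.
  rewrite exchange_big /=; apply: eq_bigr => n _.
  rewrite (eq_bigr (fun k => if k == y n then (lam n)%:C%C * g k else 0)) => [|k _].
    by rewrite -big_mkcond big_nat1_eq.
  by case: eqP; rewrite ?mul0r.
have := completing c M0 wM; rewrite -/X.
have c1 X' : \sum_(0 <= k < X') c k =
    (\sum_(1 <= n < N.+1 | n == u %[mod v]) (if (y n < X')%N then lam n else 0))%:C%C.
  have := cg X' (fun=> 1); under eq_bigr do rewrite mulr1; move=> ->.
  by rewrite rmorph_sum /=; apply: eq_bigr => n _; case: ifP; rewrite ?mulr1.
rewrite !c1.
have -> : \sum_(1 <= n < N.+1 | n == u %[mod v]) (if (y n < M)%N then lam n else 0) =
    \sum_(1 <= n < N.+1 | n == u %[mod v]) lam n.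
  by apply: eq_bigr => n _; rewrite yM.
have -> : X%:R / M%:R = (X%:R / M%:R)%:C%C :> R[i].
  by rewrite rmorphM /= fmorphV !rmorph_nat.
rewrite -rmorphM /= -rmorphB /= cabs_real.
move=> /le_trans; apply; rewrite ler_wpM2l ?invr_ge0 //.
apply: ler_sum_nat => t /andP[t0 tM].
rewrite ler_wpM2l ?mulr_ge0 ?chord_cap_ge0 // cg.
have phase (x : R) (z : R[i]) : cabs z = cabs (e2pi x * z).
  by rewrite cabsM cabs_e2pi mul1r.
rewrite (phase ((B%:~R - w%:R) * (t%:R / M%:R)) (\sum_(1 <= n < N.+1 | _) _)).
rewrite le_eqVlt; apply/orP; left; apply/eqP; congr cabs.
rewrite big_distrr big_mkcond /=; apply: eq_bigr => n _.
rewrite yM /twist; case: ifP => _; last by rewrite mulr0.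
rewrite mulrCA -e2piD; congr (_ * _).
have -> : (y n)%:R = A%:~R * n%:R - B%:~R + w%:R - ((A * n%:Z - B + w%:Z) %/ M%:Z)%Z%:~R * M%:R :> R.
  have e : (A * n%:Z - B + w%:Z)%:~R = ((A * n%:Z - B + w%:Z) %/ M%:Z)%Z%:~R * M%:R + (y n)%:R :> R.
    by rewrite [in LHS](divz_eq (A * n%:Z - B + w%:Z) M%:Z) intrD intrM -yE.
  have e2 : (A * n%:Z - B + w%:Z)%:~R = A%:~R * n%:R - B%:~R + w%:R :> R.
    by rewrite intrD intrB intrM.
  by rewrite -e2 e; ring.
set z := (_ %/ _)%Z.
have -> : (B%:~R - w%:R) * (t%:R / M%:R) +
   (A%:~R * n%:R - B%:~R + w%:R - z%:~R * M%:R) * (t%:R / M%:R) =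
   n%:R * (t%:R * (A%:~R / M%:R)) + (- z * t%:Z)%:~R :> R.
  by rewrite intrM intrN -[t%:Z%:~R]/(t%:R : R); field.
by rewrite e2piD e2pi_int mulr1.
Qed.

Lemma twist_sym (A : int) (M u v N t : nat) (lam : nat -> R) :
  (0 < M)%N -> (t <= M)%N ->
  cabs (\sum_(1 <= n < N.+1) (lam n)%:C%C * twist (A%:~R / M%:R) u v (M - t) n) =
  cabs (\sum_(1 <= n < N.+1) (lam n)%:C%C * twist (A%:~R / M%:R) u v t n).
Proof.
move=> M0 tM; have MR : M%:R != 0 :> R by rewrite pnatr_eq0 -lt0n.
rewrite -[RHS]cabsJ; congr cabs; rewrite rmorph_sum /=; apply: eq_bigr => n _.
rewrite conjc_mul conjc_real /twist; case: ifP => _; last by rewrite conjc0.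
rewrite -e2piN natrB //; congr (_ * _).
have -> : n%:R * ((M%:R - t%:R) * (A%:~R / M%:R)) =
   - (n%:R * (t%:R * (A%:~R / M%:R))) + (n%:Z * A)%:~R :> R.
  by rewrite intrM -[n%:Z%:~R]/(n%:R : R); field.
by rewrite e2piD e2pi_int mulr1.
Qed.

Lemma half_sum (phi : nat -> R) (M : nat) :
  (forall t, 0 <= phi t) -> (forall t, (t <= M)%N -> phi (M - t)%N = phi t) ->
  \sum_(1 <= t < M) phi t <= 2 * \sum_(1 <= t < (M %/ 2).+1) phi t.
Proof.
move=> p0 ps; have hM : (M %/ 2 <= M)%N := leq_div M 2.
case: (leqP M (M %/ 2).+1) => MM.
  apply: (le_trans (ler_sum_nat_widen 1 p0 MM)).
  by rewrite mulr_natl mulr2n lerDl sumr_ge0.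
rewrite (@big_cat_nat _ _ _ (M %/ 2).+1) ?(ltnW MM) //= mulr_natl mulr2n lerD2l.
rewrite big_nat_rev /= (eq_big_nat _ _ (F2 := fun i => phi (i - M %/ 2)%N)) => [|i /andP[i1 i2]].
  rewrite -[(M %/ 2).+1 in X in X <= _]add1n big_addn.
  rewrite (eq_bigr phi) => [|i _]; last by rewrite addnK.
  by apply: ler_sum_nat_widen => //; have := divn_eq M 2; have := ltn_pmod M (isT : 0 < 2)%N; lia.
by rewrite -ps; [congr phi; lia|lia].
Qed.

End Windows.

Section Discrepancy.
Variable R : realType.

(** Dyadic summation over the frequencies [t]: the Fourier coefficient of a
    window is at most [min delta (1 / t)], and every term of the bound for the
    sum over [t <= H] grows at most linearly in [H]. The terms that grow like
    [H ^ (1/2)] or stay bounded gain a power of [delta]. *)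
Lemma frequency_sum (A : int) (M u v N l U s X : nat) (a : int) (q k1 : nat)
    (kappa delta D : R) :
  (0 < v)%N -> (0 < q)%N -> coprimez a q -> 0 <= kappa ->
  `|v%:R * (A%:~R / M%:R) - a%:~R / q%:R| <= kappa / q%:R ^+ 2 ->
  2 * pi * (1 + kappa) <= k1%:R ->
  (N < 2 ^ l)%N -> (q < 2 ^ l)%N -> (M < 2 ^ l)%N -> (2 * M * s < 2 ^ l)%N ->
  (0 < M)%N -> (0 < X)%N -> 2 * X%:R / M%:R <= delta ->
  (U.+1 ^ 3 <= N)%N -> (s <= N)%N -> (N < s.+1 ^ 2)%N ->
  (forall n, (0 < n)%N -> (n <= 2 * M * U)%N -> (ndiv n)%:R <= D) -> 0 <= D ->
  M%:R^-1 * \sum_(1 <= t < M) (2 * chord_cap X%:R (t%:R / M%:R)) *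
    cabs (\sum_(1 <= n < N.+1) (von_mangoldt R n)%:C%C * twist (A%:~R / M%:R) u v t n) <=
  2 * (l%:R * (2 * U%:R * l%:R +
    8 * v%:R * sieve_const R k1 * l%:R ^+ 2 * D *
      (4 * N%:R / q%:R + (4 * U%:R + delta * q%:R) * l%:R) +
    48 * v%:R ^+ 2 * sieve_const R k1 * l%:R ^+ 5 *
      Num.sqrt (4 * N%:R ^+ 2 / q%:R + 4 * N%:R * s%:R +
         2 * delta * N%:R * ((N %/ U.+1)%:R + q%:R)))).
Proof.
move=> v0 q0 aq kappa0 approx k1_ge Nl ql Ml Msl M0 X0 Xd U3 sN Ns dD D0.
have MR : 0 < M%:R :> R by rewrite ltr0n.
have qR : 0 < q%:R :> R by rewrite ltr0n.
have d0 : 0 <= delta by apply: le_trans Xd; rewrite divr_ge0 // mulr_ge0.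
pose sg t := cabs (\sum_(1 <= n < N.+1) (von_mangoldt R n)%:C%C * twist (A%:~R / M%:R) u v t n).
have sg0 t : 0 <= sg t by exact: cabs_ge0.
pose phi t := M%:R^-1 * (2 * chord_cap X%:R (t%:R / M%:R)) * sg t.
have phi0 t : 0 <= phi t by rewrite /phi mulr_ge0 // mulr_ge0 ?invr_ge0 // mulr_ge0 // chord_cap_ge0.
have phis t : (t <= M)%N -> phi (M - t)%N = phi t.
  move=> tM; rewrite /phi /sg twist_sym //; congr (_ * (2 * _) * _).
  have -> : (M - t)%:R / M%:R = - (t%:R / M%:R) + 1%:~R :> R.
    by rewrite natrB //; field; rewrite gt_eqF.
  by rewrite /chord_cap chordD_int chordN.
rewrite big_distrr /= (eq_bigr phi) => [|t _]; last by rewrite /phi mulrA.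
apply: (le_trans (half_sum phi0 phis)); rewrite ler_wpM2l //.
set Z := _ + _ * Num.sqrt _.
have CC0 : 0 <= sieve_const R k1 by exact: le_trans ler01 (sieve_const_ge1 R k1).
pose b1 : R := 8 * v%:R * sieve_const R k1 * l%:R ^+ 2 * D.
pose b2 : R := 48 * v%:R ^+ 2 * sieve_const R k1 * l%:R ^+ 5.
have b10 : 0 <= b1 by rewrite !(CC0, mulr_ge0, exprn_ge0).
have b20 : 0 <= b2 by rewrite !(CC0, mulr_ge0, exprn_ge0).
have Z0 : 0 <= Z.
  rewrite /Z -/b1 -/b2; apply: addr_ge0; last by rewrite mulr_ge0 // sqrtr_ge0.
  apply: addr_ge0; first by rewrite !mulr_ge0.
  rewrite mulr_ge0 // addr_ge0 ?divr_ge0 ?mulr_ge0 //.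
  by rewrite addr_ge0 ?mulr_ge0.
have hM : (M %/ 2 <= M)%N := leq_div M 2.
pose g t := if (t <= M %/ 2)%N then phi t else 0.
have g0 t : 0 <= g t by rewrite /g; case: ifP.
apply: (@le_trans _ _ (\sum_(1 <= t < 2 ^ l) g t)).
  apply: (@le_trans _ _ (\sum_(1 <= t < (M %/ 2).+1) g t)).
    by apply: ler_sum_nat => t /andP[_ tM]; rewrite /g -ltnS tM.
  by apply: ler_sum_nat_widen => //; exact: leq_ltn_trans Ml.
rewrite dyadic_sum; apply: (@le_trans _ _ (\sum_(0 <= i < l) Z)); last first.
  by rewrite big_const_nat iter_addr addr0 subn0 [leRHS]mulr_natl.
apply: ler_sum => i _.
have [iM|iM] := leqP (2 ^ i) (M %/ 2); last first.
  rewrite big1_seq // => t /andP[_]; rewrite mem_index_iota => /andP[it _].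
  by rewrite /g leqNgt (leq_trans iM it).
have i0 : (0 < 2 ^ i)%N by rewrite expn_gt0.
pose H := (2 ^ i.+1)%N.
have H0 : (0 < H)%N by rewrite expn_gt0.
have HM : (H <= M)%N by rewrite /H expnS mulnC -leq_divRL.
pose gam : R := Num.min delta (2 ^ i)%:R^-1.
have gam0 : 0 <= gam by rewrite le_min d0 invr_ge0 ler0n.
have gd : gam <= delta by rewrite ge_min lexx.
have gH : gam * H%:R <= 2.
  apply: (@le_trans _ _ ((2 ^ i)%:R^-1 * H%:R)); first by rewrite ler_wpM2r // ge_min lexx orbT.
  by rewrite /H expnS natrM mulrCA mulVf ?mulr1 // pnatr_eq0 -lt0n.
have gph t : (2 ^ i <= t)%N -> g t <= gam * sg t.
  move=> it; rewrite /g; case: ifP => tM; last by rewrite mulr_ge0.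
  have t0 : (0 < t)%N := leq_trans i0 it.
  rewrite /phi ler_wpM2r // le_min; apply/andP; split.
    apply: le_trans Xd; rewrite mulrC ler_wpM2r ?invr_ge0 // ler_wpM2l //.
    by rewrite chord_cap_le // ltr0n.
  have tR : 0 < t%:R :> R by rewrite ltr0n.
  have tMle : (t <= M)%N := leq_trans tM hM.
  have tmin : minn t (M - t) = t.
    apply/minn_idPl; rewrite leq_subRL // addnn -muln2.
    by rewrite -leq_divRL.
  have c := chord_frac_ge R M0 tMle; rewrite tmin in c.
  have cp : 0 < 2 * t%:R / M%:R :> R by rewrite divr_gt0 // mulr_gt0.
  apply: (@le_trans _ _ (M%:R^-1 * (2 * (2 * t%:R / M%:R)^-1))).
    by rewrite ler_wpM2l ?invr_ge0 // ler_wpM2l // chord_cap_le_inv.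
  have -> : M%:R^-1 * (2 * (2 * t%:R / M%:R)^-1) = t%:R^-1 :> R.
    by field; rewrite !gt_eqF.
  by rewrite lef_pV2 ?posrE ?ltr0n // ler_nat.
apply: (@le_trans _ _ (gam * \sum_(1 <= h < H.+1) sg h)).
  rewrite big_distrr /=.
  apply: (@le_trans _ _ (\sum_(2 ^ i <= t < 2 ^ i.+1) gam * sg t)).
    by apply: ler_sum_nat => t /andP[it _]; exact: gph.
  rewrite [leRHS](@big_cat_nat _ _ _ (2 ^ i)) //=; last by rewrite leqW // leq_exp2l.
  rewrite -[leLHS]add0r; apply: lerD; first by apply: sumr_ge0 => h _; rewrite mulr_ge0.
  by apply: ler_sum_nat_widen => // h; rewrite mulr_ge0.
have Hsl : (2 * H * s < 2 ^ l)%N.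
  by apply: leq_ltn_trans Msl; rewrite leq_mul // leq_mul.
have HD n : (0 < n)%N -> (n <= 2 * H * U)%N -> (ndiv n)%:R <= D.
  by move=> n0 nH; apply: dD => //; apply: leq_trans nH _; rewrite leq_mul // leq_mul.
have ps := prime_sum u v0 q0 aq kappa0 approx k1_ge Nl ql H0 U3 sN Ns Hsl HD D0.
apply: (le_trans (ler_wpM2l gam0 ps)).
rewrite /Z -/b1 -/b2 [gam * (_ + _)]mulrDr [gam * (_ + _)]mulrDr.
have l0 : 0 <= l%:R :> R by [].
have NR : 0 <= N%:R :> R by [].
have UR : 0 <= U%:R :> R by [].
have sR : 0 <= s%:R :> R by [].
rewrite !natrM; set K0 := (N %/ U.+1)%:R.
have K00 : 0 <= K0 by rewrite /K0.
apply: lerD; first apply: lerD.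
- rewrite !mulrA; apply: ler_wpM2r => //; apply: ler_wpM2r => //.
- rewrite mulrCA; apply: ler_wpM2l => //.
  have e1 : gam * (2 * (H%:R * N%:R) / q%:R) <= 4 * N%:R / q%:R.
    rewrite !mulrA; apply: ler_wpM2r; first by rewrite invr_ge0.
    by apply: ler_wpM2r => //; lra.
  have e2 : gam * ((2 * (H%:R * U%:R) + q%:R) * l%:R) <= (4 * U%:R + delta * q%:R) * l%:R.
    rewrite mulrA; apply: ler_wpM2r => //; rewrite mulrDr; apply: lerD; last first.
      by apply: ler_wpM2r => //; exact: ltW.
    by rewrite !mulrA; apply: ler_wpM2r => //; lra.
  by rewrite [gam * (_ + _)]mulrDr; exact: lerD.
rewrite mulrCA; apply: ler_wpM2l => //.
rewrite -[X in X * Num.sqrt _]ger0_norm // -sqrtr_sqr -sqrtrM ?sqr_ge0 // ler_wsqrtr //.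
have -> : gam ^+ 2 * (H%:R * N%:R * (H%:R * N%:R / q%:R + H%:R * s%:R + K0 + q%:R)) =
  (gam * H%:R) ^+ 2 * (N%:R ^+ 2 / q%:R) + (gam * H%:R) ^+ 2 * (N%:R * s%:R) +
   gam * (gam * H%:R) * (N%:R * (K0 + q%:R)).
  by field; rewrite gt_eqF.
have gH2 : (gam * H%:R) ^+ 2 <= 4.
  rewrite (_ : 4 = 2 ^+ 2); last by ring.
  by rewrite lerXn2r ?nnegrE // mulr_ge0.
have gg : gam * (gam * H%:R) <= 2 * delta.
  by rewrite [leRHS]mulrC; apply: ler_pM => //; rewrite mulr_ge0.
have p1 : 0 <= N%:R ^+ 2 / q%:R :> R by rewrite divr_ge0 // exprn_ge0.
have p2 : 0 <= N%:R * s%:R :> R by rewrite mulr_ge0.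
have p3 : 0 <= N%:R * (K0 + q%:R) :> R by rewrite mulr_ge0 // addr_ge0.
rewrite -[4 * _ ^+ 2 / _]mulrA -[4 * _ * s%:R]mulrA -[2 * delta * _ * _]mulrA.
by apply: lerD; [apply: lerD|]; apply: ler_wpM2r.
Qed.

Lemma dist_int_lt (x Delta : R) :
  dist_int x < Delta <-> exists m : int, `|x - m%:~R| < Delta.
Proof.
have hi : has_inf [set `|x - m%:~R| | m in [set: int]]%classic.
  split; first by exists `|x - 0%:~R|; exists 0.
  by exists 0 => _ [m _ <-].
split=> [/(inf_lt hi.1)[_ [m _ <-] h]|[m h]]; first by exists m.
by apply: le_lt_trans h; apply: ge_inf; [exact: hi.2|exists m].
Qed.

Lemma window_mem (M w : nat) (z : int) : (0 < M)%N -> (2 * w < M)%N ->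
  (`|((z + w%:Z) %% M%:Z)%Z| < (2 * w).+1)%N <->
  exists j : int, `|z - j * M%:Z| <= w%:Z.
Proof.
move=> M0 wM; have Mn0 : (M%:Z != 0)%R by rewrite eqz_nat -lt0n.
split.
  move=> h; exists ((z + w%:Z) %/ M%:Z)%Z.
  have r0 := modz_ge0 (z + w%:Z) Mn0.
  have e := divz_eq (z + w%:Z) M%:Z.
  by clear - r0 e h; lia.
move=> [j h].
have -> : z + w%:Z = j * M%:Z + (z - j * M%:Z + w%:Z) by ring.
rewrite modzMDl.
have [k ek] : exists k : nat, z - j * M%:Z + w%:Z = k%:Z.
  exists (absz (z - j * M%:Z + w%:Z)); clear - h; lia.
rewrite ek modz_nat absz_nat modn_small; last by clear - h ek wM; lia.
by clear - h ek; lia.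
Qed.

(** Rounding [alpha] and [beta] to multiples of [1 / M] moves the points
    [alpha n - beta] by at most [N / M]. *)
Lemma rounding_error (alpha beta : R) (M N n : nat) (z j : int) :
  z = Num.floor (alpha * M%:R) * n%:Z - Num.floor (beta * M%:R) ->
  (n <= N)%N -> (0 < N)%N ->
  `|(alpha * n%:R - beta - j%:~R) * M%:R - (z - j * M%:Z)%:~R| <= N%:R.
Proof.
move=> z_def nN N0; have N1 : 1 <= N%:R :> R by rewrite ler1n.
pose e1 := alpha * M%:R - (Num.floor (alpha * M%:R))%:~R.
pose e2 := beta * M%:R - (Num.floor (beta * M%:R))%:~R.
have fl (x : R) : 0 <= x - (Num.floor x)%:~R <= 1.
  rewrite subr_ge0 ge_floor /=; have := ltW (floorD1_gt x); rewrite intrD; lra.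
have /andP[e10 e11] : 0 <= e1 <= 1 by exact: fl.
have /andP[e20 e21] : 0 <= e2 <= 1 by exact: fl.
have -> : (alpha * n%:R - beta - j%:~R) * M%:R - (z - j * M%:Z)%:~R = n%:R * e1 - e2.
  rewrite z_def !intrB !intrM /e1 /e2 -[n%:Z%:~R]/(n%:R : R) -[M%:Z%:~R]/(M%:R : R).
  by ring.
have p1 : 0 <= n%:R * e1 by rewrite mulr_ge0.
have p2 : n%:R * e1 <= N%:R.
  by rewrite -[leRHS]mulr1; apply: ler_pM => //; rewrite ler_nat.
by rewrite ler_norml; lra.
Qed.

Lemma f_Delta_ge_window (alpha beta Delta : R) (M N n w : nat) (z : int) :
  z = Num.floor (alpha * M%:R) * n%:Z - Num.floor (beta * M%:R) ->
  (0 < M)%N -> (n <= N)%N -> (0 < N)%N -> (2 * w < M)%N ->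
  (w + N)%:R < Delta * M%:R ->
  (if (`|((z + w%:Z) %% M%:Z)%Z| < (2 * w).+1)%N then 1 else 0) <=
    f_Delta Delta (alpha * n%:R - beta).
Proof.
move=> z_def M0 nN N0 wM hw; have MR : 0 < M%:R :> R by rewrite ltr0n.
case: ifP => [/(window_mem z M0 wM)[j hj]|_]; last by rewrite /f_Delta; case: ifP.
rewrite /f_Delta; have -> // : dist_int (alpha * n%:R - beta) < Delta.
apply/dist_int_lt; exists j; rewrite -(ltr_pM2r MR) -[X in _ * X < _]ger0_norm //.
rewrite -normrM; apply: le_lt_trans hw; rewrite natrD.
have hj' : `|(z - j * M%:Z)%:~R| <= w%:R :> R.
  by rewrite -intr_norm -[w%:R]/(w%:Z%:~R) ler_int.
have := ler_normD ((alpha * n%:R - beta - j%:~R) * M%:R - (z - j * M%:Z)%:~R) (z - j * M%:Z)%:~R.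
by rewrite subrK; have := rounding_error j z_def nN N0; lra.
Qed.

Lemma f_Delta_le_window (alpha beta Delta : R) (M N n w : nat) (z : int) :
  z = Num.floor (alpha * M%:R) * n%:Z - Num.floor (beta * M%:R) ->
  (0 < M)%N -> (n <= N)%N -> (0 < N)%N -> (2 * w < M)%N ->
  Delta * M%:R + N%:R <= w.+1%:R ->
  f_Delta Delta (alpha * n%:R - beta) <=
    (if (`|((z + w%:Z) %% M%:Z)%Z| < (2 * w).+1)%N then 1 else 0).
Proof.
move=> z_def M0 nN N0 wM hw; have MR : 0 < M%:R :> R by rewrite ltr0n.
rewrite /f_Delta; case: ifP => [/dist_int_lt[j hj]|_]; last by case: ifP.
have -> // : (`|((z + w%:Z) %% M%:Z)%Z| < (2 * w).+1)%N.
apply/(window_mem z M0 wM); exists j.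
rewrite -ltzD1 -(ltr_int R) intr_norm.
have {}hj : `|(alpha * n%:R - beta - j%:~R) * M%:R| < Delta * M%:R.
  by rewrite normrM [X in _ * X]ger0_norm // ltr_pM2r.
have -> : (w%:Z + 1)%:~R = w.+1%:R :> R by rewrite intrD -natr1.
apply: lt_le_trans hw.
have := ler_normB ((alpha * n%:R - beta - j%:~R) * M%:R) ((alpha * n%:R - beta - j%:~R) * M%:R - (z - j * M%:Z)%:~R).
rewrite opprB addrCA subrr addr0; have := rounding_error j z_def nN N0; lra.
Qed.

Lemma f_Delta_ge0_le1 (Delta x : R) : 0 <= f_Delta Delta x <= 1.
Proof. by rewrite /f_Delta; case: ifP => _; rewrite ?lexx ler01. Qed.

(** The arc of radius [Delta] lies between two windows of integer radius whose
    lengths differ from [2 Delta M] by [O(N)]. When the larger one would cover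
    the whole circle the upper bound is trivial. *)
Lemma discrepancy_le (alpha beta Delta V : R) (M N u v : nat) (lam : nat -> R) :
  (0 < M)%N -> (0 < N)%N -> 0 < Delta -> Delta < 1 / 2 ->
  (2 * N + 2)%:R <= Delta * M%:R -> 0 <= V -> (forall n, 0 <= lam n) ->
  (forall w, (2 * w < M)%N -> 2 * (2 * w).+1%:R / M%:R <= 6 * Delta ->
    M%:R^-1 * \sum_(1 <= t < M) (2 * chord_cap (2 * w).+1%:R (t%:R / M%:R)) *
      cabs (\sum_(1 <= n < N.+1) (lam n)%:C%C *
        twist ((Num.floor (alpha * M%:R))%:~R / M%:R) u v t n) <= V) ->
  `|\sum_(1 <= n < N.+1 | n == u %[mod v])
      lam n * (f_Delta Delta (alpha * n%:R - beta) - 2 * Delta)| <=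
  V + (2 * N + 3)%:R / M%:R * \sum_(1 <= n < N.+1 | n == u %[mod v]) lam n.
Proof.
move=> M0 N0 D0 D12 DM V0 lam0 hV.
have MR : 0 < M%:R :> R by rewrite ltr0n.
set psi := \sum_(1 <= n < N.+1 | n == u %[mod v]) lam n.
have psi0 : 0 <= psi by apply: sumr_ge0.
pose S1 := \sum_(1 <= n < N.+1 | n == u %[mod v]) lam n * f_Delta Delta (alpha * n%:R - beta).
have -> : \sum_(1 <= n < N.+1 | n == u %[mod v])
      lam n * (f_Delta Delta (alpha * n%:R - beta) - 2 * Delta) = S1 - 2 * Delta * psi.
  rewrite /S1 /psi big_distrr /= -sumrB; apply: eq_bigr => n _; ring.
have DM0 : 0 <= Delta * M%:R by rewrite mulr_ge0 // ltW.
have /andP[t1 t2] := truncn_itv DM0.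
set t := Num.truncn (Delta * M%:R) in t1 t2.
have tN : (2 * N + 2 <= t)%N by rewrite -ltnS -(ltr_nat R); exact: le_lt_trans t2.
have DM12 : 2 * (Delta * M%:R) < M%:R.
  by rewrite mulrA -[ltRHS]mul1r ltr_pM2r //; lra.
have tM : (2 * t < M)%N by rewrite -(ltr_nat R) natrM; lra.
have tNR : (2 * N + 2)%:R <= t%:R :> R by rewrite ler_nat.
have e2 : (2 * N + 2)%:R = 2 * N%:R + 2 :> R by rewrite natrD natrM.
have e3 : (2 * N + 3)%:R = 2 * N%:R + 3 :> R by rewrite natrD natrM.
rewrite e2 in DM tNR; rewrite e3.
pose z (n : nat) := Num.floor (alpha * M%:R) * n%:Z - Num.floor (beta * M%:R).
pose W w := \sum_(1 <= n < N.+1 | n == u %[mod v])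
  (if (`|((z n + w%:Z) %% M%:Z)%Z| < (2 * w).+1)%N then lam n else 0).
have Ww w : (2 * w < M)%N -> 2 * (2 * w).+1%:R / M%:R <= 6 * Delta ->
    `|W w - (2 * w).+1%:R / M%:R * psi| <= V.
  by move=> wM wD; apply: le_trans (hV w wM wD); exact: window_sum.
have smul (b : bool) (x : R) : (if b then x else 0) = x * (if b then 1 else 0).
  by case: b; rewrite ?mulr1 ?mulr0.
have wR (w : nat) : (2 * w).+1%:R = 2 * w%:R + 1 :> R by rewrite -natr1 natrM.
set E := (2 * N%:R + 3) / M%:R.
rewrite ler_norml; apply/andP; split.
  pose w := (t - N.+1)%N.
  have wt : w%:R = t%:R - N%:R - 1 :> R.
    have Nt : (N.+1 <= t)%N.
      by apply: leq_trans tN; rewrite addn2 ltnS leqW // leq_pmull.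
    by rewrite /w natrB // -natr1; ring.
  have wM : (2 * w < M)%N by apply: leq_ltn_trans tM; rewrite leq_mul // leq_subr.
  have wD : 2 * (2 * w).+1%:R / M%:R <= 6 * Delta.
    by rewrite wR ler_pdivrMr // wt; have := ler0n R N; lra.
  have := Ww w wM wD; rewrite ler_norml => /andP[h1 _].
  have S2 : W w <= S1.
    rewrite /W /S1 big_nat_cond [leRHS]big_nat_cond; apply: ler_sum => n /andP[/andP[_ nN] _].
    rewrite smul ler_wpM2l //; apply: (@f_Delta_ge_window _ _ _ M N) => //.
    by rewrite natrD wt; lra.
  have c : (2 * Delta - E) * psi <= (2 * w).+1%:R / M%:R * psi.
    rewrite ler_wpM2r // /E wR wt lerBlDr -mulrDl ler_pdivlMr //; lra.
  by rewrite mulrBl in c; lra.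
case: (ltnP (2 * (t + N)) M) => wM.
  pose w := (t + N)%N; rewrite -/w in wM.
  have wt : w%:R = t%:R + N%:R :> R by rewrite /w natrD.
  have wD : 2 * (2 * w).+1%:R / M%:R <= 6 * Delta by rewrite wR ler_pdivrMr // wt; lra.
  have := Ww w wM wD; rewrite ler_norml => /andP[_ h1].
  have S2 : S1 <= W w.
    rewrite /W /S1 big_nat_cond [leRHS]big_nat_cond; apply: ler_sum => n /andP[/andP[_ nN] _].
    rewrite [leRHS]smul ler_wpM2l //; apply: (@f_Delta_le_window _ _ _ M N) => //.
    by rewrite -natr1 wt; rewrite -natr1 in t2; lra.
  have c : (2 * w).+1%:R / M%:R * psi <= (2 * Delta + E) * psi.
    rewrite ler_wpM2r // /E wR wt ler_pdivrMr // [(2 * Delta + _) * _]mulrDl divfK ?gt_eqF //; lra.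
  by rewrite mulrDl in c; lra.
have S2 : S1 <= psi.
  apply: ler_sum => n _; rewrite -[leRHS]mulr1 ler_wpM2l //.
  by have /andP[] := f_Delta_ge0_le1 Delta (alpha * n%:R - beta).
have c : psi <= (2 * Delta + E) * psi.
  have Mn0 : M%:R != 0 :> R by rewrite gt_eqF.
  rewrite ler_peMl // /E -[2 * Delta](mulfK Mn0) -mulrDl ler_pdivlMr //.
  by rewrite -(ler_nat R) natrM natrD in wM; lra.
by rewrite mulrDl in c; lra.
Qed.

End Discrepancy.

(** * The terms of the error bound *)

Section Target.
Variable R : realType.

Definition error_bound (epsilon N q Delta : R) : R :=
  N * q `^ (- (1 / 2)) + N `^ (3 / 4) + N `^ (5 / 6) * Delta `^ (1 / 2)
  + (Delta * N * q) `^ (1 / 2) + N `^ epsilon * q * Delta `^ (1 - epsilon).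

Section Terms.
Variables (epsilon N q Delta : R).
Hypothesis e0 : 0 < epsilon.
Hypothesis N1 : 1 <= N.
Hypothesis q1 : 1 <= q.
Hypothesis D0 : 0 < Delta.
Hypothesis D12 : Delta < 1 / 2.

Let T := error_bound epsilon N q Delta.
Let L := ln (N * q / Delta).

Lemma error_bound_terms :
  [/\ 0 <= N * q `^ (- (1 / 2)), 0 <= N `^ (3 / 4),
      0 <= N `^ (5 / 6) * Delta `^ (1 / 2), 0 <= (Delta * N * q) `^ (1 / 2) &
      0 <= N `^ epsilon * q * Delta `^ (1 - epsilon)].
Proof.
have N0 : 0 <= N by exact: le_trans N1.
have q0 : 0 <= q by exact: le_trans q1.
by split; rewrite ?mulr_ge0 ?powR_ge0.
Qed.

Lemma last_term_ge : q * Delta <= N `^ epsilon * q * Delta `^ (1 - epsilon).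
Proof.
have q0 : 0 <= q by exact: le_trans q1.
rewrite -mulrA; apply: (@le_trans _ _ (1 * (q * Delta))); first by rewrite mul1r.
apply: ler_pM => //; first by rewrite mulr_ge0 // ltW.
  by rewrite -(powRr0 N) ler_powR // ltW.
have D01 : 0 < Delta <= 1 by rewrite D0; move: D12; lra.
have e1 : 1 - epsilon <= 1 by move: e0; lra.
by rewrite ler_wpM2l // ger1_powR.
Qed.

Lemma ln_bounds : [/\ ln 2 <= L, ln N <= L & ln q <= L].
Proof.
have N0 : 0 < N by exact: lt_le_trans N1.
have q0 : 0 < q by exact: lt_le_trans q1.
have Nq : 1 <= N * q by rewrite mulr_ege1.
have big : N * q * 2 <= N * q / Delta.
  rewrite ler_wpM2l ?mulr_ge0 ?(ltW N0) ?(ltW q0) //.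
  have h : 2 * Delta <= 1 by move: D12; lra.
  by rewrite -(ler_pM2r D0) mulVf ?gt_eqF.
have p : N * q / Delta \is Num.pos by rewrite posrE divr_gt0 // mulr_gt0.
by split; rewrite /L ler_ln ?posrE //; apply: le_trans big; move: N1 q1 Nq; nra.
Qed.

Lemma error_bound_ge0 : 0 <= T.
Proof. by have [] := error_bound_terms; rewrite /T /error_bound; lra. Qed.

End Terms.

Lemma trunc_log2_le (x L : R) (n : nat) : (0 < n)%N -> n%:R <= x ->
  0 < ln 2 :> R -> ln x <= L -> (trunc_log 2 n).+1%:R <= 1 + (ln 2)^-1 * L :> R.
Proof.
move=> n0 nx l2 lx; rewrite -addn1 natrD addrC lerD2l.
have nR : 0 < n%:R :> R by rewrite ltr0n.
rewrite mulrC ler_pdivlMr //; apply: le_trans lx.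
have := trunc_logP (isT : 1 < 2)%N n0; rewrite -(ler_nat R) natrX => h.
have p2 : 0 < 2 ^+ trunc_log 2 n :> R by rewrite exprn_gt0.
apply: (@le_trans _ _ (ln n%:R)); last by rewrite ler_ln ?posrE // (lt_le_trans nR).
by rewrite mulr_natl -lnXn // ler_ln ?posrE.
Qed.

Lemma nat_root (k N : nat) : (0 < k)%N -> exists s, (s ^ k <= N)%N && (N < s.+1 ^ k)%N.
Proof.
move=> k0; have ex : exists s, (s ^ k <= N)%N by exists 0%N; rewrite exp0n.
have ub s : (s ^ k <= N)%N -> (s <= N)%N.
  apply: leq_trans; case: s => // s; rewrite -[X in (X <= _)%N]expn1.
  by rewrite leq_pexp2l.
exists (ex_maxn ex ub); case: ex_maxnP => s -> h /=.
by rewrite ltnNge; apply/negP => /h; rewrite ltnn.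
Qed.

End Target.

Section Comparison.
Variable R : realType.

Lemma sqrt_squares_le (z A B C E : R) :
  0 <= A -> 0 <= B -> 0 <= C -> 0 <= E ->
  z <= 4 * A ^+ 2 + 4 * B ^+ 2 + (24 * C ^+ 2 + 12 * E ^+ 2) ->
  Num.sqrt z <= 5 * (A + B + C + E).
Proof.
move=> A0 B0 C'0 E0 zle.
have p0 : 0 <= 5 * (A + B + C + E) by rewrite mulr_ge0 // !addr_ge0.
rewrite -[leRHS]ger0_norm // -sqrtr_sqr ler_wsqrtr //; apply: (le_trans zle).
have c1 := mulr_ge0 A0 B0; have c2 := mulr_ge0 A0 C'0; have c3 := mulr_ge0 A0 E0.
have c4 := mulr_ge0 B0 C'0; have c5 := mulr_ge0 B0 E0; have c6 := mulr_ge0 C'0 E0.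
have d1 := sqr_ge0 A; have d2 := sqr_ge0 B; have d3 := sqr_ge0 C; have d4 := sqr_ge0 E.
by lra.
Qed.

Lemma frequency_terms_le (l W W2 w p d U sq A B G T : R) :
  1 <= l -> 0 <= W -> 0 <= W2 -> 0 <= A -> 0 <= B -> 0 <= G -> A + B + G <= T ->
  0 <= U -> w * p <= A -> w * U <= B -> w * d <= G -> U <= B -> sq <= 5 * T ->
  4 * (l ^+ 2 * U) + 16 * W * l ^+ 3 * (w * (4 * p + (4 * U + 6 * d) * l))
    + 96 * W2 * l ^+ 6 * sq <= (4 + 96 * W + 480 * W2) * (l ^+ 6 * T).
Proof.
move=> l1 W0 W20 A0 B0 G0 ABG U0 wp wU wd UB sqT.
have l0 : 0 <= l := le_trans ler01 l1.
have T0 : 0 <= T by lra.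
have lX i : (i <= 6)%N -> l ^+ i <= l ^+ 6 by move=> i6; rewrite ler_weXn2l.
have s1 : 4 * (l ^+ 2 * U) <= 4 * (l ^+ 6 * T).
  rewrite ler_wpM2l //; apply: ler_pM; rewrite ?exprn_ge0 ?lX //.
  by apply: (le_trans UB); lra.
have s2 : w * (4 * p + (4 * U + 6 * d) * l) <= 6 * (l * T).
  have h1 : 0 <= (4 * B + 6 * G - w * (4 * U + 6 * d)) * l by rewrite mulr_ge0 //; lra.
  have h2 : 0 <= (l - 1) * A by rewrite mulr_ge0 // subr_ge0.
  have h3 : 0 <= l * (6 * T - 4 * A - 4 * B - 6 * G) by rewrite mulr_ge0 //; lra.
  by lra.
have s3 : 16 * W * l ^+ 3 * (w * (4 * p + (4 * U + 6 * d) * l)) <= 96 * W * (l ^+ 6 * T).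
  have k0 : 0 <= 16 * W * l ^+ 3 by apply: mulr_ge0; [exact: mulr_ge0|exact: exprn_ge0].
  apply: (le_trans (ler_wpM2l k0 s2)).
  have -> : 16 * W * l ^+ 3 * (6 * (l * T)) = 96 * W * (l ^+ 4 * T) by ring.
  by apply: ler_wpM2l; [exact: mulr_ge0|apply: ler_wpM2r => //; exact: lX].
have s4 : 96 * W2 * l ^+ 6 * sq <= 480 * W2 * (l ^+ 6 * T).
  have k0 : 0 <= 96 * W2 * l ^+ 6 by apply: mulr_ge0; [exact: mulr_ge0|exact: exprn_ge0].
  by apply: (le_trans (ler_wpM2l k0 sqT)); lra.
rewrite [leRHS]mulrDl [X in _ <= X + _]mulrDl; apply: lerD => //; exact: lerD.
Qed.

End Comparison.

(** * The three ranges of the parameters *)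

Section Cases.
Variable R : realType.

Lemma weighted_sum_le (N u v : nat) (g : nat -> R) (y : R) : ln N%:R <= y -> 0 <= y ->
  (forall n, 0 <= g n) ->
  \sum_(1 <= n < N.+1 | n == u %[mod v]) von_mangoldt R n * g n <=
  y * \sum_(1 <= n < N.+1) g n.
Proof.
move=> lny y0 g0; rewrite big_distrr /= big_mkcond /=.
apply: ler_sum_nat => n /andP[n0 nN]; case: ifP => _; last by rewrite mulr_ge0.
rewrite ler_wpM2r //; apply: le_trans lny; apply: (le_trans (von_mangoldt_le R n0)).
by rewrite ler_ln ?posrE ?ltr0n ?ler_nat // (leq_trans n0).
Qed.

Lemma von_mangoldt_sum_le (N u v : nat) (y : R) : ln N%:R <= y -> 0 <= y ->
  \sum_(1 <= n < N.+1 | n == u %[mod v]) von_mangoldt R n <= N%:R * y.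
Proof.
move=> lny y0; have := @weighted_sum_le N u v (fun=> 1) y lny y0 (fun=> ler01).
rewrite big_const_nat iter_addr addr0 subn1 /= mulrC.
by under eq_bigr do rewrite mulr1.
Qed.

Variables (epsilon alpha beta Delta y : R) (u v N q k1 : nat) (a : int).
Hypothesis e0 : 0 < epsilon.
Hypothesis v0 : (0 < v)%N.
Hypothesis N0 : (0 < N)%N.
Hypothesis q0 : (0 < q)%N.
Hypothesis D0 : 0 < Delta.
Hypothesis D12 : Delta < 1 / 2.
Hypothesis aq : coprimez a q.
Hypothesis approx : `|alpha * v%:R - a%:~R / q%:R| <= 1 / q%:R ^+ 2.
Hypothesis k1_ge : 2 * pi * (1 + 2) <= k1%:R :> R.
Hypothesis y1 : 1 <= y.
Hypothesis lny : ln N%:R <= y.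

Let S := `|\sum_(1 <= n < N.+1 | n == u %[mod v])
      von_mangoldt R n * (f_Delta Delta (alpha * n%:R - beta) - 2 * Delta)|.
Let T := error_bound epsilon N%:R q%:R Delta.
Let NR : 1 <= N%:R :> R. Proof. by rewrite ler1n. Qed.
Let qR : 1 <= q%:R :> R. Proof. by rewrite ler1n. Qed.
Let y0 : 0 <= y := le_trans ler01 y1.
Let T0 : 0 <= T.
Proof. exact: error_bound_ge0. Qed.
Let lastG := last_term_ge e0 NR qR D0 D12.

(** For large [q] the last term of the bound exceeds the trivial estimate. *)
Lemma large_denominator : N%:R <= q%:R * Delta -> S <= y * T.
Proof.
move=> NqD; apply: (@le_trans _ _ (\sum_(1 <= n < N.+1 | n == u %[mod v]) von_mangoldt R n)).
  apply: (le_trans (ler_norm_sum _ _ _)); apply: ler_sum => n _.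
  rewrite normrM ger0_norm ?von_mangoldt_ge0 // -[leRHS]mulr1 ler_wpM2l ?von_mangoldt_ge0 //.
  have /andP[f0 f1] := f_Delta_ge0_le1 Delta (alpha * n%:R - beta).
  by rewrite ler_norml; move: D0 D12; lra.
apply: (le_trans (von_mangoldt_sum_le _ _ lny y0)); rewrite mulrC ler_wpM2l //.
have [? ? ? ? ?] := error_bound_terms epsilon Delta NR qR.
by apply: (le_trans NqD); apply: (le_trans lastG); rewrite /T /error_bound; lra.
Qed.

(** For short arcs no cancellation is needed: the points [alpha n v] with [n] in
    an interval of length [q] are well spaced, which bounds the number of them
    that fall in an arc. The expected contribution [2 Delta N] is itself at most
    [N ^ (3/4)]. *)
Lemma short_arc : harm R q <= y -> Delta <= N%:R `^ (- (1 / 4)) ->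
  S <= (8 * pi * v%:R * k1%:R + 2) * y ^+ 2 * T.
Proof.
move=> hy DN.
have p0 : 0 < pi :> R := pi_gt0 R.
have N0R : 0 < N%:R :> R by rewrite ltr0n.
have q0R : 0 < q%:R :> R by rewrite ltr0n.
have v0R : 1 <= v%:R :> R by rewrite ler1n.
have [A0 B0 C'0 E0 G0] := error_bound_terms epsilon Delta NR qR.
set A := N%:R * _ in A0; set B := N%:R `^ (3 / 4) in B0.
set G := _ * Delta `^ (1 - epsilon) in G0.
have AT : A + B + B + G <= 2 * T by rewrite /T /error_bound -/A -/B -/G; lra.
have BT : B <= T by rewrite /T /error_bound -/A -/B -/G; lra.
have B1 : 1 <= B by rewrite -(powRr0 N%:R) ler_powR //; lra.
have DNB : Delta * N%:R <= B.
  apply: (@le_trans _ _ (N%:R `^ (- (1 / 4)) * N%:R)); first by rewrite ler_wpM2r.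
  rewrite -{2}(powRr1 (ltW N0R)) -powRD; last by apply/implyP => _; rewrite gt_eqF.
  by rewrite ler_powR //; lra.
have NqA : N%:R / q%:R <= A.
  by rewrite ler_wpM2l // -(powR_inv1 (ltW q0R)) ler_powR //; lra.
pose c := 2 * pi * v%:R * Delta.
have c0 : 0 <= c by rewrite !mulr_ge0 // ltW.
have iD : 0 < Delta^-1 by rewrite invr_gt0.
pose m n := chord_cap Delta^-1 (n%:R * (v%:R * alpha) + - (v%:R * beta)).
have m0 n : 0 <= m n by exact: chord_cap_ge0.
have fm n : f_Delta Delta (alpha * n%:R - beta) <= c * m n.
  rewrite /f_Delta; case: ifP => [/dist_int_lt[j hj]|_]; last by rewrite mulr_ge0.
  have p1 : 1 <= 2 * pi * v%:R :> R.
    by have := pi_ge2 R => p2; rewrite mulr_ege1 //; lra.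
  have chc : chord (n%:R * (v%:R * alpha) + - (v%:R * beta)) <= c.
    have -> : n%:R * (v%:R * alpha) + - (v%:R * beta) =
        v%:R * (alpha * n%:R - beta - j%:~R) + (v%:Z * j)%:~R :> R.
      by rewrite intrM -[v%:Z%:~R]/(v%:R : R); ring.
    rewrite chordD_int; apply: (le_trans (chordMn _ _)).
    apply: (@le_trans _ _ (v%:R * (2 * pi * Delta))); last first.
      by rewrite le_eqVlt; apply/orP; left; apply/eqP; rewrite /c; ring.
    rewrite ler_wpM2l //; apply: (le_trans (chord_le _)).
    by rewrite ler_wpM2l ?mulr_ge0 ?(ltW p0) // ltW.
  have mx : 0 < Num.max (chord (n%:R * (v%:R * alpha) + - (v%:R * beta))) Delta^-1^-1.
    by rewrite lt_max invrK D0 orbT.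
  rewrite /m /chord_cap ler_pdivlMr // mul1r ge_max chc invrK /=.
  by rewrite /c ler_peMl // ltW.
have cnt : \sum_(1 <= n < N.+1) f_Delta Delta (alpha * n%:R - beta) <=
    8 * pi * v%:R * k1%:R * y * T.
  apply: (@le_trans _ _ (c * \sum_(0 <= n < (N %/ q).+1 * q) m n)).
    rewrite big_distrr /=; apply: (@le_trans _ _ (\sum_(1 <= n < (N %/ q).+1 * q) c * m n)).
      apply: (@le_trans _ _ (\sum_(1 <= n < N.+1) c * m n)); first by apply: ler_sum => n _.
      by apply: ler_sum_nat_widen; [move=> n; rewrite mulr_ge0|rewrite ltn_ceil].
    rewrite [leRHS]big_ltn; last by rewrite muln_gt0.
    by rewrite lerDr mulr_ge0.
  have approx1 : `|v%:R * alpha - a%:~R / q%:R| <= 1 / q%:R ^+ 2 by rewrite mulrC.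
  have k1_ge1 : 2 * pi * (1 + 1) <= k1%:R :> R.
    by apply: le_trans k1_ge; rewrite ler_wpM2l ?mulr_ge0 ?(ltW p0) //; lra.
  have bs := blocks_sum q0 aq ler01 approx1 k1_ge1 (- (v%:R * beta)) (N %/ q).+1 iD.
  apply: (le_trans (ler_wpM2l c0 bs)).
  have bq : (N %/ q).+1%:R <= N%:R / q%:R + 1 :> R.
    by rewrite -natr1 lerD2r ler_pdivlMr // -natrM ler_nat leq_divM.
  have k1R : 1 <= k1%:R :> R.
    by apply: le_trans k1_ge; have := pi_ge2 R; lra.
  have qD0 : 0 <= q%:R * Delta by rewrite mulr_ge0 // ltW.
  have r1 : 2 * k1%:R * Delta^-1 + 2 * q%:R * harm R q <=
      2 * k1%:R * y * (Delta^-1 * (1 + q%:R * Delta)).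
    rewrite mulrDr mulr1 mulrCA mulVf ?gt_eqF // mulr1 mulrDr; apply: lerD.
      rewrite -[2 * k1%:R * y * _]mulrAC ler_peMr // !mulr_ge0 // ltW //.
    rewrite -!mulrA ler_wpM2l // [k1%:R * _]mulrA [leRHS]mulrC ler_wpM2l ?(ltW q0R) //.
    by apply: (le_trans hy); rewrite ler_peMl.
  have b0 : 0 <= (N %/ q).+1%:R :> R by [].
  apply: (@le_trans _ _ (c * ((N%:R / q%:R + 1) * (2 * k1%:R * y * (Delta^-1 * (1 + q%:R * Delta)))))).
    rewrite ler_wpM2l //; apply: ler_pM => //.
    by rewrite addr_ge0 // !mulr_ge0 ?harm_ge0 // ltW.
  have -> : c * ((N%:R / q%:R + 1) * (2 * k1%:R * y * (Delta^-1 * (1 + q%:R * Delta)))) =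
     4 * pi * v%:R * k1%:R * y * (N%:R / q%:R + Delta * N%:R + 1 + q%:R * Delta).
    by rewrite /c; field; rewrite !gt_eqF.
  have -> : 8 * pi * v%:R * k1%:R * y * T = 4 * pi * v%:R * k1%:R * y * (2 * T) by ring.
  rewrite ler_wpM2l //; first by rewrite !mulr_ge0 // ltW.
  by move: lastG; rewrite -/G; lra.
have f0 n : 0 <= f_Delta Delta (alpha * n%:R - beta).
  by have /andP[] := f_Delta_ge0_le1 Delta (alpha * n%:R - beta).
have part1 := weighted_sum_le u v lny y0 f0.
have part2 := von_mangoldt_sum_le u v lny y0.
set psi := \sum_(_ <= n < _ | _) von_mangoldt R n in part2.
have psi0 : 0 <= psi by apply: sumr_ge0 => n _; exact: von_mangoldt_ge0.
have -> : S = `|\sum_(1 <= n < N.+1 | n == u %[mod v])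
    von_mangoldt R n * f_Delta Delta (alpha * n%:R - beta) - 2 * Delta * psi|.
  rewrite /S /psi big_distrr /= -sumrB; congr `|_|; apply: eq_bigr => n _; ring.
apply: (le_trans (ler_normB _ _)).
rewrite !ger0_norm; last 2 first.
- by rewrite !mulr_ge0 // ltW.
- by apply: sumr_ge0 => n _; rewrite mulr_ge0 // von_mangoldt_ge0.
have t1 : y * \sum_(1 <= n < N.+1) f_Delta Delta (alpha * n%:R - beta) <=
    8 * pi * v%:R * k1%:R * y ^+ 2 * T.
  apply: (le_trans (ler_wpM2l y0 cnt)).
  by rewrite le_eqVlt; apply/orP; left; apply/eqP; ring.
have t2 : 2 * Delta * psi <= 2 * (y ^+ 2 * T).
  rewrite -mulrA ler_wpM2l //; apply: (le_trans (ler_wpM2l (ltW D0) part2)).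
  rewrite mulrA [leRHS]mulrC; apply: ler_pM => //; last by rewrite ler_eXnr.
  - by rewrite mulr_ge0 // ltW.
  exact: le_trans BT.
by lra.
Qed.

(** The main case, where [q] and [1 / Delta] are at most powers of [N]: the
    circle is replaced by the residues modulo [M], with [M] of size [N ^ 3].
    All fractional powers of [N] that occur are powers of its twelfth root. *)
Lemma long_arc (Cd e1 : R) :
  0 < Cd -> e1 = Num.min epsilon (1 / 16) / 4 ->
  (forall n, (0 < n)%N -> (ndiv n)%:R <= Cd * n%:R `^ e1) ->
  N%:R `^ (1 / 4) < q%:R :> R -> N%:R `^ (- (1 / 4)) < Delta -> q%:R * Delta < N%:R ->
  (trunc_log 2 (32 * v * N ^ 4)).+1%:R <= y ->
  S <= (5 + 96 * (v%:R * sieve_const R k1 * (Cd * (32 * v)%:R `^ e1)) + 480 * (v%:R ^+ 2 * sieve_const R k1)) *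
       y ^+ 6 * T.
Proof.
move=> Cd0 e1E dB Nq ND qDN ly.
have D01 : 0 < Delta <= 1 by rewrite D0; move: D12; lra.
have rnd (z f : R) : f <= z -> z <= f + 1 -> `|z - f| <= 1.
  by move=> *; rewrite ler_norml; lra.
have big16 (z : R) : 0 <= z -> z <= 16 * z by lra.
have min12 (z : R) : Num.min z (1 / 16) <= 1 / 12.
  by rewrite ge_min; apply/orP; right; lra.
have eps1 : 1 - epsilon <= 1 by move: e0; lra.
have lin1 (n z : R) : 1 <= n -> n <= z -> 2 * n + 2 <= 16 * z by lra.
have lin2 (n n2 z : R) : 0 <= n2 -> n <= n2 -> n2 <= z -> 2 * n2 + 3 * n <= 16 * z by lra.
have last_sum (x c d t b z : R) : x <= (4 + c + d) * z -> t <= b -> b <= z ->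
  x + t <= (5 + c + d) * z by lra.
have five (a1 a2 a3 a4 a5 z : R) : z = a1 + a2 + a3 + a4 + a5 ->
    0 <= a1 -> 0 <= a2 -> 0 <= a3 -> 0 <= a4 -> 0 <= a5 ->
  [/\ a1 + a2 + a5 <= z, a2 <= z & a1 + a2 + a3 + a4 <= z].
  by move=> -> *; split; lra.
have N0R : 0 < N%:R :> R by rewrite ltr0n.
have q0R : 0 < q%:R :> R by rewrite ltr0n.
have v1 : 1 <= v%:R :> R by rewrite ler1n.
have e10 : 0 < e1 by rewrite e1E divr_gt0 // lt_min e0 /=; lra.
pose r := N%:R `^ (1 / 12) : R.
have r1 : 1 <= r by rewrite -(powRr0 N%:R) ler_powR //; lra.
have r0 : 0 < r := lt_le_trans ltr01 r1.
have rX (k : nat) (e : R) : e = k%:R / 12 -> N%:R `^ e = r ^+ k.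
  by move=> ->; rewrite /r -powR_mulrn ?powR_ge0 // -powRrM; congr (_ `^ _); ring.
have rN : N%:R = r ^+ 12 :> R by rewrite -(rX 12%N 1) ?powRr1 ?(ltW N0R) //; field.
have r14 : N%:R `^ (1 / 4) = r ^+ 3 by apply: rX; field.
have r34 : N%:R `^ (3 / 4) = r ^+ 9 by apply: rX; field.
have r56 : N%:R `^ (5 / 6) = r ^+ 10 by apply: rX; field.
rewrite powRN r14 in ND; rewrite r14 in Nq.
pose dh := Delta `^ (1 / 2); pose qh := q%:R `^ (1 / 2) : R.
have half (z : R) : 0 <= z -> (z `^ (1 / 2)) ^+ 2 = z.
  move=> z0; rewrite -powR_mulrn ?powR_ge0 // -powRrM (_ : 1 / 2 * 2%:R = 1) ?powRr1 //.
  by field.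
have dh2 : dh ^+ 2 = Delta by apply: half; exact: ltW.
have qh2 : qh ^+ 2 = q%:R by apply: half; exact: ltW.
have dh0 : 0 < dh by exact: powR_gt0.
have qh0 : 0 < qh by exact: powR_gt0.
have TE : T = r ^+ 12 / qh + r ^+ 9 + r ^+ 10 * dh + dh * r ^+ 6 * qh +
    N%:R `^ epsilon * q%:R * Delta `^ (1 - epsilon).
  rewrite /T /error_bound powRN -/qh r34 r56 -/dh !powRM ?mulr_ge0 ?(ltW D0) ?(ltW N0R) ?(ltW q0R) //.
  by rewrite -/dh -/qh (rX 6%N) ?rN //; field.
set G := _ * Delta `^ (1 - epsilon) in TE.
have [_ _ _ _ G0] := error_bound_terms epsilon Delta NR qR; rewrite -/G in G0.
have A0 : 0 <= r ^+ 12 / qh by rewrite divr_ge0 ?exprn_ge0 // ltW.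
have B1 : 1 <= r ^+ 9 by rewrite exprn_ege1.
have C'0 : 0 <= r ^+ 10 * dh by rewrite mulr_ge0 ?exprn_ge0 // ltW.
have E0 : 0 <= dh * r ^+ 6 * qh by rewrite !mulr_ge0 ?exprn_ge0 // ltW.
set A := r ^+ 12 / qh in TE A0 *; set B := r ^+ 9 in TE B1 *.
set C' := r ^+ 10 * dh in TE C'0 *; set E := dh * r ^+ 6 * qh in TE E0 *.
(* Both [Delta > N ^ (-1/4)] and [q Delta < N] are used: they give [q < N ^ (5/4)]. *)
have q2 : q%:R ^+ 2 <= N%:R ^+ 3 :> R.
  have qlt : q%:R <= r ^+ 15.
    rewrite -(ler_pM2r (_ : 0 < (r ^+ 3)^-1)); last by rewrite invr_gt0 exprn_gt0.
    have -> : r ^+ 15 / r ^+ 3 = N%:R by rewrite rN; field; rewrite gt_eqF.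
    by apply: le_trans (ltW qDN); rewrite ler_wpM2l ?(ltW q0R) // ltW.
  apply: (@le_trans _ _ ((r ^+ 15) ^+ 2)).
    by rewrite lerXn2r ?nnegrE ?exprn_ge0 // ltW.
  by rewrite rN -!exprM ler_weXn2l.
have DN1 : 1 <= Delta * N%:R.
  apply: (@le_trans _ _ (r ^- 3 * N%:R)); last by rewrite ler_wpM2r // ltW.
  have -> : r ^- 3 * N%:R = r ^+ 9 by rewrite rN; field; rewrite gt_eqF.
  exact: B1.
(* [U + 1] is the integer cube root [t] of [N]. The modulus [M] exceeds [q ^ 2], so
   that rounding [alpha] to a multiple of [1 / M] at most doubles the error of
   the approximation; all quantities stay below [Z0 = 2 M N]. *)
have [t /andP[t3 Nt]] := nat_root N (isT : 0 < 3)%N.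
have [s /andP[s2 Ns]] := nat_root N (isT : 0 < 2)%N.
have t0 : (0 < t)%N by case: t t3 Nt => // _; rewrite exp1n ltnS leqn0 -(negbK (N == 0)%N) -lt0n N0.
pose U := t.-1; have tU : U.+1 = t by rewrite prednK.
have UR : U%:R <= r ^+ 4 :> R.
  rewrite -(@ler_pXn2r _ 3) ?nnegrE ?exprn_ge0 ?(ltW r0) // -exprM -rN -natrX ler_nat.
  by apply: leq_trans t3; rewrite leq_exp2r // /U leq_pred.
have tR : r ^+ 4 <= 2 * t%:R.
  apply: (@le_trans _ _ t.+1%:R); last by rewrite -natrM ler_nat mul2n -addnn -addn1 leq_add2l.
  rewrite -(@ler_pXn2r _ 3) ?nnegrE ?exprn_ge0 ?(ltW r0) // -exprM -rN -natrX ler_nat.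
  exact: ltnW.
have K0R : (N %/ t)%:R <= 2 * r ^+ 8 :> R.
  have tp : 0 < t%:R :> R by rewrite ltr0n.
  apply: (@le_trans _ _ (N%:R / t%:R)); first by rewrite ler_pdivlMr // -natrM ler_nat leq_divM.
  rewrite ler_pdivrMr // rN (_ : r ^+ 12 = r ^+ 8 * r ^+ 4); last by ring.
  rewrite (_ : 2 * r ^+ 8 * t%:R = r ^+ 8 * (2 * t%:R)); last by ring.
  by rewrite ler_wpM2l // exprn_ge0 // ltW.
have sR : s%:R <= r ^+ 6 :> R.
  rewrite -(@ler_pXn2r _ 2) ?nnegrE ?exprn_ge0 ?(ltW r0) // -exprM -rN -natrX ler_nat //.
have sN : (s <= N)%N.
  by apply: leq_trans s2; case: (s) => // s'; rewrite -[X in (X <= _)%N]expn1 leq_pexp2l.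
have UN : (U <= N)%N.
  apply: (leq_trans (leq_pred t)); apply: leq_trans t3.
  by rewrite -[X in (X <= _)%N]expn1 leq_pexp2l.
pose M := (16 * v * N ^ 3)%N; pose Z0 := (32 * v * N ^ 4)%N.
have M0 : (0 < M)%N by rewrite muln_gt0 muln_gt0 v0 expn_gt0 N0.
have ME : M%:R = 16 * v%:R * N%:R ^+ 3 :> R by rewrite /M natrM natrX natrM.
have MN : (2 * M * N = Z0)%N by rewrite /M /Z0; ring.
have ZE : Z0%:R = (32 * v)%:R * N%:R ^+ 4 :> R by rewrite /Z0 natrM natrX.
pose l := (trunc_log 2 Z0).+1.
have Zl : (Z0 < 2 ^ l)%N by exact: trunc_log_ltn.
have MZ : (M <= Z0)%N by rewrite -MN -[X in (X <= _)%N]muln1 leq_mul // leq_pmull.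
have N4Z : (N ^ 3 <= Z0)%N.
  by apply: leq_trans MZ; rewrite leq_pmull // muln_gt0.
have Nl : (N < 2 ^ l)%N.
  apply: leq_ltn_trans Zl; apply: leq_trans N4Z.
  by rewrite -[X in (X <= _)%N]expn1 leq_pexp2l.
have ql : (q < 2 ^ l)%N.
  apply: leq_ltn_trans Zl; apply: leq_trans N4Z.
  apply: (@leq_trans (q ^ 2)); first by rewrite -[X in (X <= _)%N]expn1 leq_pexp2l.
  by rewrite -(ler_nat R) !natrX.
have Ml : (M < 2 ^ l)%N by exact: leq_ltn_trans Zl.
have Msl : (2 * M * s < 2 ^ l)%N by apply: leq_ltn_trans Zl; rewrite -MN leq_mul.
have lR : 1 <= l%:R :> R by rewrite ler1n.
pose w := N%:R `^ (4 * e1) : R.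
have w0 : 0 <= w by exact: powR_ge0.
have e14 : 4 * e1 = Num.min epsilon (1 / 16) by rewrite e1E; field.
have we : w <= N%:R `^ epsilon.
  by rewrite ler_powR // e14 ge_min lexx.
have wr : w <= r.
  by rewrite ler_powR // e14 min12.
pose cD := Cd * (32 * v)%:R `^ e1.
have cD0 : 0 <= cD by rewrite mulr_ge0 ?(ltW Cd0) // powR_ge0.
have dD n : (0 < n)%N -> (n <= 2 * M * U)%N -> (ndiv n)%:R <= cD * w.
  move=> n0 nM; apply: (le_trans (dB n n0)).
  have -> : cD * w = Cd * Z0%:R `^ e1.
    by rewrite ZE powRM ?exprn_ge0 // -powR_mulrn // -powRrM mulrA.
  rewrite ler_wpM2l ?(ltW Cd0) //; apply: ge0_ler_powR; rewrite ?nnegrE ?(ltW e10) //.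
  by rewrite ler_nat (leq_trans nM) // -MN leq_mul.
have W1 := sieve_const_ge1 R k1; have W0 : 0 <= sieve_const R k1 := le_trans ler01 W1.
set F := Num.floor (alpha * M%:R).
have approx2 : `|v%:R * (F%:~R / M%:R) - a%:~R / q%:R| <= 2 / q%:R ^+ 2 :> R.
  have MR : 0 < M%:R :> R by rewrite ltr0n.
  have f1 : `|F%:~R / M%:R - alpha| <= M%:R^-1.
    have f2 : F%:~R <= alpha * M%:R by exact: ge_floor.
    have f3 := ltW (floorD1_gt (alpha * M%:R)); rewrite -/F intrD in f3.
    rewrite (_ : _ - _ = - ((alpha * M%:R - F%:~R) / M%:R)); last by field; rewrite gt_eqF.
    have iM : 0 <= M%:R^-1 :> R by rewrite invr_ge0 ltW.
    rewrite normrN normrM (ger0_norm iM) -[leRHS]mul1r; apply: ler_wpM2r => //.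
    exact: rnd f2 f3.
  have -> : v%:R * (F%:~R / M%:R) - a%:~R / q%:R =
      v%:R * (F%:~R / M%:R - alpha) + (alpha * v%:R - a%:~R / q%:R) :> R by ring.
  apply: (le_trans (ler_normD _ _)); rewrite (_ : 2 / q%:R ^+ 2 = 1 / q%:R ^+ 2 + 1 / q%:R ^+ 2); last by field; rewrite gt_eqF.
  apply: lerD => //; rewrite normrM normr_nat.
  apply: (le_trans (ler_wpM2l (ler0n _ _) f1)).
  rewrite ler_pdivrMr // mulrAC mul1r ler_pdivlMr ?exprn_gt0 // ME.
  apply: (le_trans (ler_wpM2l (ler0n _ _) q2)).
  rewrite -[16 * _ * _]mulrA; apply: big16.
  by rewrite mulr_ge0 // exprn_ge0.
pose V := 2 * (l%:R * (2 * U%:R * l%:R +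
    8 * v%:R * sieve_const R k1 * l%:R ^+ 2 * (cD * w) *
      (4 * N%:R / q%:R + (4 * U%:R + 6 * Delta * q%:R) * l%:R) +
    48 * v%:R ^+ 2 * sieve_const R k1 * l%:R ^+ 5 *
      Num.sqrt (4 * N%:R ^+ 2 / q%:R + 4 * N%:R * s%:R +
         2 * (6 * Delta) * N%:R * ((N %/ U.+1)%:R + q%:R)))).
have dq0 : 0 <= 6 * Delta * q%:R by rewrite !mulr_ge0 // ltW.
have V0 : 0 <= V.
  rewrite /V mulr_ge0 // mulr_ge0 //; apply: addr_ge0; last first.
    by rewrite mulr_ge0 ?sqrtr_ge0 // !(W0, mulr_ge0, exprn_ge0).
  apply: addr_ge0; first by rewrite !mulr_ge0.
  apply: mulr_ge0; first by rewrite !(W0, cD0, w0, mulr_ge0, exprn_ge0).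
  apply: addr_ge0; first by rewrite divr_ge0 // mulr_ge0.
  by rewrite mulr_ge0 // addr_ge0 // mulr_ge0.
have DM : (2 * N + 2)%:R <= Delta * M%:R.
  rewrite ME natrD natrM (_ : Delta * _ = 16 * (v%:R * (N%:R ^+ 2 * (Delta * N%:R)))); last by ring.
  have h1 : N%:R ^+ 2 <= N%:R ^+ 2 * (Delta * N%:R) by rewrite ler_peMr // exprn_ge0.
  have h2 : N%:R ^+ 2 <= v%:R * (N%:R ^+ 2 * (Delta * N%:R)).
    by apply: (le_trans h1); rewrite ler_peMl // (le_trans _ h1) // exprn_ge0.
  have h3 : N%:R <= N%:R ^+ 2 :> R by rewrite ler_eXnr.
  by apply: lin1 => //; exact: le_trans h2.
have Sle := @discrepancy_le R alpha beta Delta V M N u v (von_mangoldt R) M0 N0 D0 D12 DM V0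
   (von_mangoldt_ge0 R).
apply: (le_trans (Sle _)).
  move=> x xM xD; rewrite -/F.
  apply: (frequency_sum u v0 q0 aq _ approx2 k1_ge Nl ql Ml Msl M0 _ xD _ sN Ns dD) => //.
    by rewrite tU.
  by rewrite mulr_ge0.
have psiB := von_mangoldt_sum_le u v lny y0.
set psi := \sum_(_ <= n < _ | _) von_mangoldt R n in psiB *.
have tail : (2 * N + 3)%:R / M%:R * psi <= y.
  apply: (@le_trans _ _ ((2 * N + 3)%:R / M%:R * (N%:R * y))).
    by rewrite ler_wpM2l // divr_ge0.
  rewrite mulrA ler_piMl // -mulrAC ler_pdivrMr ?ltr0n // mul1r ME natrD natrM.
  have h3 : N%:R <= N%:R ^+ 2 :> R by rewrite ler_eXnr.
  have h4 : N%:R ^+ 2 <= N%:R ^+ 3 :> R by rewrite ler_weXn2l.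
  have h5 : N%:R ^+ 3 <= v%:R * N%:R ^+ 3 :> R by rewrite ler_peMl // exprn_ge0.
  rewrite -[16 * _ * _]mulrA mulrDl -mulrA -expr2.
  by apply: lin2 => //; [rewrite exprn_ge0|exact: le_trans h5].
(* The divisor bound [w] is absorbed because [q > N ^ (1/4)] leaves a factor
   [q ^ (1/2)] to spare in [N / q]. *)
have wqh : w <= qh.
  apply: (le_trans wr); rewrite -(@ler_pXn2r _ 2) ?nnegrE ?(ltW r0) ?(ltW qh0) // qh2.
  by apply: le_trans (ltW Nq); rewrite ler_weXn2l.
have wA : w * (N%:R / q%:R) <= A.
  rewrite -qh2 rN /A (_ : r ^+ 12 / qh = qh * (r ^+ 12 / qh ^+ 2)); last by field; rewrite gt_eqF.
  by rewrite ler_wpM2r // divr_ge0 ?exprn_ge0 // ltW.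
have wU : w * U%:R <= B.
  apply: (@le_trans _ _ (r * r ^+ 4)); first by apply: ler_pM.
  by rewrite -exprS ler_weXn2l.
have wG : w * (Delta * q%:R) <= G.
  rewrite /G -mulrA; apply: ler_pM => //; first by rewrite mulr_ge0 // ltW.
  by rewrite mulrC ler_wpM2l ?(ltW q0R) // ger1_powR.
have UB : U%:R <= B by apply: (le_trans UR); rewrite ler_weXn2l.
have SQ : Num.sqrt (4 * N%:R ^+ 2 / q%:R + 4 * N%:R * s%:R +
         2 * (6 * Delta) * N%:R * ((N %/ U.+1)%:R + q%:R)) <= 5 * (A + B + C' + E).
  apply: (sqrt_squares_le A0 (le_trans ler01 B1) C'0 E0).
  have -> : 4 * N%:R ^+ 2 / q%:R = 4 * A ^+ 2.
    by rewrite /A rN -qh2; field; rewrite gt_eqF.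
  rewrite mulrDr; apply: lerD; [rewrite lerD2l|apply: lerD].
  - rewrite -mulrA ler_wpM2l // /B rN (_ : (r ^+ 9) ^+ 2 = r ^+ 12 * r ^+ 6); last by ring.
    by rewrite ler_wpM2l // exprn_ge0 // ltW.
  - rewrite tU (_ : 24 * C' ^+ 2 = 2 * (6 * Delta) * N%:R * (2 * r ^+ 8)); last first.
      by rewrite /C' -dh2 rN; ring.
    by rewrite ler_wpM2l // !mulr_ge0 // ltW.
  by rewrite le_eqVlt /E -dh2 -qh2 rN; apply/orP; left; apply/eqP; ring.
pose W := v%:R * sieve_const R k1 * cD; pose W2 := v%:R ^+ 2 * sieve_const R k1.
have WW0 : 0 <= W by rewrite !(W0, cD0, mulr_ge0).
have W20 : 0 <= W2 by rewrite !(W0, mulr_ge0, exprn_ge0).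
have B0 : 0 <= B := le_trans ler01 B1.
have [ABG TB ABCE] := five _ _ _ _ _ _ TE A0 B0 C'0 E0 G0.
have SQT : Num.sqrt (4 * N%:R ^+ 2 / q%:R + 4 * N%:R * s%:R +
         2 * (6 * Delta) * N%:R * ((N %/ U.+1)%:R + q%:R)) <= 5 * T.
  by apply: (le_trans SQ); rewrite ler_wpM2l.
have V1 : V <= (4 + 96 * W + 480 * W2) * (l%:R ^+ 6 * T).
  have -> : V = 4 * (l%:R ^+ 2 * U%:R) +
     16 * W * l%:R ^+ 3 * (w * (4 * (N%:R / q%:R) + (4 * U%:R + 6 * (Delta * q%:R)) * l%:R)) +
     96 * W2 * l%:R ^+ 6 * Num.sqrt (4 * N%:R ^+ 2 / q%:R + 4 * N%:R * s%:R +
         2 * (6 * Delta) * N%:R * ((N %/ U.+1)%:R + q%:R)).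
    by rewrite /V /W /W2; set sq := Num.sqrt _; ring.
  exact: (frequency_terms_le lR WW0 W20 A0 B0 G0 ABG _ wA wU wG UB SQT).
have ly6 : l%:R ^+ 6 * T <= y ^+ 6 * T by rewrite ler_wpM2r // lerXn2r ?nnegrE ?ler0n.
have yT : y <= y ^+ 6 * T.
  apply: (@le_trans _ _ (y ^+ 6 * 1)); first by rewrite mulr1 ler_eXnr.
  by rewrite ler_wpM2l ?exprn_ge0 // (le_trans B1).
have V2 : V <= (4 + 96 * W + 480 * W2) * (y ^+ 6 * T).
  by apply: (le_trans V1); rewrite ler_wpM2l // !addr_ge0 // mulr_ge0.
by rewrite -/cD -/W -/W2 -[leRHS]mulrA; exact: last_sum V2 tail yT.
Qed.

End Cases.

(** * The theorem *)

(** Enlarging [N] increases every term of the bound, so that a real [N] may be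
    replaced by its integer part. *)
Lemma error_bound_mono (R : realType) (epsilon x N q Delta : R) :
  0 < epsilon -> 0 <= x -> x <= N -> 0 <= q -> 0 <= Delta ->
  error_bound epsilon x q Delta <= error_bound epsilon N q Delta.
Proof.
move=> e0 x0 xN q0 D0; have N0 := le_trans x0 xN.
have pw (e : R) : 0 <= e -> x `^ e <= N `^ e.
  by move=> e1; apply: ge0_ler_powR.
rewrite /error_bound; apply: lerD; last first.
  by rewrite ler_wpM2r ?powR_ge0 // ler_wpM2r // pw // ltW.
apply: lerD; last first.
  have h12 : 0 <= 1 / 2 :> R by rewrite divr_ge0.
  apply: (ge0_ler_powR h12); rewrite ?nnegrE ?mulr_ge0 //.
  by rewrite ler_wpM2r // ler_wpM2l.
apply: lerD; last by rewrite ler_wpM2r ?powR_ge0 // pw // divr_ge0.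
apply: lerD; last by rewrite pw // divr_ge0.
by rewrite ler_wpM2r // powR_ge0.
Qed.

Theorem theorem1 (R : realType) (v : nat) (epsilon : R) :
  (1 <= v)%N -> 0 < epsilon ->
  exists C : R, 0 < C /\
    forall (u : nat) (alpha beta N Delta : R) (a q : int),
      (1 <= u)%N -> coprime u v ->
      irrational alpha ->
      1 <= N ->
      0 < Delta -> Delta < 1 / 2 ->
      coprimez a q ->
      N `^ (1 / 4) < q%:~R ->
      `|alpha * v%:R - a%:~R / q%:~R| <= 1 / q%:~R ^+ 2 ->
      let L := ln (N * q%:~R / Delta) in
      `|\sum_(1 <= n < (Num.truncn N).+1 | n == u %[mod v])
          von_mangoldt R n * (f_Delta Delta (alpha * n%:R - beta) - 2 * Delta)|
      <= C * L ^+ 8 *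
         (N * q%:~R `^ (- (1 / 2)) + N `^ (3 / 4)
          + N `^ (5 / 6) * Delta `^ (1 / 2)
          + (Delta * N * q%:~R) `^ (1 / 2)
          + N `^ epsilon * q%:~R * Delta `^ (1 - epsilon)).
Proof.
move=> v0 e0.
pose k1 := (Num.truncn (2 * pi * (1 + 2) : R)).+1.
have k1_ge : 2 * pi * (1 + 2) <= k1%:R :> R by rewrite ltW // truncnS_gt.
pose e1 := Num.min epsilon (1 / 16) / 4.
have e10 : 0 < e1 by rewrite divr_gt0 // lt_min e0 /= divr_gt0.
have [Cd Cd0 dB] := ndiv_bound e10.
have l2 : 0 < ln 2 :> R by rewrite ln_gt0 // ltr1n.
have l2' : ln 2 <= 1 :> R.
  by have := @le_ln1Dx R 1; rewrite (_ : 1 + 1 = 2) //; apply; lra.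
have C00 : 0 <= sieve_const R k1 := le_trans ler01 (sieve_const_ge1 R k1).
pose Clong : R := 5 + 96 * (v%:R * sieve_const R k1 * (Cd * (32 * v)%:R `^ e1)) + 480 * (v%:R ^+ 2 * sieve_const R k1).
pose Cshort : R := 8 * pi * v%:R * k1%:R + 2.
have Clong1 : 1 <= Clong.
  have : 0 <= v%:R * sieve_const R k1 * (Cd * (32 * v)%:R `^ e1).
    by rewrite mulr_ge0 ?(mulr_ge0 _ C00) // mulr_ge0 ?powR_ge0 // ltW.
  have : 0 <= v%:R ^+ 2 * sieve_const R k1 by rewrite mulr_ge0 ?exprn_ge0.
  by rewrite /Clong; lra.
have Cshort0 : 0 <= Cshort.
  by rewrite addr_ge0 // !mulr_ge0 // pi_ge0.
(* [cy L] dominates every logarithm that occurs: in particular the binary length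
   of [32 v N ^ 4], whose logarithm is [lv + 4 ln N]. *)
pose lv : R := ln (32 * v)%:R.
have lv0 : 0 <= lv by rewrite ln_ge0 // ler1n muln_gt0.
pose cy : R := 1 + (ln 2)^-1 * (5 + (ln 2)^-1 * lv).
have i1 : 1 <= (ln 2)^-1 :> R by rewrite -[leLHS]invr1 lef_pV2 ?posrE.
have i0 : 0 <= (ln 2)^-1 :> R := le_trans ler01 i1.
have ilv : 0 <= (ln 2)^-1 * lv by rewrite mulr_ge0.
have cy1 : 1 <= cy by rewrite lerDl mulr_ge0 // addr_ge0.
have C'0 : 0 <= Clong + Cshort by rewrite addr_ge0 // (le_trans ler01).
exists ((Clong + Cshort) * cy ^+ 8); split.
  by rewrite mulr_gt0 ?exprn_gt0 ?(lt_le_trans ltr01 cy1) // ltr_wpDr // (lt_le_trans ltr01).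
move=> u alpha beta N Delta a q _ _ _ N1 D0 D12 aq Nq approx.
lazy zeta; set L := ln _.
rewrite -/(error_bound epsilon N q%:~R Delta).
have Np : 0 < N := lt_le_trans ltr01 N1.
case: q @L aq Nq approx => [q|q] L aq Nq approx; last first.
  have := lt_trans (powR_gt0 (1 / 4) Np) Nq.
  by rewrite -[0]/(0%:~R) ltr_int.
rewrite -[q%:Z%:~R]/(q%:R : R) in Nq approx L *.
set x := Num.truncn N.
have x0 : (0 < x)%N by rewrite truncn_gt0.
have xN : x%:R <= N by have /andP[] := truncn_itv (ltW Np).
have q0R : 0 < q%:R :> R by exact: le_lt_trans (powR_ge0 _ _) Nq.
have q0 : (0 < q)%N by rewrite -(ltr0n R).
have q1 : 1 <= q%:R :> R by rewrite ler1n.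
have x1 : 1 <= x%:R :> R by rewrite ler1n.
pose L0 := ln (x%:R * q%:R / Delta).
have [L2 Lx Lq] := ln_bounds x1 q1 D0 D12; rewrite -/L0 in L2 Lx Lq.
have L00 : 0 <= L0 by apply: le_trans L2; exact: ltW.
have L0L : L0 <= L.
  rewrite /L0 /L ler_ln ?posrE ?divr_gt0 ?mulr_gt0 ?ltr0n //.
  by rewrite ler_wpM2r ?invr_ge0 ?(ltW D0) // ler_wpM2r.
have iL : 1 <= (ln 2)^-1 * L0 by rewrite mulrC ler_pdivlMr // mul1r.
pose y := cy * L0.
have yE : y = L0 + 5 * ((ln 2)^-1 * L0) + (ln 2)^-1 * lv * ((ln 2)^-1 * L0).
  by rewrite /y /cy; ring.
have cL : (ln 2)^-1 * lv <= (ln 2)^-1 * lv * ((ln 2)^-1 * L0) by rewrite ler_peMr.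
have cL0 : 0 <= (ln 2)^-1 * lv * ((ln 2)^-1 * L0) := le_trans ilv cL.
have y1 : 1 <= y by rewrite yE; lra.
have lny : ln x%:R <= y by rewrite yE; lra.
have hy : harm R q <= y.
  apply: (le_trans (harm_le R (trunc_log_ltn q (isT : 1 < 2)%N))).
  apply: (le_trans (trunc_log2_le q0 (lexx _) l2 Lq)); rewrite yE; lra.
have ly : (trunc_log 2 (32 * v * x ^ 4)).+1%:R <= y.
  have Z0 : (0 < 32 * v * x ^ 4)%N by rewrite muln_gt0 muln_gt0 v0 expn_gt0 x0.
  have lZ : ln (32 * v * x ^ 4)%:R <= lv + 4 * L0.
    rewrite natrM lnM ?posrE ?ltr0n ?muln_gt0 ?expn_gt0 ?x0 ?v0 // natrX lnXn ?ltr0n //.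
    by rewrite -/lv lerD2l -[_ *+ 4]mulr_natl ler_wpM2l.
  apply: (le_trans (trunc_log2_le Z0 (lexx _) l2 lZ)); rewrite yE mulrDr; lra.
have y8 i : (i <= 8)%N -> y ^+ i <= y ^+ 8 by move=> i8; rewrite ler_weXn2l.
set T0 := error_bound epsilon x%:R q%:R Delta.
have TT0 : 0 <= T0 by exact: error_bound_ge0.
have TT : T0 <= error_bound epsilon N q%:R Delta.
  by apply: error_bound_mono => //; exact: ltW.
have xq : x%:R `^ (1 / 4) < q%:R :> R.
  apply: le_lt_trans Nq; apply: ge0_ler_powR; rewrite ?nnegrE ?divr_ge0 //.
  exact: ltW.
apply: (@le_trans _ _ ((Clong + Cshort) * y ^+ 8 * T0)); last first.
  rewrite /y exprMn mulrA; apply: ler_pM => //.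
    by rewrite !mulr_ge0 ?exprn_ge0 // (le_trans ler01).
  rewrite ler_wpM2l ?mulr_ge0 ?exprn_ge0 ?(le_trans ler01 cy1) //.
  by rewrite lerXn2r ?nnegrE // (le_trans L00).
have y60 i : (i <= 8)%N -> forall c, 0 <= c -> c <= Clong + Cshort ->
    c * y ^+ i * T0 <= (Clong + Cshort) * y ^+ 8 * T0.
  move=> i8 c c0 cc; rewrite ler_wpM2r //; apply: ler_pM; rewrite ?exprn_ge0 ?y8 //.
  exact: le_trans ler01 y1.
have Cl0 := le_trans ler01 Clong1.
have [Dx|Dx] := leP Delta (x%:R `^ (- (1 / 4))).
  apply: (le_trans (short_arc beta u e0 v0 x0 q0 D0 D12 aq approx k1_ge y1 lny hy Dx)).
  by apply: y60 => //; rewrite lerDr.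
have [xqD|xqD] := leP x%:R (q%:R * Delta).
  apply: (le_trans (large_denominator alpha beta u v e0 x0 q0 D0 D12 y1 lny xqD)).
  have := y60 1%N isT 1 ler01; rewrite mul1r expr1; apply.
  by apply: (le_trans Clong1); rewrite lerDl.
apply: (le_trans (long_arc beta u e0 v0 x0 q0 D0 D12 aq approx k1_ge y1 lny Cd0 (erefl e1) dB xq Dx xqD ly)).
by apply: y60 => //; rewrite lerDl.
Qed.
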